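(* Let $\mathbf{K}$ be an algebraically closed field, let $\mathcal{D}$ be a $\mathbf{K}$-linear idempotent complete triangulated category, let $\Phi : \mathcal{D} \to \mathcal{D}$ be an exact endofunctor with $\Phi^N\not\cong 0$ for every $N>0$, and let $\Gamma : \mathcal{D} \to D^b(\mathbf{K})$ (resp. $\Gamma : \mathcal{D}^{\mathrm{op}} \to D^b(\mathbf{K})$) be an exact functor. Let $t\in\mathbf{R}$. (1) Let $\mathfrak{a}$ be a bounded t-structure on $\mathcal{D}$ with finite heart $\mathcal{H}_{\mathfrak{a}}$. Assume that $\Gamma(E) \cong \mathbf{K}$ (concentrated in degree $0$) for every simple object $E \in \mathcal{H}_{\mathfrak{a}}$. Then $$\hat{h}_t^{\mathfrak{a}}(\Phi) = \lim_{N \to \infty} \frac{1}{N} \log \sum_{k \in \mathbf{Z}} \dim H^{-k}(\Gamma(\Phi^N(G))) e^{kt}$$ $$\left( \text{resp. } \hat{h}_t^{\mathfrak{a}}(\Phi) = \lim_{N \to \infty} \frac{1}{N} \log \sum_{k \in \mathbf{Z}} \dim H^{-k}(\Gamma(\Phi^N(G))) e^{-kt} \right)$$ for any split-generator $G$ of $\mathcal{D}$. (2) Let $\mathfrak{b}$ be a bounded co-t-structure on $\mathcal{D}$ with finite co-heart $\mathcal{C}_{\mathfrak{b}}$. Assume that $\Gamma(E) \cong \mathbf{K}$ (concentrated in degree $0$) for every indecomposable object $E \in \mathcal{C}_{\mathfrak{b}}$ and that, for any indecomposable objects $E,F \in \mathcal{C}_{\mathfrak{b}}$, a morphism $f \in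 \mathrm{Hom}(E,F)$ is an isomorphism whenever $\Gamma(f) \neq 0$. Then $$\check{h}_t^{\mathfrak{b}}(\Phi) = \lim_{N \to \infty} \frac{1}{N} \log \sum_{k \in \mathbf{Z}} \dim H^{-k}(\Gamma(\Phi^N(G))) e^{kt}$$ $$\left( \text{resp. } \check{h}_t^{\mathfrak{b}}(\Phi) = \lim_{N \to \infty} \frac{1}{N} \log \sum_{k \in \mathbf{Z}} \dim H^{-k}(\Gamma(\Phi^N(G))) e^{-kt} \right)$$ for any split-generator $G$ of $\mathcal{D}$.
   Context: $\Sigma$ is the shift functor of $\mathcal{D}$; $\mathcal{D}^{\mathrm{op}}$ is triangulated with shift $\Sigma^{-1}$. $D^b(\mathbf{K})$ is the bounded derived category of $\mathbf{K}$-vector spaces. An object $G$ is a split-generator of $\mathcal{D}$ if the smallest thick subcategory (triangulated subcategory closed under direct summands) containing $G$ is $\mathcal{D}$. A filtration of $X\in\mathcal{D}$ with factors $X_1,\dots,X_m$ is a sequence $0=Y_0\to Y_1\to\cdots\to Y_m=X$ together with exact triangles $Y_{i-1}\to Y_i\to X_i\to\Sigma Y_{i-1}$ for $1\le i\le m$. Convention: $\log 0=-\infty$. t-structures. A t-structure $\mathfrak{a}=(\mathcal{D}^{\le0},\mathcal{D}^{\ge0})$ is a pair of full (isomorphism-closed) additive subcategories such that, with $\mathcal{D}^{\ge1}:=\Sigma^{-1}\mathcal{D}^{\ge0}$: (i) $\Sigma\mathcal{D}^{\le0}\subset\mathcal{D}^{\le0}$, $\Sigma^{-1}\mathcal{D}^{\ge0}\subset\mathcal{D}^{\ge0}$;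 (ii) $\mathrm{Hom}(E,F)=0$ for $E\in\mathcal{D}^{\le0}$, $F\in\mathcal{D}^{\ge1}$; (iii) every $E$ fits in an exact triangle $D\to E\to F\to\Sigma D$ with $D\in\mathcal{D}^{\le0}$, $F\in\mathcal{D}^{\ge1}$. It is bounded if $\mathcal{D}=\bigcup_{k\in\mathbf{Z}}\Sigma^k\mathcal{D}^{\le0}=\bigcup_{k\in\mathbf{Z}}\Sigma^k\mathcal{D}^{\ge0}$. Its heart $\mathcal{H}_{\mathfrak{a}}=\mathcal{D}^{\le0}\cap\mathcal{D}^{\ge0}$ is abelian; it is finite if every object has a composition series and there are finitely many isomorphism classes of simple objects; $\lambda_{\mathcal{H}_{\mathfrak{a}}}(E)$ is then the length of $E\in\mathcal{H}_{\mathfrak{a}}$. For $\mathfrak{a}$ bounded, each $E\in\mathcal{D}$ has a t-filtration, i.e. a filtration with factors $\Sigma^{k_1}E_1,\dots,\Sigma^{k_m}E_m$, $E_i\in\mathcal{H}_{\mathfrak{a}}$, $k_1>\cdots>k_m$, essentially unique. Put $\hat\delta_t^{\mathfrak{a}}(E)=\sum_{i=1}^m\lambda_{\mathcal{H}_{\mathfrak{a}}}(E_i)e^{k_it}$ and $\hat h_t^{\mathfrak{a}}(\Phi)=\sup_{E\in\mathcal{D}}\limsup_{N\to\infty}\frac1N\log\hat\delta_t^{\mathfrak{a}}(\Phi^N(E))$. Co-t-structures. A co-t-structure $\mathfrak{b}=(\mathcal{D}_{\ge0},\mathcal{D}_{\le0})$ is a pair of full additive subcategories closed under direct summands such that, with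 $\mathcal{D}_{\ge1}:=\Sigma^{-1}\mathcal{D}_{\ge0}$: (i) $\Sigma^{-1}\mathcal{D}_{\ge0}\subset\mathcal{D}_{\ge0}$, $\Sigma\mathcal{D}_{\le0}\subset\mathcal{D}_{\le0}$; (ii) $\mathrm{Hom}(E,F)=0$ for $E\in\mathcal{D}_{\ge1}$, $F\in\mathcal{D}_{\le0}$; (iii) every $E$ fits in an exact triangle $D\to E\to F\to\Sigma D$ with $D\in\mathcal{D}_{\ge1}$, $F\in\mathcal{D}_{\le0}$. It is bounded if $\mathcal{D}=\bigcup_{k\in\mathbf{Z}}\Sigma^k\mathcal{D}_{\ge0}=\bigcup_{k\in\mathbf{Z}}\Sigma^k\mathcal{D}_{\le0}$. Its co-heart $\mathcal{C}_{\mathfrak{b}}=\mathcal{D}_{\ge0}\cap\mathcal{D}_{\le0}$ is finite if it is Krull–Schmidt (every object is a finite direct sum of objects with local endomorphism rings) with finitely many isomorphism classes of indecomposables; $\sigma_{\mathcal{C}_{\mathfrak{b}}}(E)$ is then the number of indecomposable summands of $E\in\mathcal{C}_{\mathfrak{b}}$. For $\mathfrak{b}$ bounded, each $E\in\mathcal{D}$ has a (non-unique) co-t-filtration, i.e. a filtration with factors $\Sigma^{k_1}E_1,\dots,\Sigma^{k_m}E_m$, $E_i\in\mathcal{C}_{\mathfrak{b}}$, $k_1<\cdots<k_m$. Put $\check\delta_t^{\mathfrak{b}}(E)=\inf\sum_{i=1}^m\sigma_{\mathcal{C}_{\mathfrak{b}}}(E_i)e^{k_it}$ over all co-t-filtrations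 of $E$, and $\check h_t^{\mathfrak{b}}(\Phi)=\sup_{E\in\mathcal{D}}\limsup_{N\to\infty}\frac1N\log\check\delta_t^{\mathfrak{b}}(\Phi^N(E))$. *)

(* Defs.v *)
From HB Require Import structures.
From mathcomp Require Import all_boot all_order all_algebra.
From mathcomp Require Import ring_quotient generic_quotient.
From mathcomp Require Import all_classical all_reals all_analysis.
From mathcomp Require Import zify.

Set Implicit Arguments.
Unset Strict Implicit.
Unset Printing Implicit Defensive.

Import Order.TTheory GRing.Theory Num.Theory.
Local Open Scope ring_scope.
Local Open Scope quotient_scope.
Local Open Scope classical_set_scope.

(** * Quotient modules and dimension *)

Section QuotientModule.
Variables (K : fieldType) (V : lmodType K) (W : V -> bool).
Hypothesis Wmod : submod_closed W.

Definition quot_zmod : zmodClosed V :=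
  HB.pack W (GRing.isZmodClosed.Build V W (GRing.submod_closedB Wmod)).

Definition qmod : Type := Quotient.quot quot_zmod.
HB.instance Definition _ := GRing.Zmodule.on qmod.

Definition qpi (x : V) : qmod := \pi_(Quotient.quot quot_zmod) x.
Definition qrepr (x : qmod) : V := repr (x : Quotient.quot quot_zmod).
Definition qscale (a : K) (x : qmod) : qmod := qpi (a *: qrepr x).

Lemma qreprK x : qpi (qrepr x) = x.
Proof. exact: reprK. Qed.

Lemma qpiP x y : qpi x = qpi y <-> x - y \in W.
Proof.
have /= E := Quotient.idealrBE quot_zmod x y.
split=> [xy|xyW]; first by rewrite [_ \in _]E; apply/eqP.
by apply/eqP; rewrite -E.
Qed.

Lemma qpiD x y : qpi (x + y) = qpi x + qpi y.
Proof. exact: (raddfD (\pi_(Quotient.quot quot_zmod))). Qed.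

Lemma qpiZ a x : qpi (a *: x) = qscale a (qpi x).
Proof.
apply/qpiP; rewrite -scalerBr -[X in X \in _]addr0.
have [W0 Wlin] := Wmod; apply: Wlin => //.
by apply/qpiP; rewrite qreprK.
Qed.

Let qscaleA a b x : qscale a (qscale b x) = qscale (a * b) x.
Proof. by rewrite -[x]qreprK -!qpiZ scalerA. Qed.
Let qscale1 : left_id 1 qscale.
Proof. by move=> x; rewrite -[x]qreprK -qpiZ scale1r. Qed.
Let qscaleDr : right_distributive qscale +%R.
Proof.
by move=> a x y; rewrite -[x]qreprK -[y]qreprK -qpiD -!qpiZ scalerDr qpiD.
Qed.
Let qscaleDl x : {morph qscale^~ x : a b / a + b}.
Proof. by move=> a b; rewrite -[x]qreprK -!qpiZ scalerDl qpiD. Qed.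
HB.instance Definition _ :=
  GRing.Zmodule_isLmodule.Build K qmod qscaleA qscale1 qscaleDr qscaleDl.

Lemma qpi_linear : linear qpi.
Proof. by move=> a x y; rewrite qpiD qpiZ. Qed.
HB.instance Definition _ :=
  GRing.isLinear.Build K V qmod *:%R qpi qpi_linear.

End QuotientModule.

Definition lin_indep (K : fieldType) (V : lmodType K) (n : nat)
    (v : 'I_n -> V) : Prop :=
  forall c : 'I_n -> K, \sum_i c i *: v i = 0 -> forall i, c i = 0.

(** The dimension, with values in [\bar R] and possibly [+oo]. *)
Definition dimE (R : realType) (K : fieldType) (V : lmodType K) : \bar R :=
  ereal_sup [set n%:R%:E | n in [set n | exists v : 'I_n -> V, lin_indep v]].

(** * K-linear categories *)

Record lincat (K : fieldType) := LinCat {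
  obj :> Type;
  mor : obj -> obj -> lmodType K;
  idm : forall X, mor X X;
  ccomp : forall X Y Z, mor Y Z -> mor X Y -> mor X Z;
  comp_idl : forall X Y (f : mor X Y), ccomp (idm Y) f = f;
  comp_idr : forall X Y (f : mor X Y), ccomp f (idm X) = f;
  comp_assoc : forall X Y Z T (h : mor Z T) (g : mor Y Z) (f : mor X Y),
    ccomp h (ccomp g f) = ccomp (ccomp h g) f;
  comp_linearl : forall X Y Z (f : mor X Y), linear (fun g : mor Y Z => ccomp g f);
  comp_linearr : forall X Y Z (g : mor Y Z), linear (fun f : mor X Y => ccomp g f)
}.
Arguments idm {K l} X.
Arguments ccomp {K l X Y Z} g f.

Declare Scope cat_scope.
Delimit Scope cat_scope with cat.
Notation "g ∘ f" := (ccomp g f) (at level 40, left associativity) : cat_scope.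
Local Open Scope cat_scope.

Section LinCatTheory.
Variables (K : fieldType) (A : lincat K).

Definition is_iso (X Y : A) (f : mor X Y) : Prop :=
  exists g : mor Y X, g ∘ f = idm X /\ f ∘ g = idm Y.

Definition isomorphic (X Y : A) : Prop := exists f : mor X Y, is_iso f.

Definition is_zero (Z : A) : Prop :=
  forall X, (forall f : mor X Z, f = 0) /\ (forall f : mor Z X, f = 0).

Definition is_dsum (X Y S : A) : Prop :=
  exists (i1 : mor X S) (i2 : mor Y S) (p1 : mor S X) (p2 : mor S Y),
    [/\ p1 ∘ i1 = idm X, p2 ∘ i2 = idm Y, p1 ∘ i2 = 0, p2 ∘ i1 = 0
      & i1 ∘ p1 + i2 ∘ p2 = idm S].

Definition idempotent_complete : Prop :=
  forall (X : A) (e : mor X X), e ∘ e = e ->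
    exists (Y : A) (p : mor X Y) (s : mor Y X), p ∘ s = idm Y /\ s ∘ p = e.

(** Full subcategories are given by predicates on objects. *)

Definition iso_closed (P : A -> Prop) : Prop :=
  forall X Y, isomorphic X Y -> P X -> P Y.

Definition additive_sub (P : A -> Prop) : Prop :=
  (exists Z, is_zero Z /\ P Z) /\
  (forall X Y S, is_dsum X Y S -> P X -> P Y -> P S).

Definition summand_closed (P : A -> Prop) : Prop :=
  forall X Y S, is_dsum X Y S -> P S -> P X.

Definition finitely_many_iso (P : A -> Prop) : Prop :=
  exists (n : nat) (S : 'I_n -> A), forall X, P X -> exists i, isomorphic X (S i).

(** Notions relative to the full subcategory [P]. *)

Definition mono_in (P : A -> Prop) (X Y : A) (f : mor X Y) : Prop :=
  forall T (g : mor T X), P T -> f ∘ g = 0 -> g = 0.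

Definition coker_in (P : A -> Prop) (X Y C : A) (f : mor X Y) (q : mor Y C) :
    Prop :=
  q ∘ f = 0 /\
  forall T (g : mor Y T), P T -> g ∘ f = 0 -> exists! g' : mor C T, g' ∘ q = g.

Definition simple_in (P : A -> Prop) (X : A) : Prop :=
  [/\ P X, ~ is_zero X
    & forall Y (f : mor Y X), P Y -> mono_in P f -> is_zero Y \/ is_iso f].

(** [comp_series P X n]: there are subobjects [0 = X_0 -> ... -> X_n = X] in [P]
    whose successive quotients are simple in [P]. *)
Inductive comp_series (P : A -> Prop) : A -> nat -> Prop :=
| comp_series0 Z of P Z & is_zero Z : comp_series P Z 0
| comp_seriesS X Y S n (f : mor X Y) (q : mor Y S) of
    comp_series P X n & P Y & simple_in P S & mono_in P f & coker_in P f q :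
    comp_series P Y n.+1.

(** The length of a chosen composition series; by Jordan-Hoelder the choice is
    irrelevant.  Junk value [0] if there is none. *)
Definition length_in (P : A -> Prop) (X : A) : nat :=
  xget 0%N [set n | comp_series P X n].

Definition indecomposable_in (P : A -> Prop) (X : A) : Prop :=
  [/\ P X, ~ is_zero X
    & forall Y Z, P Y -> P Z -> is_dsum Y Z X -> is_zero Y \/ is_zero Z].

(** The ring [End X] is local: it is nonzero and its non-units are closed under
    addition. *)
Definition local_end (X : A) : Prop :=
  idm X <> 0 /\
  forall f g : mor X X, ~ is_iso f -> ~ is_iso g -> ~ is_iso (f + g).

(** [dsum_of Q n X]: [X] is a direct sum of [n] objects satisfying [Q]. *)
Inductive dsum_of (Q : A -> Prop) : nat -> A -> Prop :=
| dsum_of0 Z of is_zero Z : dsum_of Q 0 Z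
| dsum_ofS X Y S n of Q X & dsum_of Q n Y & is_dsum X Y S : dsum_of Q n.+1 S.

Definition krull_schmidt (P : A -> Prop) : Prop :=
  forall X, P X -> exists n, dsum_of (fun Y => P Y /\ local_end Y) n X.

Definition num_indec (P : A -> Prop) (X : A) : nat :=
  xget 0%N [set n | dsum_of (indecomposable_in P) n X].

End LinCatTheory.

Record functor (K : fieldType) (A B : lincat K) := Functor {
  fobj :> A -> B;
  fmor : forall X Y, mor X Y -> mor (fobj X) (fobj Y);
  fmap_id : forall X, fmor (idm X) = idm (fobj X);
  fmap_comp : forall X Y Z (g : mor Y Z) (f : mor X Y),
    fmor (g ∘ f) = fmor g ∘ fmor f
}.
Arguments fmor {K A B} _ {X Y} _.

Definition additive_functor (K : fieldType) (A B : lincat K) (F : functor A B) :=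
  forall (X Y : A) (f g : mor X Y), fmor F (f + g) = fmor F f + fmor F g.

Definition linear_functor (K : fieldType) (A B : lincat K) (F : functor A B) :=
  forall X Y : A, linear (fun f : mor X Y => fmor F f).

(** * Triangulated categories *)

(** [dist f g h]: the triangle [X --f--> Y --g--> Z --h--> Sigma X] is exact. *)
Record shiftcat (K : fieldType) := ShiftCat {
  shiftcat_lin :> lincat K;
  sh : functor shiftcat_lin shiftcat_lin;
  dist : forall X Y Z : shiftcat_lin,
    mor X Y -> mor Y Z -> mor Z (sh X) -> Prop
}.
Arguments sh {K s}.
Arguments dist {K s X Y Z} f g h.

(** Shift functors are autoequivalences [sh] with a chosen quasi-inverse [ush];
    strict automorphisms are a special case. *)
Record tricat (K : fieldType) := TriCat {
  tricat_shift :> shiftcat K;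
  ush : functor tricat_shift tricat_shift;
  sh_linear : linear_functor (sh (s := tricat_shift));
  ush_linear : linear_functor ush;
  sh_ush : forall X : tricat_shift, mor (sh (ush X)) X;
  sh_ush_iso : forall X, is_iso (sh_ush X);
  sh_ush_nat : forall X Y (f : mor X Y),
    f ∘ sh_ush X = sh_ush Y ∘ fmor sh (fmor ush f);
  ush_sh : forall X : tricat_shift, mor (ush (sh X)) X;
  ush_sh_iso : forall X, is_iso (ush_sh X);
  ush_sh_nat : forall X Y (f : mor X Y),
    f ∘ ush_sh X = ush_sh Y ∘ fmor ush (fmor sh f);
  zero_ex : exists Z : tricat_shift, is_zero Z;
  dsum_ex : forall X Y : tricat_shift, exists S, is_dsum X Y S;
  dist_iso : forall (X Y Z X' Y' Z' : tricat_shift)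
    (f : mor X Y) (g : mor Y Z) (h : mor Z (sh X))
    (f' : mor X' Y') (g' : mor Y' Z') (h' : mor Z' (sh X'))
    (a : mor X X') (b : mor Y Y') (c : mor Z Z'),
    is_iso a -> is_iso b -> is_iso c ->
    b ∘ f = f' ∘ a -> c ∘ g = g' ∘ b -> fmor sh a ∘ h = h' ∘ c ->
    dist f g h -> dist f' g' h';
  dist_id : forall X Z : tricat_shift, is_zero Z ->
    dist (idm X) (0 : mor X Z) (0 : mor Z (sh X));
  dist_ex : forall (X Y : tricat_shift) (f : mor X Y),
    exists (Z : tricat_shift) (g : mor Y Z) (h : mor Z (sh X)), dist f g h;
  dist_rot : forall (X Y Z : tricat_shift)
    (f : mor X Y) (g : mor Y Z) (h : mor Z (sh X)),
    dist f g h <-> dist g h (- fmor sh f);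
  dist_mor : forall (X Y Z X' Y' Z' : tricat_shift)
    (f : mor X Y) (g : mor Y Z) (h : mor Z (sh X))
    (f' : mor X' Y') (g' : mor Y' Z') (h' : mor Z' (sh X'))
    (a : mor X X') (b : mor Y Y'),
    dist f g h -> dist f' g' h' -> b ∘ f = f' ∘ a ->
    exists c : mor Z Z', c ∘ g = g' ∘ b /\ fmor sh a ∘ h = h' ∘ c;
  octahedron : forall (X Y Z X' Y' Z' : tricat_shift)
    (u : mor X Y) (j : mor Y Z') (k : mor Z' (sh X))
    (v : mor Y Z) (l : mor Z X') (i : mor X' (sh Y))
    (m : mor Z Y') (n : mor Y' (sh X)),
    dist u j k -> dist v l i -> dist (v ∘ u) m n ->
    exists (f : mor Z' Y') (g : mor Y' X'),
      dist f g (fmor sh j ∘ i) /\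
      [/\ l = g ∘ m, k = n ∘ f, m ∘ v = f ∘ j & fmor sh u ∘ n = i ∘ g]
}.
Arguments ush {K t}.
Arguments sh_ush {K t} X.
Arguments ush_sh {K t} X.

(** Exact functors only involve the shifts and the exact triangles. *)
Record exact_functor (K : fieldType) (A B : shiftcat K) := ExactFunctor {
  ex_functor :> functor A B;
  ex_additive : additive_functor ex_functor;
  ex_sh : forall X : A, mor (ex_functor (sh X)) (sh (ex_functor X));
  ex_sh_iso : forall X, is_iso (ex_sh X);
  ex_sh_nat : forall X Y (f : mor X Y),
    fmor sh (fmor ex_functor f) ∘ ex_sh X = ex_sh Y ∘ fmor ex_functor (fmor sh f);
  ex_dist : forall (X Y Z : A) (f : mor X Y) (g : mor Y Z) (h : mor Z (sh X)),
    dist f g h ->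
    dist (fmor ex_functor f) (fmor ex_functor g) (ex_sh X ∘ fmor ex_functor h)
}.

(** The opposite triangulated category, with shift [ush].  A triangle
    [X -> Y -> Z -> ush X] of the opposite category, given by [f : Y -> X],
    [g : Z -> Y], [h : ush X -> Z], is exact when [Z -> Y -> X -> sh Z] is, the
    last morphism being [sh h] up to [sh (ush X) ~= X]. *)
Section Opposite.
Variables (K : fieldType) (D : tricat K).

Definition op_lincat : lincat K :=
  @LinCat K D (fun X Y => mor Y X) (fun X => idm X) (fun X Y Z g f => f ∘ g)
    (fun X Y f => comp_idr f) (fun X Y f => comp_idl f)
    (fun X Y Z T h g f => esym (comp_assoc f g h))
    (fun X Y Z f => @comp_linearr K D Z Y X f)
    (fun X Y Z g => @comp_linearl K D Z Y X g).

Definition op_ush : functor op_lincat op_lincat :=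
  @Functor K op_lincat op_lincat (fun X => ush (X : D))
    (fun X Y f => fmor ush (f : mor (Y : D) X)) (fun X => fmap_id ush (X : D))
    (fun X Y Z g f => fmap_comp ush (f : mor (Y : D) X) g).

Definition op_dist (X Y Z : D) (f : mor Y X) (g : mor Z Y) (h : mor (ush X) Z) :
    Prop :=
  exists2 k : mor X (sh Z), k ∘ sh_ush X = fmor sh h & dist g f k.

Definition op_shiftcat : shiftcat K := @ShiftCat K op_lincat op_ush op_dist.

End Opposite.

(** * The bounded derived category of K-vector spaces *)

Record bcomplex (K : fieldType) := BComplex {
  cx :> int -> lmodType K;
  cd : forall i, {linear cx i -> cx (i + 1)};
  cdd : forall i x, cd (i + 1) (cd i x) = 0;
  cx_bounded : exists n : nat, forall i : int, (n < `|i|)%N ->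
    forall x : cx i, x = 0
}.
Arguments cd {K} b i.

Section Cohomology.
Variables (K : fieldType) (C : bcomplex K) (i : int).

Definition cocycle : {pred C i} := fun x => cd C i x == 0.

Fact cocycle_submod : submod_closed cocycle.
Proof.
split=> [|a x y]; rewrite !unfold_in; first by rewrite linear0.
by move=> /eqP xZ /eqP yZ; rewrite linearP xZ yZ scaler0 addr0.
Qed.
HB.instance Definition _ :=
  GRing.isSubmodClosed.Build K (C i) cocycle cocycle_submod.

Record Z_space := ZSpace { zval :> C i; zvalP : zval \in cocycle }.
HB.instance Definition _ := [isSub for zval].
HB.instance Definition _ := [Choice of Z_space by <:].
HB.instance Definition _ := [SubChoice_isSubLmodule of Z_space by <:].
End Cohomology.
Arguments cocycle {K} C i.

Inductive is_boundary (K : fieldType) (C : bcomplex K) : forall i, C i -> Prop :=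
| IsBoundary j (y : C j) : is_boundary (cd C j y).

(** Casts along [i = (i - 1) + 1]: a family given in the degrees [i + 1] is a
    family given in all degrees. *)
Definition all_degrees (T : int -> Type) (F : forall i, T (i + 1)) (j : int) :
    T j :=
  eq_rect (j - 1 + 1) T (F (j - 1)) j (subrK 1 j).

Lemma all_degreesE (T : int -> Type) (F : forall i, T (i + 1)) i :
  all_degrees F (i + 1) = F i.
Proof.
rewrite /all_degrees; have e : i + 1 - 1 = i by rewrite addrK.
move: (subrK 1 (i + 1)); move: (i + 1 - 1) e => j -> e.
by rewrite (eq_irrelevance e erefl).
Qed.

Section CohomologyQuotient.
Variables (K : fieldType) (C : bcomplex K).

Lemma is_boundaryS i (x : C (i + 1)) :
  is_boundary x <-> exists y, x = cd C i y.
Proof.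
split=> [bx|[y ->]]; last exact: IsBoundary.
suff H j (z : C j) : is_boundary z -> forall e : j = i + 1,
    exists y, eq_rect j (fun k => C k : Type) z (i + 1) e = cd C i y by exact: (H _ _ bx erefl).
case=> {}j {}z e; have ji : j = i by apply: (addIr 1).
by subst j; rewrite (eq_irrelevance e erefl); exists z.
Qed.

Definition boundary i : Z_space C i -> bool :=
  fun z => `[< is_boundary (zval z) >].

Fact boundary_submod i : submod_closed (@boundary i).
Proof.
move: i; apply: all_degrees => i; split=> [|a x y].
  apply/asboolP/is_boundaryS; exists 0; rewrite linear0.
  exact: (raddf0 (\val : Z_space C (i + 1) -> _)).
move=> /asboolP/is_boundaryS[x' ex] /asboolP/is_boundaryS[y' ey].
apply/asboolP/is_boundaryS; exists (a *: x' + y').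
rewrite linearP -ex -ey.
exact: (linearP (\val : Z_space C (i + 1) -> _)).
Qed.

Definition cohomology (i : int) : lmodType K := qmod (@boundary_submod i).

End CohomologyQuotient.

Section ChainMaps.
Variables (K : fieldType) (C D : bcomplex K).

Definition graded_map : Type := forall i : int, C i -> D i.
HB.instance Definition _ := Choice.on graded_map.

Section GradedMapLmodule.
Implicit Types f g h : graded_map.
Let add f g : graded_map := fun i x => f i x + g i x.
Let opp f : graded_map := fun i x => - f i x.
Let zero : graded_map := fun i x => 0.
Let scale (a : K) f : graded_map := fun i x => a *: f i x.
Let ext f g : (forall i x, f i x = g i x) -> f = g.
Proof. by move=> fg; apply: functional_extensionality_dep => i; apply/funext. Qed.
Let addA : associative add.
Proof. by move=> f g h; apply: ext => i x; rewrite /add addrA. Qed.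
Let addC : commutative add.
Proof. by move=> f g; apply: ext => i x; rewrite /add addrC. Qed.
Let add0 : left_id zero add.
Proof. by move=> f; apply: ext => i x; rewrite /add add0r. Qed.
Let addN : left_inverse zero opp add.
Proof. by move=> f; apply: ext => i x; rewrite /add addNr. Qed.
HB.instance Definition _ :=
  GRing.isZmodule.Build graded_map addA addC add0 addN.
Let scaleA a b f : scale a (scale b f) = scale (a * b) f.
Proof. by apply: ext => i x; rewrite /scale scalerA. Qed.
Let scale1 : left_id 1 scale.
Proof. by move=> f; apply: ext => i x; rewrite /scale scale1r. Qed.
Let scaleDr : right_distributive scale +%R.
Proof. by move=> a f g; apply: ext => i x; rewrite /scale scalerDr. Qed.
Let scaleDl f : {morph scale^~ f : a b / a + b}.
Proof. by move=> a b; apply: ext => i x; rewrite /scale scalerDl. Qed.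
HB.instance Definition _ :=
  GRing.Zmodule_isLmodule.Build K graded_map scaleA scale1 scaleDr scaleDl.
End GradedMapLmodule.

Definition is_chain_map (f : graded_map) : Prop :=
  (forall i, linear (f i)) /\ (forall i x, f (i + 1) (cd C i x) = cd D i (f i x)).

Definition chain_mapb : graded_map -> bool := fun f => `[< is_chain_map f >].

Fact chain_mapb_submod : submod_closed chain_mapb.
Proof.
split=> [|a f g].
  apply/asboolP; split=> [i b x y|i x] /=; first by rewrite scaler0 addr0.
  by rewrite linear0.
move=> /asboolP[fl fd] /asboolP[gl gd]; apply/asboolP; split=> [i b x y|i x].
- have E z : (a *: f + g) i z = a *: f i z + g i z by [].
  by rewrite !E fl gl !scalerDr !scalerA mulrC addrACA.
- have E j z : (a *: f + g) j z = a *: f j z + g j z by [].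
  by rewrite !E fd gd linearP.
Qed.
HB.instance Definition _ :=
  GRing.isSubmodClosed.Build K graded_map chain_mapb chain_mapb_submod.

Record chain_map := ChainMap {
  cm_fun : graded_map;
  cm_in : cm_fun \in (chain_mapb : {pred graded_map})
}.
HB.instance Definition _ := [isSub for cm_fun].
HB.instance Definition _ := [Choice of chain_map by <:].
HB.instance Definition _ := [SubChoice_isSubLmodule of chain_map by <:].

Definition cm_app (f : chain_map) : forall i, C i -> D i := cm_fun f.
Coercion cm_app : chain_map >-> Funclass.

Lemma cm_linear (f : chain_map) i : linear (f i).
Proof. by case: f => f /= /asboolP[]. Qed.

Lemma cm_linear0 (f : chain_map) i : f i 0 = 0.
Proof. by have := @cm_linear f i (-1) 0 0; rewrite scaler0 addr0 scaleN1r addNr. Qed.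

Lemma cm_linearD (f : chain_map) i x y : f i (x + y) = f i x + f i y.
Proof. by have := @cm_linear f i 1 x y; rewrite !scale1r. Qed.

Lemma cm_linearN (f : chain_map) i x : f i (- x) = - f i x.
Proof.
by have := @cm_linear f i (-1) x 0; rewrite !scaleN1r !addr0 cm_linear0 addr0.
Qed.

Lemma cm_d (f : chain_map) i x : f (i + 1) (cd C i x) = cd D i (f i x).
Proof. by case: f => f /= /asboolP[]. Qed.

Lemma cm_ext (f g : chain_map) : (forall i x, f i x = g i x) -> f = g.
Proof.
move=> fg; apply/val_inj; apply: functional_extensionality_dep => i.
exact/funext.
Qed.

(** [f = d h + h d] for a family of linear maps [h i : C (i + 1) -> D i]. *)
Definition null_homotopic (f : chain_map) : Prop :=
  exists h : forall i, C (i + 1) -> D i,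
    (forall i, linear (h i)) /\
    (forall i x, f (i + 1) x = cd D i (h i x) + h (i + 1) (cd C (i + 1) x)).

Definition null_homotopicb : chain_map -> bool := fun f => `[< null_homotopic f >].

Fact null_homotopic_submod : submod_closed null_homotopicb.
Proof.
split=> [|a f g].
  apply/asboolP; exists (fun i x => 0); split=> [i b x y|i x] /=.
    by rewrite scaler0 addr0.
  by rewrite linear0 addr0.
move=> /asboolP[h [hl hP]] /asboolP[k [kl kP]]; apply/asboolP.
exists (fun i x => a *: h i x + k i x); split=> [i b x y|i x].
  by rewrite hl kl !scalerDr !scalerA mulrC addrACA.
have -> : (a *: f + g) (i + 1) x = a *: f (i + 1) x + g (i + 1) x by [].
by rewrite hP kP linearP scalerDr addrACA.
Qed.

Definition db_hom : lmodType K := qmod null_homotopic_submod.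

Definition db_class (f : chain_map) : db_hom := qpi null_homotopic_submod f.

End ChainMaps.

Section HomotopyCategory.
Variable K : fieldType.
Implicit Types C D E : bcomplex K.

Definition chain_id C : chain_map C C.
Proof.
apply: (@ChainMap K C C (fun i x => x)).
by apply/asboolP; split=> [i a x y|i x].
Defined.

Definition chain_comp C D E (g : chain_map D E) (f : chain_map C D) :
  chain_map C E.
Proof.
apply: (@ChainMap K C E (fun i x => g i (f i x))).
by apply/asboolP; split=> [i a x y|i x]; rewrite ?cm_linear ?cm_d.
Defined.

Definition db_comp C D E (g : db_hom D E) (f : db_hom C D) : db_hom C E :=
  db_class (chain_comp (qrepr g) (qrepr f)).

Lemma db_classP C D (f g : chain_map C D) :
  db_class f = db_class g <-> null_homotopic (f - g).
Proof.
rewrite /db_class; split=> [/qpiP/asboolP //|H].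
by apply/qpiP/asboolP.
Qed.

Lemma qreprKd C D (f : db_hom C D) : db_class (qrepr f) = f.
Proof. exact: qreprK. Qed.

Lemma db_compE C D E (g : chain_map D E) (f : chain_map C D) :
  db_comp (db_class g) (db_class f) = db_class (chain_comp g f).
Proof.
apply/db_classP; set g' := qrepr _; set f' := qrepr _.
have /db_classP[h [hl hP]] : db_class g' = db_class g by rewrite qreprKd.
have /db_classP[k [kl kP]] : db_class f' = db_class f by rewrite qreprKd.
have Bg i x : g' i x = (g' - g) i x + g i x.
  have -> : (g' - g) i x = g' i x - g i x by [].
  by rewrite subrK.
have Bf i x : f' i x = (f' - f) i x + f i x.
  have -> : (f' - f) i x = f' i x - f i x by [].
  by rewrite subrK.
exists (fun i x => h i (f' (i + 1) x) + g i (k i x)); split=> [i a x y|i x].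
  by rewrite cm_linear hl kl cm_linear scalerDr addrACA.
have -> : (chain_comp g' f' - chain_comp g f) (i + 1) x =
  g' (i + 1) (f' (i + 1) x) - g (i + 1) (f (i + 1) x) by [].
rewrite Bg hP {3}Bf kP !cm_linearD !cm_d linearD [in RHS]/= -!cm_d !addrA addrK.
by congr (_ + _); rewrite addrAC.
Qed.

Lemma db_classD C D (f g : chain_map C D) :
  db_class (f + g) = db_class f + db_class g.
Proof. exact: qpiD. Qed.

Lemma db_classL C D a (f g : chain_map C D) :
  db_class (a *: f + g) = a *: db_class f + db_class g.
Proof. exact: qpi_linear. Qed.

Let db_idl C D (f : db_hom C D) : db_comp (db_class (chain_id D)) f = f.
Proof.
by rewrite -[f]qreprKd db_compE; congr db_class; apply: cm_ext.
Qed.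

Let db_idr C D (f : db_hom C D) : db_comp f (db_class (chain_id C)) = f.
Proof.
by rewrite -[f]qreprKd db_compE; congr db_class; apply: cm_ext.
Qed.

Let db_assoc B C D E (h : db_hom D E) (g : db_hom C D) (f : db_hom B C) :
  db_comp h (db_comp g f) = db_comp (db_comp h g) f.
Proof.
rewrite -[f]qreprKd -[g]qreprKd -[h]qreprKd !db_compE.
by congr db_class; apply: cm_ext.
Qed.

Let db_linearl C D E (f : db_hom C D) : linear (fun g : db_hom D E => db_comp g f).
Proof.
move=> a g g'; rewrite -[f]qreprKd -[g]qreprKd -[g']qreprKd -db_classL !db_compE.
by rewrite -db_classL; congr db_class; apply: cm_ext.
Qed.

Let db_linearr C D E (g : db_hom D E) : linear (fun f : db_hom C D => db_comp g f).
Proof.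
move=> a f f'; rewrite -[f]qreprKd -[g]qreprKd -[f']qreprKd -db_classL !db_compE.
rewrite -db_classL; congr db_class; apply: cm_ext => i x.
exact: cm_linear.
Qed.

Definition db_lincat : lincat K :=
  @LinCat K (bcomplex K) (@db_hom K) (fun C => db_class (chain_id C)) db_comp
    db_idl db_idr db_assoc db_linearl db_linearr.

(** The shift [(Sigma C)^i = C^(i+1)], with differential [- d]. *)
Definition cx_sh C : bcomplex K.
Proof.
apply: (@BComplex K (fun i => C (i + 1)) (fun i => \- cd C (i + 1))).
- by move=> i x /=; rewrite linearN cdd !oppr0.
- have [n Cn] := cx_bounded C; exists n.+1 => i ni; apply: Cn.
  by lia.
Defined.

Definition chain_sh C D (f : chain_map C D) : chain_map (cx_sh C) (cx_sh D).
Proof.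
apply: (@ChainMap K (cx_sh C) (cx_sh D) (fun i x => f (i + 1) x)).
apply/asboolP; split=> [i|i x]; first exact: (@cm_linear _ _ _ f).
by rewrite /= cm_linearN cm_d.
Defined.

Lemma chain_sh_null C D (f : chain_map C D) :
  null_homotopic f -> null_homotopic (chain_sh f).
Proof.
move=> [h [hl hP]]; exists (fun i x => - h (i + 1) x); split=> [i a x y|i x].
  by rewrite hl opprD scalerN.
have hN j y : h j (- y) = - h j y.
  have h0 : h j 0 = 0 by have := hl j (-1) 0 0; rewrite scaler0 addr0 scaleN1r addNr.
  by have := hl j (-1) y 0; rewrite !scaleN1r !addr0 h0 addr0.
by rewrite /= linearN opprK hN opprK; exact: hP.
Qed.

Definition db_sh_map C D (f : db_hom C D) : db_hom (cx_sh C) (cx_sh D) :=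
  db_class (chain_sh (qrepr f)).

Lemma db_sh_mapE C D (f : chain_map C D) :
  db_sh_map (db_class f) = db_class (chain_sh f).
Proof.
apply/db_classP; set f' := qrepr _.
have /db_classP/chain_sh_null : db_class f' = db_class f by rewrite qreprKd.
by congr null_homotopic; apply: cm_ext.
Qed.

Let db_sh_id C : db_sh_map (idm (C : db_lincat)) = idm (cx_sh C : db_lincat).
Proof. by rewrite /= db_sh_mapE; congr db_class; apply: cm_ext. Qed.

Let db_sh_comp C D E (g : mor (D : db_lincat) E) (f : mor (C : db_lincat) D) :
  db_sh_map (g ∘ f) = (db_sh_map g : mor (cx_sh D : db_lincat) _) ∘ db_sh_map f.
Proof.
rewrite -[f]qreprKd -[g]qreprKd /= db_compE !db_sh_mapE db_compE.
by congr db_class; apply: cm_ext.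
Qed.

Definition db_sh : functor db_lincat db_lincat :=
  @Functor K db_lincat db_lincat cx_sh db_sh_map db_sh_id db_sh_comp.

(** The mapping cone [C^(i+1) * D^i], with differential
    [(c, e) |-> (- d c, f c + d e)]. *)
Section Cone.
Variables (C D : bcomplex K) (f : chain_map C D).

Definition cone_cx (i : int) : lmodType K := (C (i + 1)%R * D i)%type.

Definition cone_d i (x : cone_cx i) : cone_cx (i + 1) :=
  (- cd C (i + 1) x.1, f (i + 1) x.1 + cd D i x.2).

Fact cone_d_linear i : linear (@cone_d i).
Proof.
move=> a x y; rewrite /cone_d /= !linearP !cm_linear; congr pair.
by rewrite /= scalerDr addrACA.
Qed.
HB.instance Definition _ i :=
  GRing.isLinear.Build K (cone_cx i) (cone_cx (i + 1)) *:%R (@cone_d i)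
    (@cone_d_linear i).

Definition cone : bcomplex K.
Proof.
apply: (@BComplex K cone_cx (fun i => @cone_d i)).
- move=> i x; rewrite /= /cone_d /= linearN cdd !oppr0; congr pair.
  by rewrite linearD cdd addr0 cm_linearN cm_d addNr.
- have [n Cn] := cx_bounded C; have [m Dm] := cx_bounded D.
  exists (n + m).+1 => i ni [x y]; rewrite (Cn _ _ x); last by lia.
  by rewrite (Dm _ _ y) //; lia.
Defined.

Definition cone_in : chain_map D cone.
Proof.
apply: (@ChainMap K D cone (fun i x => (0, x))).
apply/asboolP; split=> [i a x y|i x] /=.
  by congr pair; rewrite /= scaler0 addr0.
by rewrite /cone_d /= linear0 oppr0 cm_linear0 add0r.
Defined.

Definition cone_pr : chain_map cone (cx_sh C).
Proof.
apply: (@ChainMap K cone (cx_sh C) (fun i x => x.1)).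
by apply/asboolP; split.
Defined.

End Cone.

(** The exact triangles are those isomorphic to some
    [C -> D -> cone f -> Sigma C]. *)
Definition db_dist (X Y Z : db_lincat) (u : mor X Y) (v : mor Y Z)
    (w : mor Z (db_sh X)) : Prop :=
  exists (C D : db_lincat) (f : chain_map C D)
    (a : mor C X) (b : mor D Y) (c : mor (cone f : db_lincat) Z),
    [/\ is_iso a, is_iso b & is_iso c] /\
    [/\ b ∘ db_class f = u ∘ a, c ∘ db_class (cone_in f) = v ∘ b
      & fmor db_sh a ∘ db_class (cone_pr f) = w ∘ c].

(** [D^b(K)].  Since [K] is a field, quasi-isomorphisms are already invertible up
    to homotopy (lemma [quasi_iso_is_iso] below): inverting them does not change
    the homotopy category of bounded complexes, which is thus [D^b(K)]. *)
Definition Db : shiftcat K := @ShiftCat K db_lincat db_sh db_dist.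

Definition unit_cx : bcomplex K.
Proof.
apply: (@BComplex K
  (fun i : int => if i == 0 then (K^o : lmodType K) else ('rV[K]_0 : lmodType K))
  (fun i => \0)) => //.
by exists 0%N => i i0; case: eqP => [i0'|_ x]; [lia | exact: thinmx0].
Defined.

End HomotopyCategory.

(** * Quasi-isomorphisms are isomorphisms in [Db] *)

Section InducedMap.
Variables (K : fieldType) (C D : bcomplex K) (f : chain_map C D).

Fact Z_map_subproof i (z : Z_space C i) : f i (zval z) \in cocycle D i.
Proof.
rewrite unfold_in; apply/eqP; rewrite -cm_d.
by have := zvalP z; rewrite unfold_in => /eqP ->; rewrite cm_linear0.
Qed.

Definition Z_map i (z : Z_space C i) : Z_space D i := ZSpace (Z_map_subproof z).

Definition cohomology_map i (x : cohomology C i) : cohomology D i :=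
  qpi (@boundary_submod K D i) (Z_map (qrepr x)).

Definition quasi_iso : Prop := forall i, bijective (@cohomology_map i).

Let zvalB (E : bcomplex K) i (x y : Z_space E i) : zval (x - y) = zval x - zval y.
Proof. exact: (raddfB (\val : Z_space E i -> _)). Qed.

Let zval0 (E : bcomplex K) i : zval (0 : Z_space E i) = 0.
Proof. exact: (raddf0 (\val : Z_space E i -> _)). Qed.

Let cm_B i x y : f i (x - y) = f i x - f i y.
Proof. by rewrite cm_linearD cm_linearN. Qed.

Lemma cohomology_mapE i (z : Z_space C i) :
  cohomology_map (qpi (@boundary_submod K C i) z) =
  qpi (@boundary_submod K D i) (Z_map z).
Proof.
move: i z; apply: all_degrees => i z.
have /qpiP/asboolP/is_boundaryS[y] :=
  qreprK (qpi (@boundary_submod K C (i + 1)) z).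
rewrite zvalB => ey; apply/qpiP/asboolP/is_boundaryS; exists (f i y).
by rewrite zvalB /= -cm_B ey cm_d.
Qed.

Lemma quasi_iso_inj : quasi_iso -> forall i (x : C (i + 1)) (y : D i),
  cd C (i + 1) x = 0 -> f (i + 1) x = cd D i y -> exists z, x = cd C i z.
Proof.
move=> qf i x y dx fx.
have Zx : x \in cocycle C (i + 1) by rewrite unfold_in dx.
pose z := ZSpace Zx; have /bij_inj injf := qf (i + 1).
have /injf/qpiP/asboolP/is_boundaryS[w] :
    cohomology_map (qpi (@boundary_submod K C (i + 1)) z) =
    cohomology_map (qpi (@boundary_submod K C (i + 1)) 0).
  rewrite !cohomology_mapE; apply/qpiP/asboolP/is_boundaryS; exists y.
  rewrite zvalB [zval (Z_map z)]fx.
  have -> : zval (Z_map (0 : Z_space C (i + 1))) = f (i + 1) (zval 0) by [].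
  by rewrite zval0 cm_linear0 subr0.
by rewrite subr0 => ex; exists w.
Qed.

Lemma quasi_iso_surj : quasi_iso -> forall i (y : D (i + 1)),
  cd D (i + 1) y = 0 ->
  exists (x : C (i + 1)) (z : D i), cd C (i + 1) x = 0 /\ y = f (i + 1) x + cd D i z.
Proof.
move=> qf i y dy.
have Zy : y \in cocycle D (i + 1) by rewrite unfold_in dy.
have [g _ gK] := qf (i + 1).
pose q := qpi (@boundary_submod K D (i + 1)) (ZSpace Zy).
have : cohomology_map (qpi (@boundary_submod K C (i + 1)) (qrepr (g q))) = q.
  by rewrite qreprK gK.
rewrite cohomology_mapE => /esym/qpiP/asboolP/is_boundaryS[z].
rewrite zvalB /= => ez; exists (zval (qrepr (g q))), z; split.
  by have := zvalP (qrepr (g q)); rewrite unfold_in => /eqP.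
by rewrite -ez; move: (f _ _) => u; rewrite [RHS]addrC subrK.
Qed.

End InducedMap.

Section GeneralizedInverse.
Variable K : fieldType.

Lemma complement_ex (V : lmodType K) (W : set V) :
  W 0 -> (forall a x y, W x -> W y -> W (a *: x + y)) ->
  exists T : set V, [/\ T 0, forall a x y, T x -> T y -> T (a *: x + y),
    forall x, W x -> T x -> x = 0
    & forall v, exists w u, [/\ W w, T u & v = w + u]].
Proof.
move=> W0 Wlin.
pose P (A : set V) := (forall a x y, A x -> A y -> A (a *: x + y)) /\
  (forall x, W x -> A x -> x = 0).
have [|T [[Tlin TW] Tmax]] := @Zorn_bigcup V P.
- move=> F FP Ftot; split=> [a x y [A FA Ax] [B FB By]|x Wx [A FA Ax]].
    have [AB|BA] := Ftot _ _ FA FB.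
      by exists B => //; apply: (FP _ FB).1 => //; apply: AB.
    by exists A => //; apply: (FP _ FA).1 => //; apply: BA.
  exact: (FP _ FA).2.
have T0 : T 0.
  apply: contrapT => nT0; apply: (Tmax [set 0]).
    split=> [x Tx|/(_ 0 erefl)//]; exfalso; apply: nT0.
    by have := Tlin (-1) x x Tx Tx; rewrite scaleN1r addNr.
  split=> [a x y -> ->|x _ -> //]; by rewrite scaler0 addr0.
exists T; split=> // v; apply: contrapT => nv.
pose T' : set V := [set x | exists a u, T u /\ x = a *: v + u].
have TZ a u : T u -> T (a *: u) by move=> Tu; rewrite -[a *: u]addr0; apply: Tlin.
apply: (Tmax T').
  split=> [x Tx|T'T]; first by exists 0, x; rewrite scale0r add0r.
  have Tv : T v by apply: T'T; exists 1, 0; rewrite scale1r addr0.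
  by apply: nv; exists 0, v; split; rewrite ?add0r.
split=> [b x y [a [u [Tu ->]]] [a' [u' [Tu' ->]]]|x Wx [a [u [Tu ex]]]].
  exists (b * a + a'), (b *: u + u'); split; first exact: Tlin.
  by rewrite scalerDr scalerDl scalerA addrACA.
have [a0|a0] := eqVneq a 0.
  by apply: TW => //; rewrite ex a0 scale0r add0r.
exfalso; apply: nv; exists (a^-1 *: x), (- (a^-1 *: u)); split.
- by rewrite -[_ *: _]addr0; apply: Wlin.
- by rewrite -scaleNr; apply: TZ.
- by rewrite ex scalerDr scalerA mulVf // scale1r addrK.
Qed.

Lemma generalized_inverse_ex (U V : lmodType K) (d : {linear U -> V}) :
  exists h : V -> U, linear h /\ forall x, d (h (d x)) = d x.
Proof.
have [||T [T0 Tlin TW Tex]] := @complement_ex U [set x | d x = 0].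
- by rewrite /= linear0.
- by move=> a x y /= dx dy; rewrite linearP dx dy scaler0 addr0.
have [||S [S0 Slin SW Sex]] := @complement_ex V [set d x | x in setT].
- by exists 0; rewrite ?linear0.
- by move=> a _ _ [x _ <-] [y _ <-]; exists (a *: x + y); rewrite ?linearP.
have hex v : exists u, T u /\ exists2 s, S s & v = d u + s.
  have [_ [s [[x _ <-] Ss ->]]] := Sex v.
  have [w [u [dw Tu ->]]] := Tex x.
  by exists u; split=> //; exists s; rewrite // linearD dw add0r.
have sub (E : lmodType K) (A : set E) x y :
    (forall a x y, A x -> A y -> A (a *: x + y)) -> A x -> A y -> A (x - y).
  by move=> Alin Ax Ay; rewrite addrC -scaleN1r; apply: Alin.
have huniq u s u' s' : T u -> T u' -> S s -> S s' ->
    d u + s = d u' + s' -> u = u'.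
  move=> Tu Tu' Ss Ss' e.
  have e' : d (u - u') = s' - s.
    by rewrite linearB; apply/eqP; rewrite subr_eq addrAC eq_sym subr_eq addrC -e addrC.
  have ds : s' - s = 0.
    by apply: SW; [exists (u - u') | exact: sub].
  apply/eqP; rewrite -subr_eq0; apply/eqP; apply: TW; last exact: sub.
  by rewrite /= e'.
have [h hP] := choice hex.
exists h; split=> [a x y|x].
  have [Txy [s Ss e]] := hP (a *: x + y).
  have [Tx [s1 Ss1 e1]] := hP x; have [Ty [s2 Ss2 e2]] := hP y.
  apply: (huniq _ s _ (a *: s1 + s2)) => //; [exact: Tlin | exact: Slin |].
  by rewrite -e linearP {1}e1 {1}e2 scalerDr addrACA.
have [Tx [s Ss e]] := hP (d x).
rewrite {2}e; suff -> : s = 0 by rewrite addr0.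
apply: SW => //; exists (x - h (d x)) => //.
by rewrite linearB {1}e addrC addKr.
Qed.

End GeneralizedInverse.

Section QuasiIso.
Variables (K : fieldType) (C D : bcomplex K) (f : chain_map C D).

Let sub_swap0 (V : zmodType) (u v : V) : 0 = - u + v -> v = u.
Proof. by move=> /esym/eqP; rewrite addrC subr_eq0 => /eqP. Qed.

Let sub_swap (V : zmodType) (c u v w : V) : c = - u + (- v + w) -> w - c = u + v.
Proof. by move=> ->; rewrite addrA -opprD [- _ + w]addrC opprB addrC subrK. Qed.

(** An acyclic complex is contractible. *)
Lemma acyclic_contractible (E : bcomplex K) :
  (forall i (x : E (i + 1)), cd E (i + 1) x = 0 -> exists y, x = cd E i y) ->
  exists k : forall i, E (i + 1) -> E i, (forall i, linear (k i)) /\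
    forall i x, x = cd E i (k i x) + k (i + 1) (cd E (i + 1) x).
Proof.
move=> acE.
have H i : exists h : E (i + 1) -> E i,
    linear h /\ forall x, cd E i (h (cd E i x)) = cd E i x.
  exact: generalized_inverse_ex.
have /cid[h hP] : exists h : forall i, E (i + 1) -> E i, forall i,
    linear (h i) /\ forall x, cd E i (h i (cd E i x)) = cd E i x.
  by exists (fun i => projT1 (cid (H i))) => i; exact: (projT2 (cid (H i))).
have hl i : linear (h i) := (hP i).1; have hd i := (hP i).2.
pose k' i : E (i + 1 + 1) -> E (i + 1) :=
  fun x => h (i + 1) x - cd E i (h i (h (i + 1) x)).
pose k := all_degrees (T := fun i => E (i + 1) -> E i) k'.
have kE i : k (i + 1) = k' i by exact: all_degreesE.
exists k; split.
  apply: all_degrees => i a x y; rewrite kE /k' !hl linearP opprD.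
  by rewrite scalerBr addrACA.
have dk i x : cd E i (k i x) = cd E i (h i x).
  move: i x; apply: all_degrees => i x.
  by rewrite kE /k' linearB /= cdd subr0.
move=> i x; rewrite dk kE /k'.
have /acE[y ey] : cd E (i + 1) (x - h (i + 1) (cd E (i + 1) x)) = 0.
  by rewrite linearB /= hd subrr.
have hB j u v : h j (u - v) = h j u - h j v.
  by rewrite [in LHS]addrC -scaleN1r hl scaleN1r addrC.
have := hd i y; rewrite -ey hB linearB /= => e.
have -> : cd E i (h i x) = x - h (i + 1) (cd E (i + 1) x)
   + cd E i (h i (h (i + 1) (cd E (i + 1) x))).
  by rewrite -e subrK.
by rewrite addrACA subrK subrr addr0.
Qed.

Lemma cone_acyclic : quasi_iso f -> forall i (x : cone f (i + 1)),
  cd (cone f) (i + 1) x = 0 -> exists y, x = cd (cone f) i y.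
Proof.
move=> qf i [c e] /= [/eqP]; rewrite oppr_eq0 => /eqP dc fc.
have fe : f (i + 1 + 1) c = cd D (i + 1) (- e).
  by rewrite linearN; apply/eqP; rewrite -addr_eq0; apply/eqP.
have [c' ec] := quasi_iso_inj qf dc fe.
have dfe : cd D (i + 1) (e + f (i + 1) c') = 0.
  by rewrite linearD /= -cm_d -ec fe linearN subrr.
have [c'' [e'' [dc'' ee]]] := quasi_iso_surj qf dfe.
exists (c'' - c', e''); rewrite /= /cone_d /=; congr pair.
  by rewrite linearB /= dc'' sub0r opprK.
rewrite cm_linearD cm_linearN addrAC -ee addrK.
by [].
Qed.

Lemma quasi_iso_is_iso : quasi_iso f -> is_iso (db_class f : mor (C : Db K) D).
Proof.
move=> qf; have [k [kl kP]] := acyclic_contractible (cone_acyclic qf).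
pose kk i (c : C (i + 1 + 1)) (e : D (i + 1)) : cone_cx C D i := k i (c, e).
have kkl i b c e c' e' :
    kk i (b *: c + c') (b *: e + e') = b *: kk i c e + kk i c' e'.
  exact: (kl i b (c, e) (c', e')).
have kk1 i c e : c = - cd C (i + 1) (kk i c e).1 +
    (kk (i + 1) (- cd C (i + 1 + 1) c) (f (i + 1 + 1) c + cd D (i + 1) e)).1.
  exact: (congr1 fst (kP i (c, e))).
have kk2 i c e : e = f (i + 1) (kk i c e).1 + cd D i (kk i c e).2 +
    (kk (i + 1) (- cd C (i + 1 + 1) c) (f (i + 1 + 1) c + cd D (i + 1) e)).2.
  exact: (congr1 snd (kP i (c, e))).
move: kk kkl kk1 kk2 => {kl kP}k kl k1 k2.
pose g' i (y : D (i + 1)) : C (i + 1) := (k i 0 y).1.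
pose g := @all_degrees (fun i => D i -> C i) g'.
have gE i : g (i + 1) = g' i by exact: all_degreesE.
have g'l i : linear (g' i).
  move=> b x y; have := congr1 fst (kl i b 0 x 0 y).
  by rewrite scaler0 addr0.
have gl i : linear (g i).
  by move: i; apply: (@all_degrees (fun i => linear (g i))) => i; rewrite gE.
have gd i y : g (i + 1) (cd D i y) = cd C i (g i y).
  move: i y; apply: (@all_degrees
    (fun i => forall y, g (i + 1) (cd D i y) = cd C i (g i y))) => i y.
  have := k1 i 0 y; rewrite linear0 oppr0 cm_linear0 add0r !gE.
  exact: sub_swap0.
have gP : (g : graded_map D C) \in (@chain_mapb K D C : {pred _}).
  by apply/asboolP; split.
pose G := ChainMap gP.
exists (db_class G); split; rewrite /= db_compE; apply/db_classP.
- pose a' i (c : C (i + 1 + 1)) : C (i + 1) := (k i c 0).1.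
  pose a := @all_degrees (fun i => C (i + 1) -> C i) a'.
  have aE i : a (i + 1) = a' i by exact: all_degreesE.
  have a'l i : linear (a' i).
    move=> b x y; have := congr1 fst (kl i b x 0 y 0).
    by rewrite scaler0 addr0.
  exists a; split.
    by apply: (@all_degrees (fun i => linear (a i))) => i; rewrite aE.
  apply: (@all_degrees (fun i => forall x, (chain_comp G f - chain_id C) (i + 1) x =
    cd C i (a i x) + a (i + 1) (cd C (i + 1) x))) => i c; rewrite !aE.
  have -> : (chain_comp G f - chain_id C) (i + 1 + 1) c =
    g (i + 1 + 1) (f (i + 1 + 1) c) - c by [].
  rewrite gE; have := k1 i c 0; rewrite linear0 addr0.
  have := congr1 fst (kl (i + 1) (-1) (cd C (i + 1 + 1) c) 0 0 (f (i + 1 + 1) c)).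
  rewrite !scaleN1r oppr0 addr0 add0r => -> /=.
  rewrite -/(a' i c) -/(a' (i + 1) _) -/(g' (i + 1) _) => ec.
  exact: sub_swap.
- pose h i (y : D (i + 1)) : D i := - (k i 0 y).2.
  exists h; split=> [i b x y|i y].
    have /= := congr1 snd (kl i b 0 x 0 y); rewrite scaler0 addr0 /h => ->.
    by rewrite opprD scalerN.
  have -> : (chain_comp f G - chain_id D) (i + 1) y = f (i + 1) (g (i + 1) y) - y.
    by [].
  have := k2 i 0 y; rewrite linear0 oppr0 cm_linear0 add0r gE => ey.
  rewrite {2}ey /h linearN -/(g' i y) -addrA opprD addrA subrr add0r.
  by rewrite opprD.
Qed.

End QuasiIso.

(** * Thick subcategories and filtrations *)

Section TriangulatedTheory.
Variables (K : fieldType) (D : tricat K).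

Definition shn (k : int) (X : D) : D :=
  match k with
  | Posz n => iter n sh X
  | Negz n => iter n.+1 ush X
  end.

(** The full subcategory [Sigma^k P]. *)
Definition sh_sub (k : int) (P : D -> Prop) : D -> Prop :=
  fun Y => exists2 X, P X & isomorphic Y (shn k X).

Definition thick (P : D -> Prop) : Prop :=
  [/\ iso_closed P, additive_sub P, summand_closed P,
      (forall X, P X -> P (sh X) /\ P (ush X))
    & forall (X Y Z : D) (f : mor X Y) (g : mor Y Z) (h : mor Z (sh X)),
        dist f g h -> P X -> P Y -> P Z].

Definition split_generator (G : D) : Prop :=
  forall P : D -> Prop, thick P -> P G -> forall X, P X.

(** [filtration X s]: [X] has a filtration with sequence of factors [s]. *)
Inductive filtration : D -> seq D -> Prop :=
| filtration0 Z of is_zero Z : filtration Z [::]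
| filtrationS X Y F s (f : mor X Y) (g : mor Y F) (h : mor F (sh X)) of
    filtration X s & dist f g h : filtration Y (rcons s F).

(** The sequence [(k_1, E_1), ..., (k_m, E_m)] encodes the factors
    [Sigma^(k_1) E_1, ..., Sigma^(k_m) E_m]. *)
Definition shifted_filtration (E : D) (s : seq (int * D)) : Prop :=
  filtration E [seq shn x.1 x.2 | x <- s].

Definition all_in (P : D -> Prop) (s : seq (int * D)) : Prop :=
  foldr (fun x Q => P x.2 /\ Q) True s.

End TriangulatedTheory.

(** * Mass growth *)

Section Entropy.
Variable R : realType.

(** The value [(1/N) log x_N], with [log 0 = -oo]. *)
Definition log_growth (x : nat -> \bar R) (N : nat) : \bar R :=
  ((N%:R^-1)%:E * lne (x N))%E.

Section Structures.
Variables (K : fieldType) (D : tricat K).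

Definition weight (ell : D -> nat) (t : R) (s : seq (int * D)) : R :=
  \sum_(x <- s) (ell x.2)%:R * expR (x.1%:~R * t).

(** ** t-structures *)

Record t_structure := TStructure {
  tle : D -> Prop;
  tge : D -> Prop;
  tge1 := sh_sub (-1) tge;
  tle_iso : iso_closed tle;
  tge_iso : iso_closed tge;
  tle_additive : additive_sub tle;
  tge_additive : additive_sub tge;
  tle_sh : forall E, tle E -> tle (sh E);
  tge_ush : forall E, tge E -> tge (ush E);
  t_hom0 : forall E F (f : mor E F), tle E -> tge1 F -> f = 0;
  t_trunc : forall E, exists (X Y : D) (f : mor X E) (g : mor E Y)
    (h : mor Y (sh X)), [/\ tle X, tge1 Y & dist f g h]
}.

Definition heart (a : t_structure) (E : D) : Prop := tle a E /\ tge a E.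

Definition t_bounded (a : t_structure) : Prop :=
  forall E, (exists k, sh_sub k (tle a) E) /\ (exists k, sh_sub k (tge a) E).

Definition finite_heart (a : t_structure) : Prop :=
  (forall E, heart a E -> exists n, comp_series (heart a) E n) /\
  finitely_many_iso (simple_in (heart a)).

Definition t_filtration (a : t_structure) (E : D) (s : seq (int * D)) : Prop :=
  [/\ all_in (heart a) s, sorted >%R [seq x.1 | x <- s]
    & shifted_filtration E s].

(** The weight of a chosen t-filtration of [E]: it does not depend on the choice,
    t-filtrations being essentially unique. *)
Definition delta_t (a : t_structure) (t : R) (E : D) : R :=
  xget 0 [set w | exists s, t_filtration a E s /\
                           w = weight (length_in (heart a)) t s].

Definition entropy_t (a : t_structure) (t : R) (Phi : D -> D) : \bar R :=
  ereal_sup [set h | exists E : D,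
    h = limn_esup (log_growth (fun N => (delta_t a t (iter N Phi E))%:E))].

(** ** co-t-structures *)

Record cot_structure := CotStructure {
  cge : D -> Prop;
  cle : D -> Prop;
  cge1 := sh_sub (-1) cge;
  cge_iso : iso_closed cge;
  cle_iso : iso_closed cle;
  cge_additive : additive_sub cge;
  cle_additive : additive_sub cle;
  cge_summand : summand_closed cge;
  cle_summand : summand_closed cle;
  cge_ush : forall E, cge E -> cge (ush E);
  cle_sh : forall E, cle E -> cle (sh E);
  cot_hom0 : forall E F (f : mor E F), cge1 E -> cle F -> f = 0;
  cot_trunc : forall E, exists (X Y : D) (f : mor X E) (g : mor E Y)
    (h : mor Y (sh X)), [/\ cge1 X, cle Y & dist f g h]
}.

Definition coheart (b : cot_structure) (E : D) : Prop := cge b E /\ cle b E.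

Definition cot_bounded (b : cot_structure) : Prop :=
  forall E, (exists k, sh_sub k (cge b) E) /\ (exists k, sh_sub k (cle b) E).

Definition finite_coheart (b : cot_structure) : Prop :=
  krull_schmidt (coheart b) /\
  finitely_many_iso (indecomposable_in (coheart b)).

Definition cot_filtration (b : cot_structure) (E : D) (s : seq (int * D)) :
    Prop :=
  [/\ all_in (coheart b) s, sorted <%R [seq x.1 | x <- s]
    & shifted_filtration E s].

Definition delta_cot (b : cot_structure) (t : R) (E : D) : \bar R :=
  ereal_inf [set w | exists s, cot_filtration b E s /\
                                w = (weight (num_indec (coheart b)) t s)%:E].

Definition entropy_cot (b : cot_structure) (t : R) (Phi : D -> D) : \bar R :=
  ereal_sup [set h | exists E : D,
    h = limn_esup (log_growth (fun N => delta_cot b t (iter N Phi E)))].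

End Structures.
End Entropy.

(** [sum_k dim H^(-k)(C) e^(kt)]. *)
Definition coh_sum (R : realType) (K : fieldType) (t : R) (C : bcomplex K) :
    \bar R :=
  (\esum_(k in [set: int]) (dimE R (cohomology C (- k)) * (expR (k%:~R * t))%:E))%E.

(* Main.v *)
(** Write [mass X] for [sum_k dim H^(-k) (Gamma X) e^(kt)].  For a t-structure,
    [Gamma] is exact on the heart, where it counts lengths, and the factors of a
    t-filtration sit in degrees so ordered that no connecting map can be nonzero
    on cohomology; hence [mass] is exactly the weight of the t-filtration.  For a
    co-t-structure, a connecting map can only be nonzero between two adjacent
    factors, where by hypothesis it has a component that is an isomorphism of
    indecomposables; this component can be cancelled by the octahedral axiom, so
    a co-t-filtration with the least number of indecomposables has weight [mass],
    which is the infimum.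

    It remains to study [mass].  If [S_1, ..., S_n] are the simple (indecomposable)
    objects and [b N = sum_i mass (Phi^N S_i)], then filtering [E] by shifts of the
    [S_i] yields [mass (Phi^N E) <= mass E * b N].  Thus [b] is submultiplicative
    and Fekete's lemma applies; and since the objects [E] with
    [mass (Phi^N E) = O (mass (Phi^N G))] form a thick subcategory, a
    split-generator [G] has the growth of [b]. *)
Require Import Defs.
From HB Require Import structures.
From mathcomp Require Import all_boot all_order all_algebra.
From mathcomp Require Import all_classical all_reals all_analysis.
From mathcomp Require Import zify.

Set Implicit Arguments.
Unset Strict Implicit.
Unset Printing Implicit Defensive.

Import Order.TTheory GRing.Theory Num.Theory.
Import numFieldNormedType.Exports.
Local Open Scope ring_scope.
Local Open Scope classical_set_scope.
Local Open Scope cat_scope.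

(** * Linear and triangulated categories *)

(** The obstacle is that [Phi] respects neither hearts nor degrees, so that a filtration of [E] says
    nothing directly about the cohomology of its images under [Phi]. What survives composition with
    [Phi] is subadditivity on exact triangles, scaling by [expR t] under the shift and monotonicity
    under retracts. These are the axioms of [mass_fun]: every filtration estimate is proved for an
    arbitrary mass function and then applied to the mass composed with an iterate of [Phi].

    The two variances of [Gamma] are merged in [coh_theory], which records only dimensions and the
    vanishing of induced maps, notions that do not mention the direction of the arrows on
    cohomology. The contravariant theory is indexed by the opposite degree, whence the exponent
    [- k t] in that case.

    The lengths and numbers of summands inside the weights are chosen by [xget]. The choices are
    harmless because the dimension in degree 0 computes both numbers. *)

Section LinCat.
Variables (K : fieldType) (A : lincat K).
Implicit Types X Y Z W : A.

Lemma comp0l X Y Z (f : mor X Y) : (0 : mor Y Z) ∘ f = 0.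
Proof.
by have := comp_linearl f (-1) (0 : mor Y Z) 0; rewrite scaler0 addr0 scaleN1r addNr.
Qed.

Lemma comp0r X Y Z (g : mor Y Z) : g ∘ (0 : mor X Y) = 0.
Proof.
by have := comp_linearr g (-1) (0 : mor X Y) 0; rewrite scaler0 addr0 scaleN1r addNr.
Qed.

Lemma compDl X Y Z (g g' : mor Y Z) (f : mor X Y) :
  (g + g') ∘ f = g ∘ f + g' ∘ f.
Proof. by have := comp_linearl f 1 g g'; rewrite !scale1r. Qed.

Lemma compDr X Y Z (g : mor Y Z) (f f' : mor X Y) :
  g ∘ (f + f') = g ∘ f + g ∘ f'.
Proof. by have := comp_linearr g 1 f f'; rewrite !scale1r. Qed.

Lemma compNl X Y Z (g : mor Y Z) (f : mor X Y) : (- g) ∘ f = - (g ∘ f).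
Proof. by have := comp_linearl f (-1) g 0; rewrite comp0l !scaleN1r !addr0. Qed.

Lemma compNr X Y Z (g : mor Y Z) (f : mor X Y) : g ∘ (- f) = - (g ∘ f).
Proof. by have := comp_linearr g (-1) f 0; rewrite comp0r !scaleN1r !addr0. Qed.

Lemma compBl X Y Z (g g' : mor Y Z) (f : mor X Y) :
  (g - g') ∘ f = g ∘ f - g' ∘ f.
Proof. by rewrite compDl compNl. Qed.

Lemma compBr X Y Z (g : mor Y Z) (f f' : mor X Y) :
  g ∘ (f - f') = g ∘ f - g ∘ f'.
Proof. by rewrite compDr compNr. Qed.

Lemma is_iso_id X : is_iso (idm X).
Proof. by exists (idm X); rewrite comp_idl. Qed.

Lemma is_iso_comp X Y Z (g : mor Y Z) (f : mor X Y) :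
  is_iso g -> is_iso f -> is_iso (g ∘ f).
Proof.
move=> [g' [gl gr]] [f' [fl fr]]; exists (f' ∘ g'); split.
  by rewrite -comp_assoc (comp_assoc g') gl comp_idl.
by rewrite -comp_assoc (comp_assoc f) fr comp_idl.
Qed.

Lemma isomorphic_refl X : isomorphic X X.
Proof. by exists (idm X); exact: is_iso_id. Qed.

Lemma isomorphic_sym X Y : isomorphic X Y -> isomorphic Y X.
Proof. by move=> [f [g [gl gr]]]; exists g, f. Qed.

Lemma isomorphic_trans Y X Z :
  isomorphic X Y -> isomorphic Y Z -> isomorphic X Z.
Proof. by move=> [f fi] [g gi]; exists (g ∘ f); apply: is_iso_comp. Qed.

Lemma is_zero_id X : is_zero X <-> idm X = 0.
Proof.
split=> [/(_ X)[]//|X0 Y]; split=> f.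
  by rewrite -[f]comp_idl X0 comp0l.
by rewrite -[f]comp_idr X0 comp0r.
Qed.

Lemma is_zero_retract X Y (i : mor X Y) (p : mor Y X) :
  p ∘ i = idm X -> is_zero Y -> is_zero X.
Proof. by move=> e Y0; apply/is_zero_id; rewrite -e [i](Y0 X).1 comp0r. Qed.

Lemma is_zero_iso X Y : isomorphic X Y -> is_zero Y -> is_zero X.
Proof. by move=> [f [g [gl _]]]; apply: is_zero_retract gl. Qed.

Lemma is_dsum_sym X Y S : is_dsum X Y S -> is_dsum Y X S.
Proof.
by move=> [i1 [i2 [p1 [p2 [? ? ? ? e]]]]]; exists i2, i1, p2, p1; rewrite addrC.
Qed.

Lemma is_dsum_iso X Y S X' : isomorphic X X' -> is_dsum X Y S -> is_dsum X' Y S.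
Proof.
move=> [a [b [ba ab]]] [i1 [i2 [p1 [p2 [e1 e2 e3 e4 e5]]]]].
exists (i1 ∘ b), i2, (a ∘ p1), p2; split=> //.
- by rewrite -comp_assoc (comp_assoc p1) e1 comp_idl.
- by rewrite -comp_assoc e3 comp0r.
- by rewrite comp_assoc e4 comp0l.
- by rewrite -comp_assoc (comp_assoc b) ba comp_idl.
Qed.

Lemma is_dsum_iso_sum X Y S S' : isomorphic S S' -> is_dsum X Y S -> is_dsum X Y S'.
Proof.
move=> [a [b [ba ab]]] [i1 [i2 [p1 [p2 [e1 e2 e3 e4 e5]]]]].
exists (a ∘ i1), (a ∘ i2), (p1 ∘ b), (p2 ∘ b); split; last first.
  rewrite -!(comp_assoc a) -compDr !(comp_assoc _ _ b) -compDl e5 comp_idl.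
  exact: ab.
all: by rewrite -comp_assoc (comp_assoc b) ba comp_idl.
Qed.

(** The complement is obtained by splitting the idempotent [idm S - i ∘ p]; this is where idempotent
    completeness enters. *)
Lemma retract_dsum (idem : idempotent_complete A) X S (i : mor X S)
    (p : mor S X) : p ∘ i = idm X ->
  exists (Y : A) (j : mor Y S) (q : mor S Y),
    [/\ q ∘ j = idm Y, p ∘ j = 0, q ∘ i = 0 & i ∘ p + j ∘ q = idm S].
Proof.
move=> pi.
have ee : (idm S - i ∘ p) ∘ (idm S - i ∘ p) = idm S - i ∘ p.
  rewrite compBl comp_idl compBr comp_idr -comp_assoc (comp_assoc p) pi comp_idl.
  by rewrite subrr subr0.
have [Y [q [j [qj jq]]]] := idem _ _ ee.
exists Y, j, q; split=> //.
- rewrite -[j]comp_idr -qj (comp_assoc j) jq (comp_assoc p) compBr comp_idr.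
  by rewrite (comp_assoc p) pi comp_idl subrr comp0l.
- rewrite -[q]comp_idl -qj -(comp_assoc q) jq -comp_assoc compBl comp_idl.
  by rewrite -comp_assoc pi comp_idr subrr comp0r.
- by rewrite jq addrC subrK.
Qed.

Lemma retract_is_dsum (idem : idempotent_complete A) X S (i : mor X S)
    (p : mor S X) : p ∘ i = idm X -> exists Y, is_dsum X Y S.
Proof.
by move=> pi; have [Y [j [q []]]] := retract_dsum idem pi; exists Y, i, j, p, q.
Qed.

End LinCat.

Section Functors.
Variables (K : fieldType) (A B : lincat K) (F : functor A B).

Lemma fmap_iso X Y (f : mor X Y) : is_iso f -> is_iso (fmor F f).
Proof.
by move=> [g [gf fg]]; exists (fmor F g); rewrite -!Defs.fmap_comp gf fg !Defs.fmap_id.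
Qed.

Lemma fmap_isomorphic X Y : isomorphic X Y -> isomorphic (F X) (F Y).
Proof. by move=> [f fi]; exists (fmor F f); apply: fmap_iso. Qed.

Lemma linear_additive_functor : linear_functor F -> additive_functor F.
Proof. by move=> Fl X Y f g; have := Fl X Y 1 f g; rewrite !scale1r. Qed.

Hypothesis Fadd : additive_functor F.

Lemma fmap0 X Y : fmor F (0 : mor X Y) = 0.
Proof. by apply: (addrI (fmor F 0)); rewrite -Fadd !addr0. Qed.

Lemma fmapN X Y (f : mor X Y) : fmor F (- f) = - fmor F f.
Proof. by apply/eqP; rewrite -addr_eq0 -Fadd addNr fmap0. Qed.

Lemma fmap_is_zero X : is_zero X -> is_zero (F X).
Proof. by move=> /is_zero_id X0; apply/is_zero_id; rewrite -Defs.fmap_id X0 fmap0. Qed.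

Lemma fmap_dsum X Y S : is_dsum X Y S -> is_dsum (F X) (F Y) (F S).
Proof.
move=> [i1 [i2 [p1 [p2 [e1 e2 e3 e4 e5]]]]].
exists (fmor F i1), (fmor F i2), (fmor F p1), (fmor F p2).
by rewrite -!Defs.fmap_comp e1 e2 e3 e4 -Fadd e5 !Defs.fmap_id !fmap0.
Qed.

End Functors.

(** * Elementary consequences of the triangulated axioms *)

Section Tricat.
Variables (K : fieldType) (D : tricat K).
Implicit Types X Y Z W : D.

Definition sh_add : additive_functor (sh (s := D)) :=
  linear_additive_functor (@sh_linear K D).
Definition ush_add : additive_functor (ush (t := D)) :=
  linear_additive_functor (@ush_linear K D).

Lemma sh_ush_isom X : isomorphic (sh (ush X)) X.
Proof. by exists (sh_ush X); exact: sh_ush_iso. Qed.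

Lemma ush_sh_isom X : isomorphic (ush (sh X)) X.
Proof. by exists (ush_sh X); exact: ush_sh_iso. Qed.

Lemma sh_faithful X Y (f g : mor X Y) : fmor sh f = fmor sh g -> f = g.
Proof.
move=> fg; have [u [_ uu]] := ush_sh_iso X.
by rewrite -[f]comp_idr -[g]comp_idr -uu !comp_assoc !ush_sh_nat fg.
Qed.

Lemma ush_faithful X Y (f g : mor X Y) : fmor ush f = fmor ush g -> f = g.
Proof.
move=> fg; have [u [_ uu]] := sh_ush_iso X.
by rewrite -[f]comp_idr -[g]comp_idr -uu !comp_assoc !sh_ush_nat fg.
Qed.

(** No triangle identity links [sh_ush] and [ush_sh]. The equation is therefore checked after
    applying the faithful functor [ush], where the naturality of [ush_sh] forces it. *)
Lemma sh_full X Y (f : mor (sh X) (sh Y)) : exists g : mor X Y, f = fmor sh g.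
Proof.
have [u [uu uu']] := ush_sh_iso X; have [v [vv vv']] := ush_sh_iso Y.
exists (ush_sh Y ∘ fmor ush f ∘ u); apply: ush_faithful.
have := ush_sh_nat (ush_sh Y ∘ fmor ush f ∘ u); rewrite -!comp_assoc uu comp_idr.
move=> /(congr1 (fun w => v ∘ w)).
by rewrite !comp_assoc vv !comp_idl.
Qed.

Lemma ush_full X Y (f : mor (ush X) (ush Y)) : exists g : mor X Y, f = fmor ush g.
Proof.
have [u [uu uu']] := sh_ush_iso X; have [v [vv vv']] := sh_ush_iso Y.
exists (sh_ush Y ∘ fmor sh f ∘ u); apply: sh_faithful.
have := sh_ush_nat (sh_ush Y ∘ fmor sh f ∘ u); rewrite -!comp_assoc uu comp_idr.
move=> /(congr1 (fun w => v ∘ w)).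
by rewrite !comp_assoc vv !comp_idl.
Qed.

Lemma dist_rot2 X Y Z (f : mor X Y) (g : mor Y Z) (h : mor Z (sh X)) :
  dist f g h <-> dist h (- fmor sh f) (- fmor sh g).
Proof. exact: iff_trans (dist_rot f g h) (dist_rot _ _ _). Qed.

Lemma dist_rot3 X Y Z (f : mor X Y) (g : mor Y Z) (h : mor Z (sh X)) :
  dist f g h <-> dist (- fmor sh f) (- fmor sh g) (- fmor sh h).
Proof. exact: iff_trans (dist_rot2 f g h) (dist_rot _ _ _). Qed.

(** A morphism from the triangle of [idm X] exhibits [g ∘ f] as factoring through a zero object. *)
Lemma comp0_dist X Y Z (f : mor X Y) (g : mor Y Z) (h : mor Z (sh X)) :
  dist f g h -> g ∘ f = 0.
Proof.
move=> dfg; have [Ob Ob0] := zero_ex D.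
have [c [cg _]] := dist_mor (a := idm X) (b := f) (dist_id X Ob0) dfg erefl.
by rewrite -cg comp0r.
Qed.

(** Since [dist_mor] supplies the third arrow of a morphism of triangles, both triangles are rotated
    until the missing arrow is the third one. It then runs between shifts and descends by fullness
    of [sh]. *)
Lemma weak_ker X Y Z (f : mor X Y) (g : mor Y Z) (h : mor Z (sh X)) W
  (u : mor W Y) : dist f g h -> g ∘ u = 0 -> exists v : mor W X, u = f ∘ v.
Proof.
move=> /dist_rot dgh gu; have [Ob Ob0] := zero_ex D.
have /dist_rot dW := dist_id W Ob0.
have [|c [_ e]] := dist_mor (a := u) (b := 0) dW dgh; first by rewrite comp0l gu.
have [v ev] := sh_full c; exists v; apply: sh_faithful; rewrite Defs.fmap_comp -ev.
by move: e; rewrite Defs.fmap_id compNr comp_idr compNl => /oppr_inj.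
Qed.

Lemma weak_coker X Y Z (f : mor X Y) (g : mor Y Z) (h : mor Z (sh X)) W
  (u : mor Y W) : dist f g h -> u ∘ f = 0 -> exists v : mor Z W, u = v ∘ g.
Proof.
move=> dfg uf; have [Ob Ob0] := zero_ex D.
have dW : dist (0 : mor Ob W) (idm W) (0 : mor W (sh Ob)).
  apply/dist_rot; rewrite fmap0; last exact: sh_add.
  by rewrite oppr0; apply/dist_id/fmap_is_zero => //; exact: sh_add.
have [|c [e _]] := dist_mor (a := 0) (b := u) dfg dW; first by rewrite comp0l uf.
by exists c; rewrite e comp_idl.
Qed.

(** The cone of [i1] has to be identified with [Y]: the retraction [p1] kills the connecting map,
    and then [p2] factors through the cone by an isomorphism with inverse [g ∘ i2]. *)
Lemma dist_dsum X Y S (i1 : mor X S) (i2 : mor Y S) (p1 : mor S X)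
    (p2 : mor S Y) : p1 ∘ i1 = idm X -> p2 ∘ i2 = idm Y -> p2 ∘ i1 = 0 ->
  i1 ∘ p1 + i2 ∘ p2 = idm S -> dist i1 p2 (0 : mor Y (sh X)).
Proof.
move=> e1 e2 e3 e5; have [Z [g [h dig]]] := dist_ex i1.
have h0 : h = 0.
  have := comp0_dist ((dist_rot2 _ _ _).1 dig); rewrite compNl => /eqP.
  rewrite oppr_eq0 => /eqP ih; rewrite -[h]comp_idl -Defs.fmap_id -e1 Defs.fmap_comp.
  by rewrite -comp_assoc ih comp0r.
have [c ec] := weak_coker dig e3.
have gi1 : g ∘ i1 = 0 := comp0_dist dig.
have e : (g ∘ i2 ∘ c - idm Z) ∘ g = 0.
  rewrite compBl comp_idl -comp_assoc -ec -comp_assoc.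
  have -> : i2 ∘ p2 = idm S - i1 ∘ p1 by rewrite -e5 addrC addKr.
  by rewrite compBr comp_idr comp_assoc gi1 comp0l subr0 subrr.
have [v] := weak_coker ((dist_rot _ _ _).1 dig) e.
rewrite h0 comp0r => /eqP; rewrite subr_eq0 => /eqP gc.
have ci : is_iso c by exists (g ∘ i2); rewrite comp_assoc -ec.
apply: (dist_iso (is_iso_id X) (is_iso_id S) ci _ _ _ dig).
- by rewrite comp_idl comp_idr.
- by rewrite comp_idr ec.
- by rewrite comp0l h0 comp0r.
Qed.

Lemma dsum_dist X Y S : is_dsum X Y S ->
  exists (f : mor X S) (g : mor S Y), dist f g (0 : mor Y (sh X)).
Proof.
move=> [i1 [i2 [p1 [p2 [e1 e2 _ e4 e5]]]]].
by exists i1, p2; apply: dist_dsum e5.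
Qed.

Lemma dist_split X Y Z (f : mor X Y) (g : mor Y Z) (h : mor Z (sh X))
    (r : mor Y X) : dist f g h -> r ∘ f = idm X -> is_dsum X Z Y.
Proof.
move=> dfg rf.
have h0 : h = 0.
  have := comp0_dist ((dist_rot2 _ _ _).1 dfg); rewrite compNl => /eqP.
  rewrite oppr_eq0 => /eqP ih; rewrite -[h]comp_idl -Defs.fmap_id -rf Defs.fmap_comp.
  by rewrite -comp_assoc ih comp0r.
have gf := comp0_dist dfg.
have [|s es] := weak_coker (u := idm Y - f ∘ r) dfg.
  by rewrite compBl comp_idl -comp_assoc rf comp_idr subrr.
have gs : g ∘ s = idm Z.
  have : (g ∘ s - idm Z) ∘ g = 0.
    rewrite compBl -comp_assoc -es compBr comp_idr comp_idl comp_assoc gf comp0l.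
    by rewrite subr0 subrr.
  move=> /(weak_coker ((dist_rot _ _ _).1 dfg))[v].
  by rewrite h0 comp0r => /eqP; rewrite subr_eq0 => /eqP.
exists f, s, r, g; split=> //; last by rewrite -es addrC subrK.
have : (r ∘ s) ∘ g = 0.
  by rewrite -comp_assoc -es compBr comp_idr comp_assoc rf comp_idl subrr.
move=> /(weak_coker ((dist_rot _ _ _).1 dfg))[v].
by rewrite h0 comp0r.
Qed.

Lemma dist_isoZ X Y Z Z' (f : mor X Y) (g : mor Y Z) (h : mor Z (sh X))
    (c : mor Z Z') (c' : mor Z' Z) : c ∘ c' = idm Z' -> c' ∘ c = idm Z ->
  dist f g h -> dist f (c ∘ g) (h ∘ c').
Proof.
move=> cc' c'c; have ci : is_iso c by exists c'.
apply: dist_iso (is_iso_id X) (is_iso_id Y) ci _ _ _.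
- by rewrite comp_idl comp_idr.
- by rewrite comp_idr.
- by rewrite Defs.fmap_id comp_idl -comp_assoc c'c comp_idr.
Qed.

Lemma dist_isoX X Y Z X' (f : mor X Y) (g : mor Y Z) (h : mor Z (sh X))
    (a : mor X X') (a' : mor X' X) : a ∘ a' = idm X' -> a' ∘ a = idm X ->
  dist f g h -> dist (f ∘ a') g (fmor sh a ∘ h).
Proof.
move=> aa' a'a; have ai : is_iso a by exists a'.
apply: dist_iso ai (is_iso_id Y) (is_iso_id Z) _ _ _.
- by rewrite comp_idl -comp_assoc a'a comp_idr.
- by rewrite comp_idl comp_idr.
- by rewrite comp_idr.
Qed.

Lemma dist_isoY X Y Z Y' (f : mor X Y) (g : mor Y Z) (h : mor Z (sh X))
    (b : mor Y Y') (b' : mor Y' Y) : b ∘ b' = idm Y' -> b' ∘ b = idm Y ->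
  dist f g h -> dist (b ∘ f) (g ∘ b') h.
Proof.
move=> bb' b'b; have bi : is_iso b by exists b'.
apply: dist_iso (is_iso_id X) bi (is_iso_id Z) _ _ _.
- by rewrite comp_idr.
- by rewrite comp_idl -comp_assoc b'b comp_idr.
- by rewrite Defs.fmap_id comp_idl comp_idr.
Qed.

Definition triangle X Y Z : Prop :=
  exists (f : mor X Y) (g : mor Y Z) (h : mor Z (sh X)), dist f g h.

Lemma dist_triangle X Y Z (f : mor X Y) (g : mor Y Z) (h : mor Z (sh X)) :
  dist f g h -> triangle X Y Z.
Proof. by exists f, g, h. Qed.

Lemma triangle_iso X Y Z X' Y' Z' : isomorphic X X' -> isomorphic Y Y' ->
  isomorphic Z Z' -> triangle X Y Z -> triangle X' Y' Z'.
Proof.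
move=> [a [a' [ea ea']]] [b [b' [eb eb']]] [c [c' [ec ec']]] [f [g [h d]]].
have d1 := dist_isoX ea' ea d.
have d2 := dist_isoY eb' eb d1.
have d3 := dist_isoZ ec' ec d2.
by do 3!eexists; exact: d3.
Qed.

Lemma triangle_rot X Y Z : triangle X Y Z -> triangle Y Z (sh X).
Proof. by move=> [f [g [h /dist_rot d]]]; exists g, h, (- fmor sh f). Qed.

(** Rotating backwards requires the third map to be minus a shifted morphism, which fullness of [sh]
    guarantees. *)
Lemma dist_unrot X Y Z (f : mor Y Z) (g : mor Z (sh X)) (h : mor (sh X) (sh Y)) :
  dist f g h -> exists2 k : mor X Y, h = - fmor sh k & dist k f g.
Proof.
move=> d; have [k ek] := sh_full (- h).
have hk : h = - fmor sh k by rewrite -ek opprK.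
by exists k => //; apply/dist_rot; rewrite -hk.
Qed.

Lemma triangle_unrot_sh X Y Z : triangle Y Z (sh X) -> triangle X Y Z.
Proof. by move=> [f [g [h /dist_unrot[k _ d]]]]; exists k, f, g. Qed.

Lemma triangle_unrot X Y Z : triangle X Y Z -> triangle (ush Z) X Y.
Proof.
move=> t; apply: triangle_unrot_sh; move: t.
apply: triangle_iso (isomorphic_refl _) (isomorphic_refl _) _.
exact/isomorphic_sym/sh_ush_isom.
Qed.

Lemma triangle_sh X Y Z : triangle X Y Z <-> triangle (sh X) (sh Y) (sh Z).
Proof.
split; first by move=> /triangle_rot/triangle_rot/triangle_rot.
by move=> /triangle_unrot_sh/triangle_unrot_sh/triangle_unrot_sh.
Qed.

Lemma triangle_ush X Y Z : triangle X Y Z -> triangle (ush X) (ush Y) (ush Z).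
Proof.
move=> t; apply/triangle_sh; move: t.
by apply: triangle_iso; apply/isomorphic_sym/sh_ush_isom.
Qed.

Lemma dsum_triangle X Y S : is_dsum X Y S -> triangle X S Y.
Proof. by move=> /dsum_dist[f [g d]]; exists f, g, 0. Qed.

Lemma triangle_zero1 X Z Ob : is_zero Ob -> isomorphic X Z -> triangle Ob X Z.
Proof.
move=> Ob0 xz; apply: triangle_iso (isomorphic_refl Ob) (isomorphic_refl X) xz _.
apply: triangle_unrot_sh; exists (idm X), 0, 0; apply: dist_id.
by apply: fmap_is_zero => //; exact: sh_add.
Qed.

Lemma zero_triangle1 X Z Ob (f : mor Ob X) (g : mor X Z) (h : mor Z (sh Ob)) :
  is_zero Ob -> dist f g h -> is_iso g.
Proof.
move=> Ob0 d.
have [|r er] := weak_coker (u := idm X) d; first by rewrite [f](Ob0 _).2 comp0r.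
exists r; split; first by rewrite -er.
have : (g ∘ r - idm Z) ∘ g = 0.
  by rewrite compBl -comp_assoc -er comp_idr comp_idl subrr.
move=> /(weak_coker ((dist_rot _ _ _).1 d))[v].
have sO0 : is_zero (sh Ob) by apply: fmap_is_zero => //; exact: sh_add.
by rewrite [h](sO0 _).1 comp0r => /eqP; rewrite subr_eq0 => /eqP.
Qed.

Lemma zero_triangle2 X Z Ob (f : mor X Z) (g : mor Z Ob) (h : mor Ob (sh X)) :
  is_zero Ob -> dist f g h -> is_iso f.
Proof.
move=> Ob0 d.
have [|r er] := weak_ker (u := idm Z) d; first by rewrite [g](Ob0 _).1 comp0l.
exists r; split=> //; have e : f ∘ (r ∘ f - idm X) = 0.
  by rewrite compBr comp_assoc -er comp_idl comp_idr subrr.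
have [v ev] : exists v : mor (sh X) Ob, fmor sh (r ∘ f - idm X) = h ∘ v.
  apply: (weak_ker ((dist_rot2 _ _ _).1 d)).
  by rewrite compNl -Defs.fmap_comp e fmap0 ?oppr0 //; exact: sh_add.
have : fmor sh (r ∘ f - idm X) = fmor sh 0.
  by rewrite ev [v](Ob0 _).1 comp0r fmap0 //; exact: sh_add.
by move=> /sh_faithful/eqP; rewrite subr_eq0 => /eqP.
Qed.

End Tricat.

(** * Iterated shifts and levels *)

Section Shifts.
Variables (K : fieldType) (D : tricat K).
Implicit Types X Y Z : D.

Section IteratedFunctor.
Variable F : functor D D.

Fixpoint iter_map n X Y (f : mor X Y) : mor (iter n F X) (iter n F Y) :=
  if n is n'.+1 then fmor F (iter_map n' f) else f.

Lemma iter_map_id n X : iter_map n (idm X) = idm (iter n F X).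
Proof. by elim: n => //= n ->; rewrite Defs.fmap_id. Qed.

Lemma iter_map_comp n X Y Z (g : mor Y Z) (f : mor X Y) :
  iter_map n (g ∘ f) = iter_map n g ∘ iter_map n f.
Proof. by elim: n => //= n ->; rewrite Defs.fmap_comp. Qed.

Lemma iter_map_add n X Y (f g : mor X Y) : additive_functor F ->
  iter_map n (f + g) = iter_map n f + iter_map n g.
Proof. by move=> Fadd; elim: n => //= n ->; rewrite Fadd. Qed.

Lemma iter_map_full n X Y (f : mor (iter n F X) (iter n F Y)) :
  (forall X' Y' (f : mor (F X') (F Y')), exists g, f = fmor F g) ->
  exists g, f = iter_map n g.
Proof.
move=> Ffull; elim: n f => [|n IH] f /=; first by exists f.
by have [g ->] := Ffull _ _ f; have [h ->] := IH g; exists h.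
Qed.

End IteratedFunctor.

Definition shmap k X Y : mor X Y -> mor (shn k X) (shn k Y) :=
  match k return mor X Y -> mor (shn k X) (shn k Y) with
  | Posz n => iter_map sh n (X := X) (Y := Y)
  | Negz n => iter_map ush n.+1 (X := X) (Y := Y)
  end.

Fact shmap_id k X : shmap k (idm X) = idm (shn k X).
Proof. by case: k => n; rewrite /shmap iter_map_id. Qed.

Fact shmap_comp k X Y Z (g : mor Y Z) (f : mor X Y) :
  shmap k (g ∘ f) = shmap k g ∘ shmap k f.
Proof. by case: k => n; rewrite /shmap iter_map_comp. Qed.

Definition shf k : functor D D :=
  @Functor K D D (shn k) (shmap k) (shmap_id k) (@shmap_comp k).

Lemma shf_add k : additive_functor (shf k).
Proof.
by case: k => n X Y f g; apply: iter_map_add; [exact: sh_add | exact: ush_add].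
Qed.

Lemma shf_full k X Y (f : mor (shn k X) (shn k Y)) :
  exists g : mor X Y, f = fmor (shf k) g.
Proof.
case: k f => n f; apply: iter_map_full; [exact: sh_full | exact: ush_full].
Qed.

Lemma shn_iso k X Y : isomorphic X Y -> isomorphic (shn k X) (shn k Y).
Proof. exact: (fmap_isomorphic (shf k)). Qed.

Lemma shn_dsum k X Y S : is_dsum X Y S -> is_dsum (shn k X) (shn k Y) (shn k S).
Proof. exact: (fmap_dsum (shf_add k)). Qed.

Lemma sh_shn_nat k : exists a : forall X, mor (sh (shn k X)) (shn (k + 1) X),
  (forall X, is_iso (a X)) /\ (forall X Y (f : mor X Y),
     fmor (shf (k + 1)) f ∘ a X = a Y ∘ fmor sh (fmor (shf k) f)).
Proof.
(* Naming [k + 1] lets each case replace it by the constructor on which [shn] computes, without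
   casts. The case of -1 stands apart because its successor crosses from [Negz] to [Posz]. *)
have [l el] : exists l, l = k + 1 by exists (k + 1).
rewrite -el; move: el; case: k => [n|[|n]].
- move=> e; have -> : l = n.+1 by rewrite e -PoszD addn1.
  exists (fun X => idm _); split=> [X|X Y f]; first exact: is_iso_id.
  by rewrite comp_idl comp_idr.
- move=> ->.
  exists (fun X => sh_ush X); split=> [X|X Y f]; first exact: sh_ush_iso.
  by rewrite /= sh_ush_nat.
- move=> e; have -> : l = Negz n by rewrite e !NegzE; lia.
  exists (fun X => sh_ush _); split=> [X|X Y f]; first exact: sh_ush_iso.
  by rewrite /= sh_ush_nat.
Qed.

Lemma sh_shn k X : isomorphic (sh (shn k X)) (shn (k + 1) X).
Proof. by have [a [ai _]] := sh_shn_nat k; exists (a X). Qed.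

Lemma shn_sh k X : isomorphic (shn k (sh X)) (shn (k + 1) X).
Proof.
case: k => n.
  have -> : n%:Z + 1 = n.+1 by rewrite -PoszD addn1.
  by rewrite [shn n.+1 X]/= -iterS iterSr; exact: isomorphic_refl.
rewrite /shn iterSr -/(shn _ _).
apply: (@isomorphic_trans _ _ (iter n ush X)).
  have := @iter_map_id ush n; elim: n => [|n IH] _ /=; first exact: ush_sh_isom.
  by apply: fmap_isomorphic; apply: IH => X'; exact: iter_map_id.
case: n => [|n]; first exact: isomorphic_refl.
have -> : Negz n.+1 + 1 = Negz n by rewrite !NegzE; lia.
exact: isomorphic_refl.
Qed.

Lemma shn_ush k X : isomorphic (shn k (ush X)) (shn (k - 1) X).
Proof.
have := shn_iso (k - 1) (sh_ush_isom X) => /isomorphic_sym e.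
apply/isomorphic_sym; apply: isomorphic_trans e _.
by have := shn_sh (k - 1) (ush X); rewrite subrK.
Qed.

Lemma shnD k l X : isomorphic (shn k (shn l X)) (shn (k + l) X).
Proof.
case: l => n.
  elim: n k => [|n IH] k; first by rewrite addr0; exact: isomorphic_refl.
  apply: isomorphic_trans (shn_sh k _) _; apply: isomorphic_trans (IH _) _.
  by rewrite -addrA -PoszD add1n; exact: isomorphic_refl.
elim: n k => [|n IH] k; first exact: shn_ush.
apply: isomorphic_trans (shn_ush k _) _; apply: isomorphic_trans (IH _) _.
have -> : k - 1 + Negz n = k + Negz n.+1 by rewrite !NegzE; lia.
exact: isomorphic_refl.
Qed.

Lemma shnK k X : isomorphic (shn k (shn (- k) X)) X.
Proof. by have := shnD k (- k) X; rewrite subrr. Qed.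

Lemma shnKV k X : isomorphic (shn (- k) (shn k X)) X.
Proof. by have := shnD (- k) k X; rewrite addNr. Qed.

Lemma triangle_shn k X Y Z :
  triangle X Y Z -> triangle (shn k X) (shn k Y) (shn k Z).
Proof.
case: k => n t; first by elim: n => //= n IH; apply: (triangle_sh _ _ _).1.
by elim: n => [|n IH]; apply: triangle_ush.
Qed.

(** For isomorphism-closed [P] this is membership in [sh_sub k P] (see [sh_sub_lev]), tested on the
    object shifted back instead of through a witness. *)
Definition lev (P : D -> Prop) k X : Prop := P (shn (- k) X).

Section Levels.
Variable P : D -> Prop.
Hypothesis Piso : iso_closed P.

Lemma lev_iso k : iso_closed (lev P k).
Proof. by move=> X Y XY; apply: Piso; apply: shn_iso. Qed.

Lemma lev_shn k l X : lev P (k + l) (shn l X) <-> lev P k X.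
Proof.
have e : isomorphic (shn (- (k + l)) (shn l X)) (shn (- k) X).
  by have := shnD (- (k + l)) l X; rewrite opprD addrNK.
by split; apply: Piso => //; exact: isomorphic_sym.
Qed.

Lemma lev_sh k X : lev P (k + 1) (sh X) <-> lev P k X.
Proof. exact: (lev_shn k 1). Qed.

Lemma lev_ush k X : lev P (k - 1) (ush X) <-> lev P k X.
Proof. exact: (lev_shn k (-1)). Qed.

Lemma lev_shn0 k X : lev P k (shn k X) <-> P X.
Proof. by have := lev_shn 0 k X; rewrite add0r. Qed.

Lemma lev_pred k X : (forall Y, P Y -> P (sh Y)) -> lev P (k + 1) X -> lev P k X.
Proof.
move=> Psh /Psh; apply: Piso.
by have := sh_shn (- (k + 1)) X; rewrite opprD addrNK.
Qed.

Lemma lev_succ k X : (forall Y, P Y -> P (ush Y)) -> lev P k X -> lev P (k + 1) X.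
Proof.
move=> Push /Push; apply: Piso.
by have := shnD (-1) (- k) X; rewrite opprD addrC.
Qed.

Lemma lev_anti k j X : (forall Y, P Y -> P (sh Y)) -> k <= j ->
  lev P j X -> lev P k X.
Proof.
move=> Psh kj; have -> : j = k + `|j - k|%N%:Z by lia.
elim: `|j - k|%N => [|n IH]; first by rewrite addr0.
by rewrite (_ : k + n.+1%:Z = k + n%:Z + 1); [move=> /lev_pred/IH; apply | lia].
Qed.

Lemma lev_mono k j X : (forall Y, P Y -> P (ush Y)) -> k <= j ->
  lev P k X -> lev P j X.
Proof.
move=> Push kj PX; have -> : j = k + `|j - k|%N%:Z by lia.
elim: `|j - k|%N => [|n IH]; first by rewrite addr0.
by rewrite (_ : k + n.+1%:Z = k + n%:Z + 1); [exact: lev_succ | lia].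
Qed.

Lemma sh_sub_lev k X : sh_sub k P X <-> lev P k X.
Proof.
split=> [[Y PY XY]|PX].
  by apply: lev_iso (isomorphic_sym XY) _; apply/lev_shn0.
by exists (shn (- k) X) => //; apply/isomorphic_sym/shnK.
Qed.

Lemma lev_summand k X Y S : summand_closed P -> is_dsum X Y S ->
  lev P k S -> lev P k X.
Proof. by move=> Psum d; apply: Psum; exact: shn_dsum d. Qed.

End Levels.

End Shifts.

(** * Orthogonality and truncation at all levels *)

Section Orthogonality.
Variables (K : fieldType) (D : tricat K).
Implicit Types X Y Z W : D.

Definition hom0 X Y : Prop := forall f : mor X Y, f = 0.

Lemma hom0_ext_l X Y Z W : triangle X Y Z -> hom0 X W -> hom0 Z W -> hom0 Y W.
Proof.
move=> [f [g [h d]]] XW ZW u.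
by have [v ->] := weak_coker d (XW (u ∘ f)); rewrite (ZW v) comp0l.
Qed.

Lemma hom0_ext_r X Y Z W : triangle X Y Z -> hom0 W X -> hom0 W Z -> hom0 W Y.
Proof.
move=> [f [g [h d]]] WX WZ u.
by have [v ->] := weak_ker d (WZ (g ∘ u)); rewrite (WX v) comp0r.
Qed.

Lemma hom0_shn k X Y : hom0 (shn k X) (shn k Y) -> hom0 X Y.
Proof.
move=> H f; suff iter_inj (F : functor D D) n : additive_functor F ->
    (forall X Y (f g : mor X Y), fmor F f = fmor F g -> f = g) ->
    iter_map F n f = 0 -> f = 0.
  case: k H => n H; apply: (iter_inj _ _ _ _ (H _)).
  - exact: sh_add.
  - exact: sh_faithful.
  - exact: ush_add.
  - exact: ush_faithful.
move=> Fadd Finj; elim: n => //= n IH e; apply: IH; apply: Finj.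
by rewrite e fmap0.
Qed.

Lemma hom0_refl X : hom0 X X -> is_zero X.
Proof. by move=> H; apply/is_zero_id. Qed.

Section LevelPairs.
Variables (P Q : D -> Prop) (p q : int).
Hypotheses (Piso : iso_closed P) (Qiso : iso_closed Q).

(** The axioms of both kinds of structures speak of a single pair of levels [(p, q)], namely (0, -1)
    for t-structures and (-1, 0) for co-t-structures; shifting moves them to all levels. *)
Lemma lev_hom0 : (forall X Y, lev P p X -> lev Q q Y -> hom0 X Y) ->
  forall k X Y, lev P (p + k) X -> lev Q (q + k) Y -> hom0 X Y.
Proof.
move=> H k X Y PX QY; apply: (@hom0_shn (- k)); apply: H.
  by apply/(lev_shn Piso _ k); apply: lev_iso PX => //; exact/isomorphic_sym/shnK.
by apply/(lev_shn Qiso _ k); apply: lev_iso QY => //; exact/isomorphic_sym/shnK.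
Qed.

Lemma lev_trunc : (forall E, exists X Y, [/\ lev P p X, lev Q q Y & triangle X E Y]) ->
  forall k E, exists X Y, [/\ lev P (p + k) X, lev Q (q + k) Y & triangle X E Y].
Proof.
move=> H k E; have [X [Y [PX QY t]]] := H (shn (- k) E).
exists (shn k X), (shn k Y); split; [exact/lev_shn | exact/lev_shn |].
apply: triangle_iso (triangle_shn k t); try exact: isomorphic_refl.
exact: shnK.
Qed.

End LevelPairs.

End Orthogonality.

(** * Dimensions *)

Section Dimension.
Variables (R : realType) (K : fieldType).
Implicit Types V W U : lmodType K.

Lemma linear_sum V W (f : V -> W) (n : nat) (c : 'I_n -> K) (v : 'I_n -> V) :
  linear f -> f (\sum_i c i *: v i) = \sum_i c i *: f (v i).
Proof.
move=> fl; have f0 : f 0 = 0.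
  by have := fl (-1) 0 0; rewrite scaler0 addr0 scaleN1r addNr.
have fD x y : f (x + y) = f x + f y by have := fl 1 x y; rewrite !scale1r.
have fZ a x : f (a *: x) = a *: f x by have := fl a x 0; rewrite !addr0 f0 addr0.
by rewrite (big_morph f fD f0); apply: eq_bigr => i _; rewrite fZ.
Qed.

Lemma lin_indep_inj V W (f : V -> W) (n : nat) (v : 'I_n -> V) :
  linear f -> (forall x, f x = 0 -> x = 0) -> lin_indep v -> lin_indep (f \o v).
Proof.
by move=> fl fi vi c; rewrite -linear_sum // => /fi/vi.
Qed.

Lemma dimE_ge0 V : (0 <= dimE R V)%E.
Proof.
apply: ereal_sup_ubound; exists 0%N => //.
by exists (fun _ => 0) => c _ [].
Qed.

Lemma dimE_ge V (n : nat) (v : 'I_n -> V) :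
  lin_indep v -> (n%:R%:E <= dimE R V)%E.
Proof. by move=> vi; apply: ereal_sup_ubound; exists n => //; exists v. Qed.

Lemma dimE_inj V W (f : V -> W) :
  linear f -> (forall x, f x = 0 -> x = 0) -> (dimE R V <= dimE R W)%E.
Proof.
move=> fl fi; apply: ge_ereal_sup => _ [n [v vi] <-].
exact: dimE_ge (lin_indep_inj fl fi vi).
Qed.

Lemma lin_indep_rV (n m : nat) (v : 'I_m -> 'rV[K]_n) : lin_indep v -> (m <= n)%N.
Proof.
move=> vi; pose A := \matrix_(i < m) v i.
suff : row_free A by move=> /eqP <-; apply: rank_leq_col.
rewrite -kermx_eq0; apply/eqP/row_matrixP => i; rewrite row0.
have : row i (kermx A) *m A = 0 by apply/sub_kermxP; rewrite row_sub.
rewrite mulmx_sum_row => e.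
apply/rowP => j; rewrite [RHS]mxE.
apply: (vi (fun j => row i (kermx A) 0 j)).
by rewrite -[RHS]e; apply: eq_bigr => k _; rewrite rowK.
Qed.

Lemma lin_indep_tail V n (v : 'I_n.+1 -> V) :
  lin_indep v -> lin_indep (v \o lift ord0).
Proof.
move=> vi c e i.
pose c' j := if unlift ord0 j is Some k then c k else 0.
have <- : c' (lift ord0 i) = c i by rewrite /c' liftK.
apply: vi; rewrite big_ord_recl /c' unlift_none scale0r add0r -[RHS]e.
by apply: eq_bigr => k _; rewrite liftK.
Qed.

Lemma lin_indep_le V (n m : nat) (v : 'I_n -> V) : (m <= n)%N ->
  lin_indep v -> exists w : 'I_m -> V, lin_indep w.
Proof.
elim: n v => [|n IH] v; first by rewrite leqn0 => /eqP ->; exists v.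
rewrite leq_eqVlt => /orP[/eqP ->|mn] vi; first by exists v.
exact: IH mn (lin_indep_tail vi).
Qed.

(** Makes the supremum usable: a finite dimension is attained by an independent family and comes
    with injective linear coordinates, so that comparisons reduce to the rank of matrices. *)
Lemma dimE_cases V : dimE R V = +oo%E \/ exists n,
  [/\ dimE R V = n%:R%:E, exists v : 'I_n -> V, lin_indep v &
    exists f : V -> 'rV[K]_n, linear f /\ forall x, f x = 0 -> x = 0].
Proof.
pose P n := `[< exists v : 'I_n -> V, lin_indep v >].
have [[n nPn]|/forallNP Pall] := pselect (exists n, ~~ P n); last first.
  left; apply/eqyP => r r0.
  have rn : r < (Num.bound r)%:R by exact: archi_boundP (ltW r0).
  have /negP/negPn/asboolP[v vi] := Pall (Num.bound r).
  by apply: le_trans _ (dimE_ge vi); rewrite lee_fin ltW.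
right; have := @ex_minnP (fun n => ~~ P n) (ex_intro _ n nPn).
(* The least size without an independent family is a successor [m.+1], hence a family of size [m] is
   maximal and every vector depends on it. *)
case=> -[/negP[]|m nPm mmin]; first by apply/asboolP; exists (fun _ => 0) => c _ [].
have /asboolP[v vi] : P m by apply/negPn/negP => /mmin; rewrite ltnn.
exists m; split; [|by exists v|].
  apply/eqP; rewrite eq_le (dimE_ge vi) andbT.
  apply: ge_ereal_sup => _ [k [w wi] <-]; rewrite lee_fin ler_nat leqNgt.
  by apply: contra nPm => mk; apply/asboolP; exact: lin_indep_le mk wi.
have ex x : exists c : 'rV[K]_m, x = \sum_i c 0 i *: v i.
  pose w (i : 'I_m.+1) := if unlift ord0 i is Some j then v j else x.
  have : ~ lin_indep w by move=> wi; move/negP: nPm; apply; apply/asboolP; exists w.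
  move=> /existsNP[c /not_implyP[e /existsNP[i ci]]].
  move: e; rewrite big_ord_recl /w unlift_none => e.
  have {}e : c ord0 *: x = - \sum_(j < m) c (lift ord0 j) *: v j.
    apply/eqP; rewrite -addr_eq0 -[X in _ == X]e; apply/eqP; congr (_ + _).
    by apply: eq_bigr => j _; rewrite liftK.
  have c0 : c ord0 != 0.
    apply/eqP => c0; apply: ci; case: (unliftP ord0 i) => [j ->|-> //].
    apply: (vi (fun j => c (lift ord0 j))); apply/eqP; rewrite -oppr_eq0 -e c0.
    by rewrite scale0r.
  exists (\row_j (- (c ord0)^-1 * c (lift ord0 j))).
  rewrite -[LHS]scale1r -(mulVf c0) -scalerA e scalerN scaler_sumr -sumrN.
  by apply: eq_bigr => j _; rewrite mxE scalerA mulNr scaleNr.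
have [f fP] := choice ex; exists f; split=> [a x y|x fx].
  apply/rowP => i; rewrite !mxE; apply/eqP; rewrite -subr_eq0; apply/eqP.
  apply: (vi (fun i => f (a *: x + y) 0 i - (a * f x 0 i + f y 0 i))).
  under eq_bigr do rewrite scalerBl scalerDl -scalerA.
  by rewrite sumrB big_split /= -scaler_sumr -!fP subrr.
by rewrite (fP x) fx; apply: big1 => i _; rewrite mxE scale0r.
Qed.

Lemma dimE_rV_le (n : nat) : (dimE R 'rV[K]_n <= n%:R%:E)%E.
Proof.
by apply: ge_ereal_sup => _ [m [v /lin_indep_rV mn] <-]; rewrite lee_fin ler_nat.
Qed.

Lemma dimE_prod V W : dimE R (V * W)%type = (dimE R V + dimE R W)%E.
Proof.
have iV : (dimE R V <= dimE R (V * W)%type)%E.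
  apply: (@dimE_inj _ _ (fun x => (x, 0))) => [a x y|x [] //].
  by congr pair; rewrite /= scaler0 addr0.
have iW : (dimE R W <= dimE R (V * W)%type)%E.
  apply: (@dimE_inj _ _ (fun x => (0, x))) => [a x y|x [] //].
  by congr pair; rewrite /= scaler0 addr0.
case: (dimE_cases V) => [eV|[p [eV [v vi] [f [fl fi]]]]].
  by rewrite eV addye ?gt_eqF ?(lt_le_trans _ (dimE_ge0 W)) ?ltNy0 //;
     apply/eqP; rewrite -leye_eq -eV.
case: (dimE_cases W) => [eW|[q [eW [w wi] [g [gl gi]]]]].
  by rewrite eW addey ?gt_eqF ?(lt_le_trans _ (dimE_ge0 V)) ?ltNy0 //;
     apply/eqP; rewrite -leye_eq -eW.
rewrite eV eW -EFinD -natrD; apply/eqP; rewrite eq_le; apply/andP; split.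
  apply: le_trans (dimE_rV_le (p + q)).
  apply: (@dimE_inj _ _ (fun x => row_mx (f x.1) (g x.2))) => [a x y|x].
    by rewrite /= fl gl scale_row_mx add_row_mx.
  rewrite -[X in _ = X]row_mx0 => /eq_row_mx[/fi x1 /gi x2].
  by case: x x1 x2 => x y /= -> ->.
pose u (i : 'I_(p + q)) : (V * W)%type :=
  match fintype.split i with inl j => (v j, 0) | inr j => (0, w j) end.
apply: (@dimE_ge _ _ u) => c; rewrite big_split_ord /= => e.
have eE : \sum_(i < p) c (lshift q i) *: v i = 0 /\
    \sum_(j < q) c (rshift p j) *: w j = 0.
  have := e; under eq_bigr do rewrite /u (unsplitK (inl _)).
  under [X in _ + X]eq_bigr do rewrite /u (unsplitK (inr _)).
  move=> e'; split.
    have := congr1 fst e'; rewrite /= !(big_morph fst (id1 := 0) (op1 := +%R)) //=.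
    by rewrite [X in _ + X]big1 ?addr0 // => i _; rewrite scaler0.
  have := congr1 snd e'; rewrite /= !(big_morph snd (id1 := 0) (op1 := +%R)) //=.
  by rewrite [X in X + _]big1 ?add0r // => i _; rewrite scaler0.
move=> i; rewrite -[i]fintype.splitK; case: (fintype.split i) => j /=.
  exact: (vi (fun j => c (lshift q j)) eE.1).
exact: (wi (fun j => c (rshift p j)) eE.2).
Qed.

Lemma dimE_eq0 V : dimE R V = 0%E <-> forall x : V, x = 0.
Proof.
split=> [V0 x|V0].
  case: (dimE_cases V) => [|[n []]]; rewrite V0 // => -[]/esym/eqP.
  by rewrite pnatr_eq0 => /eqP -> _ [f [_ fi]]; apply: fi; exact: thinmx0.
apply/eqP; rewrite eq_le dimE_ge0 andbT; apply: ge_ereal_sup => _ [[|n] [v vi] <-] //.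
by have := vi (fun=> 1) (V0 _) ord0 => /eqP; rewrite oner_eq0.
Qed.

Lemma dimE_field : dimE R (K^o : lmodType K) = 1%E.
Proof.
apply/eqP; rewrite eq_le; apply/andP; split.
  apply: le_trans (dimE_rV_le 1).
  apply: (@dimE_inj _ _ (fun x : K^o => const_mx x : 'rV_1)) => [a x y|x].
    by apply/rowP => i; rewrite !mxE.
  by move=> /rowP/(_ 0); rewrite !mxE.
apply: (@dimE_ge _ 1 (fun _ => (1 : K^o))) => c; rewrite big_ord1 => e i.
by rewrite ord1 -e /GRing.scale /= mulr1.
Qed.

Definition linmap V W (f : V -> W) (fl : linear f) : {linear V -> W} :=
  HB.pack f (GRing.isLinear.Build K V W *:%R f fl).

Lemma lin0 V W (f : V -> W) : linear f -> f 0 = 0.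
Proof. by move=> fl; exact: (linear0 (linmap fl)). Qed.

Lemma linB V W (f : V -> W) x y : linear f -> f (x - y) = f x - f y.
Proof. by move=> fl; exact: (linearB (linmap fl)). Qed.

(** Exactness in the middle embeds [W] into [V * U]: with generalized inverses [H] of [f] and [L] of
    [g], the vector [y - L (G y)] lies in the kernel of [g], hence in the image of [f], where [H] is
    injective. *)
Lemma dimE_exact V W U (f : V -> W) (g : W -> U) : linear f -> linear g ->
  (forall y, g y = 0 -> exists x, y = f x) ->
  (dimE R W <= dimE R V + dimE R U)%E.
Proof.
move=> fl gl fg.
have [h [hl hP]] := generalized_inverse_ex (linmap fl).
have [k [kl kP]] := generalized_inverse_ex (linmap gl).
pose F := linmap fl; pose G := linmap gl; pose H := linmap hl; pose L := linmap kl.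
rewrite -dimE_prod.
apply: (@dimE_inj _ _ (fun y => (H (y - L (G y)), G y))) => [a x y|y].
  congr pair; last by rewrite linearP.
  have -> : L (G (a *: x + y)) = a *: L (G x) + L (G y) by rewrite !linearP.
  rewrite /= -[RHS](linearP H); congr (H _).
  by rewrite scalerBr opprD addrACA.
move=> [] hy gy; have [x ex] : exists x, y - L (G y) = f x.
  by apply: fg; rewrite [LHS](linearB G) [G (L _)]kP subrr.
move: hy; rewrite ex => hx; have : F (H (f x)) = f x := hP x.
rewrite [H _]hx linear0 -ex => /esym/eqP; rewrite subr_eq0 => /eqP ->.
by rewrite [G _]gy linear0.
Qed.

(** A generalized inverse of the surjection [g] is a section, which together with [f] embeds [V * U]
    into [W]. *)
Lemma dimE_short_exact V W U (f : V -> W) (g : W -> U) : linear f -> linear g ->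
  (forall x, f x = 0 -> x = 0) -> (forall x, g (f x) = 0) ->
  (forall z, exists y, z = g y) -> (dimE R V + dimE R U <= dimE R W)%E.
Proof.
move=> fl gl fi gf gs.
have [k [kl kP]] := generalized_inverse_ex (linmap gl).
pose F := linmap fl; pose G := linmap gl; pose L := linmap kl.
have gk z : g (k z) = z by have [y ->] := gs z; exact: kP.
rewrite -dimE_prod; apply: (@dimE_inj _ _ (fun x => F x.1 + L x.2)) => [a x y|x].
  suff : F (a *: x.1 + y.1) + L (a *: x.2 + y.2) =
      a *: (F x.1 + L x.2) + (F y.1 + L y.2) by [].
  by rewrite (linearP F) (linearP L) scalerDr addrACA.
move=> e; have : G (F x.1 + L x.2) = 0 by rewrite e linear0.
rewrite linearD [G (F _)]gf add0r [G _]gk => x2.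
move: e; rewrite x2 linear0 addr0 => /fi x1.
by case: x x1 x2 => x y /= -> ->.
Qed.

End Dimension.

(** * Cohomology in the derived category *)

Section DbCohomology.
Variable K : fieldType.
Implicit Types C D E : bcomplex K.

Local Notation cls C i := (@qpi K _ _ (@boundary_submod K C i)).

Lemma zvalB C i (x y : Z_space C i) : zval (x - y) = zval x - zval y.
Proof. exact: (raddfB (\val : Z_space C i -> _)). Qed.

Lemma zvalP_linear C i a (x y : Z_space C i) :
  zval (a *: x + y) = a *: zval x + zval y.
Proof. exact: (linearP (\val : Z_space C i -> _)). Qed.

(** In degree [i + 1] a boundary comes from degree [i] on the nose; [all_degrees] brings an
    arbitrary degree into this form. *)
Lemma cls_eq C i (x y : Z_space C (i + 1)) :
  cls C (i + 1) x = cls C (i + 1) y <-> exists w, zval x - zval y = cd C i w.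
Proof.
split=> [/qpiP/asboolP/is_boundaryS[w]|[w e]]; first by rewrite zvalB; exists w.
by apply/qpiP/asboolP/is_boundaryS; exists w; rewrite zvalB.
Qed.

Lemma cls_eq0 C i (x : Z_space C (i + 1)) :
  cls C (i + 1) x = 0 <-> exists w, zval x = cd C i w.
Proof.
have -> : 0 = cls C (i + 1) 0 by rewrite linear0.
by rewrite cls_eq (_ : zval 0 = 0) ?subr0.
Qed.

Definition Hmap C D i (u : db_hom C D) : cohomology C i -> cohomology D i :=
  @cohomology_map K C D (qrepr u) i.

(** On a cocycle, homotopic chain maps differ by a boundary, so the representative picked by [qrepr]
    is immaterial. *)
Lemma HmapE C D i (f : chain_map C D) (z : Z_space C i) :
  Hmap (db_class f) (cls C i z) = cls D i (Z_map f z).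
Proof.
rewrite /Hmap cohomology_mapE; set f' := qrepr _.
have /db_classP[h [hl hP]] : db_class f' = db_class f by rewrite qreprKd.
move: i z; apply: all_degrees => i z; apply/cls_eq; exists (h i (zval z)).
have -> : zval (Z_map f' z) - zval (Z_map f z) = (f' - f) (i + 1) (zval z) by [].
rewrite hP; have := zvalP z; rewrite unfold_in => /eqP ->.
suff -> : h (i + 1) 0 = 0 by rewrite addr0.
by have := hl (i + 1) (-1) 0 0; rewrite scaler0 addr0 scaleN1r addNr.
Qed.

Lemma Hmap_linear C D i (u : db_hom C D) : linear (@Hmap C D i u).
Proof.
move=> a x y; rewrite -[u]qreprKd -[x]qreprK -[y]qreprK -linearP !HmapE -linearP.
congr qpi; apply/val_inj; move: (qrepr u) => f.
have -> : \val (Z_map f (a *: qrepr x + qrepr y)) =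
  f i (zval (a *: qrepr x + qrepr y)) by [].
by rewrite zvalP_linear cm_linear [RHS]zvalP_linear.
Qed.

Lemma Hmap_id C i (x : cohomology C i) : Hmap (db_class (chain_id C)) x = x.
Proof. by rewrite -[x]qreprK HmapE; congr qpi; apply/val_inj. Qed.

Lemma Hmap_comp C D E i (v : db_hom D E) (u : db_hom C D) (x : cohomology C i) :
  Hmap (db_comp v u) x = Hmap v (Hmap u x).
Proof.
rewrite -[u]qreprKd -[v]qreprKd -[x]qreprK db_compE !HmapE.
by congr qpi; apply/val_inj.
Qed.

Lemma HmapD C D i (u v : db_hom C D) (x : cohomology C i) :
  Hmap (u + v) x = Hmap u x + Hmap v x.
Proof.
rewrite -[u]qreprKd -[v]qreprKd -[x]qreprK -db_classD !HmapE -linearD.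
congr qpi; apply/val_inj; rewrite (raddfD (\val : Z_space D i -> _)).
by [].
Qed.

Lemma Hmap0 C D i (x : cohomology C i) : Hmap (0 : db_hom C D) x = 0.
Proof. by apply: (addrI (Hmap 0 x)); rewrite -HmapD !addr0. Qed.

(** If [(0, z)] is the boundary of [(c, e)] in the cone, then [c] is a cocycle and
    [z = f c + d e]. *)
Lemma cone_exact C D (f : chain_map C D) i (y : cohomology D i) :
  Hmap (db_class (cone_in f)) y = 0 -> exists x, y = Hmap (db_class f) x.
Proof.
rewrite -[y]qreprK HmapE; move: (qrepr y) => {y}.
move: i; apply: all_degrees => i z /cls_eq0[[c e]] /= [ec ee].
have Zc : c \in cocycle C (i + 1).
  by rewrite unfold_in -oppr_eq0 -ec.
exists (cls C (i + 1) (ZSpace Zc)); rewrite HmapE; apply/cls_eq; exists e.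
by rewrite ee /= [LHS]addrAC subrr add0r.
Qed.

(** Only the middle term is treated: exactness at the other terms will come from rotating the
    triangle in [D] before applying [Gamma]. *)
Lemma db_dist_exact (X Y Z : Db K) (u : mor X Y) (v : mor Y Z)
    (w : mor Z (sh X)) i (y : cohomology Y i) :
  dist u v w -> Hmap v y = 0 -> exists x, y = Hmap u x.
Proof.
move=> [C [D [f [a [b [c [[_ [b' [b'b bb']] [c' [c'c _]]] [e1 e2 _]]]]]]]] vy.
have [|x ex] := @cone_exact _ _ f i (Hmap b' y).
  rewrite -[Hmap _ _]Hmap_id -[db_class (chain_id _)]c'c Hmap_comp.
  rewrite -(Hmap_comp c) [db_comp _ _]e2 Hmap_comp -(Hmap_comp b).
  rewrite [db_comp b b']bb' Hmap_id vy.
  exact: (linear0 (linmap (@Hmap_linear _ _ i c'))).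
exists (Hmap a x); rewrite -Hmap_comp -[db_comp u a]e1 Hmap_comp -ex -Hmap_comp.
by rewrite [db_comp b b']bb' Hmap_id.
Qed.

Section ShiftIso.
Variables (C : bcomplex K) (i : int).

Fact Zsh_subproof (z : Z_space (cx_sh C) i) : (zval z : C (i + 1)) \in cocycle C (i + 1).
Proof. by have := zvalP z; rewrite !unfold_in /= oppr_eq0. Qed.

Definition Zsh z : Z_space C (i + 1) := ZSpace (Zsh_subproof z).

(** Induced by the identity on cocycles: the sign in the shifted differential changes neither
    kernels nor images. *)
Definition Hsh (x : cohomology (cx_sh C) i) : cohomology C (i + 1) :=
  cls C (i + 1) (Zsh (qrepr x)).
End ShiftIso.

Lemma HshE C i (z : Z_space (cx_sh C) i) :
  Hsh (cls (cx_sh C) i z) = cls C (i + 1) (Zsh z).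
Proof.
rewrite /Hsh; move: i z; apply: all_degrees => i z.
have /cls_eq[w e] := qreprK (cls (cx_sh C) (i + 1) z).
by apply/cls_eq; exists (- w); rewrite linearN.
Qed.

Lemma Hsh_linear C i : linear (@Hsh C i).
Proof.
move=> a x y; rewrite -[x]qreprK -[y]qreprK -linearP !HshE -linearP.
congr qpi; apply/val_inj.
have -> : \val (Zsh (a *: qrepr x + qrepr y)) = zval (a *: qrepr x + qrepr y) by [].
by rewrite zvalP_linear [RHS]zvalP_linear.
Qed.

Lemma Hsh_inj C i x : @Hsh C i x = 0 -> x = 0.
Proof.
rewrite -[x]qreprK HshE; move: (qrepr x) => {x}; move: i.
apply: all_degrees => i z /cls_eq0[w e]; apply/cls_eq0.
by exists (- w); rewrite linearN /= opprK.
Qed.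

Lemma Hsh_surj C i y : exists x, y = @Hsh C i x.
Proof.
have Zz : (zval (qrepr y) : cx_sh C i) \in cocycle (cx_sh C) i.
  by have := zvalP (qrepr y); rewrite !unfold_in /= oppr_eq0.
exists (cls (cx_sh C) i (ZSpace Zz)); rewrite HshE -[LHS]qreprK.
by congr qpi; apply/val_inj.
Qed.

Lemma Hsh_nat C D i (u : db_hom C D) (x : cohomology (cx_sh C) i) :
  Hsh (Hmap (db_sh_map u) x) = Hmap u (Hsh x).
Proof.
rewrite -[u]qreprKd -[x]qreprK db_sh_mapE HmapE !HshE.
apply: etrans (esym (HmapE _ _)).
by apply: (congr1 (cls D (i + 1))); apply/val_inj.
Qed.

Lemma dim_unit_cx (R : realType) i :
  dimE R (cohomology (unit_cx K) i) = if i == 0 then 1%E else 0%E.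
Proof.
case: eqP => [->|/eqP i0]; last first.
  apply/dimE_eq0 => x; rewrite -[x]qreprK -[RHS](linear0 (cls (unit_cx K) i)).
  have U (u v : unit_cx K i) : u = v.
    by move: u v => /=; rewrite (negbTE i0) => u v; apply/rowP => -[].
  by congr qpi; apply/val_inj; apply: U.
have bd x : boundary x -> x = 0 :> Z_space (unit_cx K) 0.
  have B j (z : unit_cx K j) : is_boundary z -> z = 0 by case.
  by move=> /asboolP/B e; apply/val_inj.
have zP (x : unit_cx K 0) : x \in cocycle (unit_cx K) 0 by rewrite unfold_in.
apply/eqP; rewrite eq_le -(dimE_field R K).
rewrite -[K^o : lmodType K]/(unit_cx K 0 : lmodType K); apply/andP; split.
  apply: (@dimE_inj _ _ _ _ (fun x => zval (qrepr x))) => [a x y|x x0].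
    rewrite -[RHS](zvalP_linear a (qrepr x) (qrepr y)); congr zval.
    apply/eqP; rewrite -subr_eq0; apply/eqP/bd.
    have /qpiP // : cls (unit_cx K) 0 (qrepr (a *: x + y)) =
      cls (unit_cx K) 0 (a *: qrepr x + qrepr y) by rewrite [RHS]qpi_linear !qreprK.
  rewrite -[x]qreprK -[RHS](linear0 (cls (unit_cx K) 0)); congr qpi.
  exact/val_inj.
apply: (@dimE_inj _ _ _ _ (fun x => cls (unit_cx K) 0 (ZSpace (zP x)))).
  move=> a x y; rewrite -linearP; congr qpi; apply/val_inj.
  by rewrite [RHS]zvalP_linear.
move=> x; rewrite -[RHS](linear0 (cls (unit_cx K) 0)) => /qpiP/bd.
by rewrite subr0 => /(congr1 (@zval _ _ _)).
Qed.

End DbCohomology.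

(** * Abstract cohomology theories *)

Section CohTheory.
Variables (R : realType) (K : fieldType) (D : tricat K).

(** What the growth arguments need from the cohomology of [Gamma]:
    [hdim k X] is the dimension of [H^(-k) (Gamma X)] (of [H^k (Gamma X)] when
    [Gamma] is contravariant) and [hnull k f] says that [f] acts by zero there. *)
Record coh_theory := CohTheory {
  hdim : int -> D -> \bar R;
  hnull : int -> forall X Y : D, mor X Y -> Prop;
  hdim_ge0 : forall k X, (0 <= hdim k X)%E;
  hnull_id : forall k X, hnull k (idm X) <-> hdim k X = 0%E;
  hnull0 : forall k X Y, hnull k (0 : mor X Y);
  hnullD : forall k X Y (f g : mor X Y), hnull k f -> hnull k g -> hnull k (f + g);
  hnull_compl : forall k X Y Z (g : mor Y Z) (f : mor X Y),
    hnull k f -> hnull k (g ∘ f);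
  hnull_compr : forall k X Y Z (g : mor Y Z) (f : mor X Y),
    hnull k g -> hnull k (g ∘ f);
  hnull_sh : forall k X Y (f : mor X Y), hnull (k + 1) (fmor sh f) <-> hnull k f;
  hdim_sh : forall k X, hdim (k + 1) (sh X) = hdim k X;
  hdim_retract : forall k X S (i : mor X S) (p : mor S X),
    p ∘ i = idm X -> (hdim k X <= hdim k S)%E;
  hdim_le : forall k X Y Z (f : mor X Y) (g : mor Y Z) (h : mor Z (sh X)),
    dist f g h -> (hdim k Y <= hdim k X + hdim k Z)%E;
  hdim_ge : forall k X Y Z (f : mor X Y) (g : mor Y Z) (h : mor Z (sh X)),
    dist f g h -> hnull k h -> hnull (k + 1) h ->
    (hdim k X + hdim k Z <= hdim k Y)%E;
  hnull_cancel : forall k X Y Z (f : mor X Y) (g : mor Y Z) (h : mor Z (sh X)) W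
    (u : mor W Y), dist f g h -> hdim k X = 0%E -> hnull k (g ∘ u) -> hnull k u
}.

End CohTheory.

Section HmapTheory.
Variable K : fieldType.
Implicit Types C D : bcomplex K.

Lemma HmapN C D i (u : db_hom C D) (x : cohomology C i) :
  Hmap (- u) x = - Hmap u x.
Proof. by apply/eqP; rewrite -addr_eq0 -HmapD addNr Hmap0. Qed.

Lemma Hmap_0 C D i (u : db_hom C D) : Hmap u (0 : cohomology C i) = 0.
Proof. exact: lin0 (@Hmap_linear _ _ _ i u). Qed.

End HmapTheory.

(** * The cohomology theory of a covariant functor *)

Section CovariantTheory.
Variables (R : realType) (K : fieldType) (D : tricat K).
Variable Gamma : exact_functor D (Db K).
Implicit Types X Y Z W : D.

Let V k X : lmodType K := cohomology (Gamma X) (- k).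
Let vm k X Y (f : mor X Y) : V k X -> V k Y := @Hmap _ _ _ (- k) (fmor Gamma f).

Let vm_id k X (x : V k X) : vm (idm X) x = x.
Proof. by rewrite /vm Defs.fmap_id Hmap_id. Qed.

Let vm_comp k X Y Z (g : mor Y Z) (f : mor X Y) (x : V k X) :
  vm (g ∘ f) x = vm g (vm f x).
Proof. by rewrite /vm Defs.fmap_comp Hmap_comp. Qed.

Let vmD k X Y (f g : mor X Y) (x : V k X) : vm (f + g) x = vm f x + vm g x.
Proof. by rewrite /vm ex_additive HmapD. Qed.

Let vmN k X Y (f : mor X Y) (x : V k X) : vm (- f) x = - vm f x.
Proof. by rewrite /vm (fmapN (@ex_additive _ _ _ Gamma)) HmapN. Qed.

Let vm0 k X Y (x : V k X) : vm (0 : mor X Y) x = 0.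
Proof. by rewrite /vm (fmap0 (@ex_additive _ _ _ Gamma)) Hmap0. Qed.

Let vm_linear k X Y (f : mor X Y) : linear (@vm k X Y f).
Proof. exact: Hmap_linear. Qed.

Let vm_0 k X Y (f : mor X Y) : vm f (0 : V k X) = 0.
Proof. exact: Hmap_0. Qed.

Let vm_exact k X Y Z (f : mor X Y) (g : mor Y Z) (h : mor Z (sh X)) (y : V k Y) :
  dist f g h -> vm g y = 0 -> exists x, y = vm f x.
Proof. by move=> /(@ex_dist _ _ _ Gamma)/db_dist_exact; apply. Qed.

Let vm_sh k : exists th : forall X, V (k + 1) (sh X) -> V k X,
  (forall X, linear (th X)) /\ (forall X x, th X x = 0 -> x = 0) /\
  (forall X y, exists x, y = th X x) /\
  (forall X Y (f : mor X Y) x, th Y (vm (fmor sh f) x) = vm f (th X x)).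
Proof.
(* [Hsh] goes from degree [i] to degree [i + 1] literally. Generalizing both degrees turns this
   equation into a substitution and avoids a cast. *)
rewrite /vm /V; have : - (k + 1) + 1 = - k by rewrite opprD addrNK.
move: (- (k + 1)) (- k) => i j e; case: _ / e.
exists (fun X x => Hsh (Hmap (ex_sh Gamma X) x)).
split=> [X a x y|]; first by rewrite Hmap_linear Hsh_linear.
split=> [X x|].
  have [b [ba _]] := ex_sh_iso Gamma X.
  move=> /Hsh_inj e; rewrite -[x]Hmap_id -[db_class _]ba.
  by rewrite [LHS]Hmap_comp e Hmap_0.
split=> [X y|X Y f x].
  have [b [_ ab]] := ex_sh_iso Gamma X.
  have [x ->] := Hsh_surj y; exists (Hmap b x).
  by rewrite -Hmap_comp [db_comp _ _]ab Hmap_id.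
rewrite -Hsh_nat -!Hmap_comp; congr Hsh; congr (Hmap _ x).
exact: esym (ex_sh_nat Gamma f).
Qed.

Definition covariant_theory : coh_theory R D.
Proof.
apply: (@CohTheory R K D (fun k X => dimE R (V k X))
  (fun k X Y f => forall x : V k X, vm f x = 0)).
- by move=> k X; exact: dimE_ge0.
- by move=> k X; rewrite dimE_eq0; split=> H x; have := H x; rewrite vm_id.
- by move=> *; exact: vm0.
- by move=> k X Y f g f0 g0 x; rewrite vmD f0 g0 addr0.
- by move=> k X Y Z g f f0 x; rewrite vm_comp f0 vm_0.
- by move=> k X Y Z g f g0 x; rewrite vm_comp g0.
- move=> k X Y f; have [th [thl [thi [ths thn]]]] := vm_sh k.
  have th0 Z : th Z 0 = 0 := lin0 (thl Z).
  split=> H x; last by apply: thi; rewrite thn H.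
  by have [x' ->] := ths _ x; rewrite -thn H th0.
- move=> k X; have [th [thl [thi [ths thn]]]] := vm_sh k.
  apply/eqP; rewrite eq_le (dimE_inj R (thl X) (thi X)) /=.
  have [u uK] := choice (ths X).
  apply: (@dimE_inj _ _ _ _ u) => [a x y|x ux]; last first.
    by rewrite (uK x) ux (lin0 (thl X)).
  apply/eqP; rewrite -subr_eq0; apply/eqP/(thi X).
  by rewrite linB // thl -!uK subrr.
- move=> k X S i p pi; apply: (dimE_inj R (@vm_linear k _ _ i)) => x ix.
  by rewrite -[x]vm_id -pi vm_comp ix vm_0.
- move=> k X Y Z f g h d.
  by apply: dimE_exact => [||y /(vm_exact d)]; [exact: (vm_linear f)|exact: (vm_linear g)|].
(* The connecting map enters twice in the long exact sequence: its vanishing in index [k] makes [g]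
   surjective, and its vanishing in index [k + 1] makes [f] injective, the kernel of [f] being the
   image of index [k + 1] of [Z]. *)
- move=> k X Y Z f g h d h0 h1.
  apply: (dimE_short_exact R (@vm_linear k _ _ f) (@vm_linear k _ _ g)) => [x fx|x|z].
  + have [th [thl [thi [ths thn]]]] := vm_sh k.
    have [x' ex] := ths _ x; rewrite ex.
    have sfx : vm (- fmor sh f) x' = 0.
      by rewrite vmN; apply/eqP; rewrite oppr_eq0; apply/eqP/thi; rewrite thn -ex.
    have [w ->] := vm_exact ((dist_rot2 _ _ _).1 d) sfx.
    by rewrite h1 (lin0 (thl X)).
  + by rewrite -vm_comp (comp0_dist d) vm0.
  + exact: vm_exact ((dist_rot _ _ _).1 d) (h0 z).
- move=> k X Y Z f g h W u d X0 gu x.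
  have [|y ->] := vm_exact (y := vm u x) d; first by rewrite -vm_comp.
  by rewrite ((dimE_eq0 _ _).1 X0 y) vm_0.
Defined.

Lemma hdim_covariant k X :
  hdim covariant_theory k X = dimE R (cohomology (Gamma X) (- k)).
Proof. by []. Qed.

Lemma hnull_covariant k X Y (f : mor X Y) :
  fmor Gamma f = 0 -> hnull covariant_theory k f.
Proof. by move=> f0 x; rewrite /vm f0 Hmap0. Qed.

End CovariantTheory.

(** * The cohomology theory of a contravariant functor *)

Section ContravariantTheory.
Variables (R : realType) (K : fieldType) (D : tricat K).
Variable Gamma : exact_functor (op_shiftcat D) (Db K).
Implicit Types X Y Z W : D.

Let V k X : lmodType K := cohomology (Gamma X) k.
Let vm k X Y (f : mor X Y) : V k Y -> V k X :=
  @Hmap _ _ _ k (@fmor _ _ _ Gamma Y X f).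

Let vm_id k X (x : V k X) : vm (idm X) x = x.
Proof. by rewrite /vm (Defs.fmap_id Gamma) Hmap_id. Qed.

Let vm_comp k X Y Z (g : mor Y Z) (f : mor X Y) (x : V k Z) :
  vm (g ∘ f) x = vm f (vm g x).
Proof.
rewrite /vm; have /= -> := @Defs.fmap_comp _ _ _ Gamma Z Y X f g.
by rewrite Hmap_comp.
Qed.

Let vmD k X Y (f g : mor X Y) (x : V k Y) : vm (f + g) x = vm f x + vm g x.
Proof. by rewrite /vm (@ex_additive _ _ _ Gamma Y X) HmapD. Qed.

Let vmN k X Y (f : mor X Y) (x : V k Y) : vm (- f) x = - vm f x.
Proof. by rewrite /vm (@fmapN _ _ _ _ (@ex_additive _ _ _ Gamma) Y X) HmapN. Qed.

Let vm0 k X Y (x : V k Y) : vm (0 : mor X Y) x = 0.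
Proof. by rewrite /vm (@fmap0 _ _ _ _ (@ex_additive _ _ _ Gamma) Y X) Hmap0. Qed.

Let vm_linear k X Y (f : mor X Y) : linear (@vm k X Y f).
Proof. exact: Hmap_linear. Qed.

Let vm_0 k X Y (f : mor X Y) : vm f (0 : V k Y) = 0.
Proof. exact: Hmap_0. Qed.

Let vm_exact k X Y Z (f : mor X Y) (g : mor Y Z) (h : mor Z (sh X)) (y : V k Y) :
  dist f g h -> vm f y = 0 -> exists z, y = vm g z.
Proof.
(* Exactness in the opposite category asks for a third map from [ush Z] to [X] whose shift is [h] up
   to [sh_ush]; fullness provides it. *)
move=> d; have [h' eh] := sh_full (h ∘ sh_ush Z).
have d' : @dist _ (op_shiftcat D) Z Y X g f h' by exists h.
exact: db_dist_exact (ex_dist Gamma d').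
Qed.

(** [Gamma] carries [ush] to the shift of complexes, so [X] is first replaced by [ush (sh X)]. Hence
    [sh] raises the cohomological degree, and index [k] has to stand for degree [k] here. *)
Let vm_sh k : exists th : forall X, V k X -> V (k + 1) (sh X),
  (forall X, linear (th X)) /\ (forall X x, th X x = 0 -> x = 0) /\
  (forall X y, exists x, y = th X x) /\
  (forall X Y (f : mor X Y) y, th X (vm f y) = vm (fmor sh f) (th Y y)).
Proof.
pose e X : db_hom (Gamma (ush (sh X))) (cx_sh (Gamma (sh X))) := ex_sh Gamma (sh X).
exists (fun X x => Hsh (Hmap (e X) (vm (ush_sh X) x))).
split=> [X a x y|]; first by rewrite vm_linear Hmap_linear Hsh_linear.
split=> [X x|].
  have [b [ba _]] := ex_sh_iso Gamma (sh X).
  have [c [_ ac]] := ush_sh_iso X.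
  move=> /Hsh_inj e0; rewrite -[x]vm_id -ac vm_comp.
  rewrite -[vm (ush_sh X) x]Hmap_id -[db_class _]ba.
  by rewrite [X in vm c X]Hmap_comp e0 Hmap_0 vm_0.
split=> [X y|X Y f y].
  have [b [_ ab]] := ex_sh_iso Gamma (sh X).
  have [c [ca _]] := ush_sh_iso X.
  have [x ->] := Hsh_surj y; exists (vm c (Hmap b x)).
  by rewrite -vm_comp ca vm_id -Hmap_comp [db_comp _ _]ab Hmap_id.
rewrite /vm -Hsh_nat; congr Hsh; rewrite -/(vm _ _).
rewrite -[vm (ush_sh X) _]vm_comp ush_sh_nat vm_comp.
rewrite /vm -!(Hmap_comp (e X)) -(Hmap_comp (db_sh_map _)).
congr (Hmap _ _); exact: esym (@ex_sh_nat _ _ _ Gamma (sh Y) (sh X) (fmor sh f)).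
Qed.

Definition contravariant_theory : coh_theory R D.
Proof.
apply: (@CohTheory R K D (fun k X => dimE R (V k X))
  (fun k X Y f => forall y : V k Y, vm f y = 0)).
- by move=> k X; exact: dimE_ge0.
- by move=> k X; rewrite dimE_eq0; split=> H x; have := H x; rewrite vm_id.
- by move=> *; exact: vm0.
- by move=> k X Y f g f0 g0 x; rewrite vmD f0 g0 addr0.
- by move=> k X Y Z g f f0 x; rewrite vm_comp f0.
- by move=> k X Y Z g f g0 x; rewrite vm_comp g0 vm_0.
- move=> k X Y f; have [th [thl [thi [ths thn]]]] := vm_sh k.
  split=> H x; first by apply: thi; rewrite thn H.
  by have [x' ->] := ths _ x; rewrite -thn H (lin0 (thl _)).
- move=> k X; have [th [thl [thi [ths thn]]]] := vm_sh k.
  apply/eqP; rewrite eq_le (dimE_inj R (thl X) (thi X)) andbT.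
  have [u uK] := choice (ths X).
  apply: (@dimE_inj _ _ _ _ u) => [a x y|x ux]; last first.
    by rewrite (uK x) ux (lin0 (thl X)).
  apply/eqP; rewrite -subr_eq0; apply/eqP/(thi X).
  by rewrite linB // thl -!uK subrr.
- move=> k X S i p pi; apply: (dimE_inj R (@vm_linear k _ _ p)) => x px.
  by rewrite -[x]vm_id -pi vm_comp px vm_0.
- move=> k X Y Z f g h d; rewrite addeC.
  by apply: dimE_exact => [||y /(vm_exact d)]; [exact: (vm_linear g)|exact: (vm_linear f)|].
- move=> k X Y Z f g h d h0 h1; rewrite addeC.
  apply: (dimE_short_exact R (@vm_linear k _ _ g) (@vm_linear k _ _ f)) => [z gz|z|x].
  + have [w ->] := vm_exact ((dist_rot _ _ _).1 d) gz.
    exact: h0.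
  + by rewrite -vm_comp (comp0_dist d) vm0.
  + have [th [thl [thi [ths thn]]]] := vm_sh k.
    have [w ew] := vm_exact ((dist_rot2 _ _ _).1 d) (h1 (th X x)).
    have [y ey] := ths _ (- w); exists y.
    apply/eqP; rewrite -subr_eq0; apply/eqP/thi; rewrite linB // thn -ey ew.
    by rewrite vmN -[- w]sub0r (linB _ _ (vm_linear _)) vm_0 sub0r subrr.
- move=> k X Y Z f g h W u d X0 gu y.
  have [|z ->] := vm_exact (y := y) d; last by rewrite -vm_comp.
  exact: (dimE_eq0 _ _).1 X0 _.
Defined.

Lemma hdim_contravariant k X :
  hdim contravariant_theory k X = dimE R (cohomology (Gamma X) k).
Proof. by []. Qed.

Lemma hnull_contravariant k X Y (f : mor X Y) :
  @fmor _ _ _ Gamma Y X f = 0 -> hnull contravariant_theory k f.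
Proof. by move=> f0 x; rewrite /vm f0 Hmap0. Qed.

End ContravariantTheory.

(** * Growth rates *)

Section Growth.
Variable R : realType.

Lemma le_limn_esup (u v : nat -> \bar R) :
  (forall n, (u n <= v n)%E) -> (limn_esup u <= limn_esup v)%E.
Proof.
move=> uv; apply: le_ereal_inf_tmp => _ [A FA <-].
apply: (@le_trans _ _ (ereal_sup (u @` A))).
  by apply: ereal_inf_lbound; exists A.
apply: ge_ereal_sup => _ [n An <-]; apply: le_trans (uv n) _.
by apply: ereal_sup_ubound; exists n.
Qed.

Lemma near_div_le (M e : R) : 0 < e -> \forall n \near \oo, M / n%:R <= e.
Proof.
move=> e0; near=> n.
have n0 : (0 < n%:R :> R) by rewrite ltr0n; near: n; exact: nbhs_infty_gt.
by rewrite ler_pdivrMr // mulrC -ler_pdivrMr //; near: n; exact: nbhs_infty_ger.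
Unshelve. all: by end_near. Qed.

Lemma cvg_bounded_div (x : nat -> R) (M : R) :
  (forall n, `|x n| <= M) -> (n%:R^-1 * x n) @[n --> \oo] --> (0 : R).
Proof.
move=> xM; apply/cvgrPdist_le => e e0; near=> n.
rewrite sub0r normrN normrM normfV normr_nat mulrC.
apply: (@le_trans _ _ (M / n%:R)); first by rewrite ler_wpM2r.
by near: n; exact: near_div_le.
Unshelve. all: by end_near. Qed.

(** Handles a finite limit and the limit [-oo] uniformly, for a sequence that approaches its
    infimum. *)
Lemma cvge_of_bounds (v : nat -> R) (L : \bar R) : (L != +oo)%E ->
  (\forall n \near \oo, (L <= (v n)%:E)%E) ->
  (forall y, (L < y%:E)%E -> \forall n \near \oo, v n <= y) ->
  (fun n => (v n)%:E) @ \oo --> L.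
Proof.
case: L => [l| //|] _ lv vl; last first.
  by apply/cvgeNyPle => A; apply: filterS (vl A (ltNyr A)) => n; rewrite lee_fin.
apply/fine_cvgP; split; first by exists 0%N.
apply/cvgrPdist_le => e e0; near=> n; rewrite ler_distl; apply/andP; split.
  by rewrite lerBlDr; near: n; apply: vl; rewrite lte_fin ltrDl.
rewrite -lee_fin; apply: (@le_trans _ _ (v n)%:E); first by near: n.
by rewrite lee_fin lerDl ltW.
Unshelve. all: by end_near. Qed.

Lemma fekete (u : nat -> R) : (forall m n, u (m + n)%N <= u m + u n) ->
  exists2 L : \bar R, (L != +oo)%E & (fun n => (n%:R^-1 * u n)%:E) @ \oo --> L.
Proof.
move=> usub; pose v n := n%:R^-1 * u n.
(* The limit is the infimum of the quotients. Index 0 is left out, as its quotient is the default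
   value 0. *)
pose L := ereal_inf [set (v n)%:E | n in [set n | (0 < n)%N]].
have Lle n : (0 < n)%N -> (L <= (v n)%:E)%E.
  by move=> n0; apply: ereal_inf_lbound; exists n.
have Ly : (L != +oo)%E.
  by apply/eqP => Ly; have := Lle 1%N isT; rewrite Ly leye_eq.
exists L => //; apply: cvge_of_bounds => //.
- by exists 1%N => // n /= n0; exact: Lle.
move=> y /ereal_inf_lt[_ [m /= m0 <-]]; rewrite lte_fin => vmy.
have mR : 0 < m%:R :> R by rewrite ltr0n.
(* Bounds [u] on all remainders modulo [m] at once. *)
pose B := \sum_(r < m) `|u r|.
have uB r : (r < m)%N -> u r <= B.
  move=> rm; apply: le_trans (ler_norm _) _.
  by rewrite /B (bigD1 (Ordinal rm)) //= lerDl sumr_ge0.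
have uq q r : u (q * m + r)%N <= q%:R * u m + u r.
  elim: q => [|q IH]; first by rewrite mul0n mul0r add0r.
  rewrite mulSn -addnA -natr1 mulrDl mul1r; apply: le_trans (usub _ _) _.
  by rewrite [leRHS]addrAC [leLHS]addrC lerD2r.
near=> n.
have n0 : 0 < n%:R :> R by rewrite ltr0n; near: n; exact: nbhs_infty_gt.
(* Division of [n] by [m]: replacing the multiple of [m] by [n] costs the remainder times [v m],
   whose sign is unknown; the term with the absolute value absorbs it. *)
have le1 : u n <= n%:R * v m + (`|v m| * m%:R + B).
  have rm := ltn_pmod n m0.
  rewrite {1}(divn_eq n m); apply: le_trans (uq _ _) _.
  rewrite addrA; apply: lerD; last exact: uB.
  have -> : u m = m%:R * v m by rewrite /v mulrA divff ?mul1r ?gt_eqF.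
  rewrite {2}(divn_eq n m) natrD natrM mulrDl mulrA -addrA lerDl.
  have : - ((n %% m)%:R * v m) <= `|v m| * m%:R.
    apply: le_trans (ler_norm _) _; rewrite normrN normrM normr_nat mulrC.
    by rewrite ler_wpM2l // ler_nat ltnW.
  by rewrite -subr_ge0 opprK addrC.
have le2 : v n <= v m + (`|v m| * m%:R + B) / n%:R.
  rewrite /v -(ler_pM2l n0) mulrA divff ?mul1r ?gt_eqF //.
  by apply: le_trans le1 _; rewrite mulrDr [n%:R * (_ / _)]mulrC divfK ?gt_eqF.
apply: le_trans le2 _; rewrite -lerBrDl.
by near: n; apply: near_div_le; rewrite subr_gt0.
Unshelve. all: by end_near. Qed.

Lemma le_log_growth (a b : nat -> R) : (forall n, a n <= b n) ->
  forall n, (log_growth (fun N => (a N)%:E) n <= log_growth (fun N => (b N)%:E) n)%E.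
Proof.
move=> ab n; apply: lee_wpmul2l; first by rewrite lee_fin invr_ge0.
have [a0|a0] := leP (a n) 0; first by rewrite le0_lneNy ?lee_fin // leNye.
rewrite !lne_EFin ?(lt_le_trans a0) // lee_fin ler_ln ?posrE ?(lt_le_trans a0) //.
Qed.

(** The logarithms of the two sequences differ by a bounded amount, which division by [n] sends to
    0. *)
Lemma log_growth_comparable (a b : nat -> R) (c C : R) (L : \bar R) :
  0 < c -> 0 < C ->
  (forall n, b n <= c * a n) -> (forall n, a n <= C * b n) ->
  log_growth (fun N => (b N)%:E) @ \oo --> L ->
  log_growth (fun N => (a N)%:E) @ \oo --> L.
Proof.
move=> c0 C0 ba ab bL.
(* Where [b n] is not positive, neither is [a n]; both logarithms are then [-oo] and the correction
   may be 0. *)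
pose x n := if 0 < b n then ln (a n) - ln (b n) else 0.
have aE n : log_growth (fun N => (a N)%:E) n =
    (log_growth (fun N => (b N)%:E) n + (n%:R^-1 * x n)%:E)%E.
  rewrite /log_growth /x; have [b0|b0] := ltP 0 (b n).
    have a0 : 0 < a n by rewrite -(pmulr_rgt0 _ c0) (lt_le_trans b0).
    by rewrite !lne_EFin // -EFinD -mulrDr addrC subrK.
  rewrite !le0_lneNy ?lee_fin ?mulr0 ?adde0 //.
  by apply: le_trans (ab n) _; rewrite pmulr_rle0.
have xM n : `|x n| <= `|ln c| + `|ln C|.
  rewrite /x; case: ltP => b0; last by rewrite normr0 addr_ge0.
  have a0 : 0 < a n by rewrite -(pmulr_rgt0 _ c0) (lt_le_trans b0).
  rewrite ler_norml; apply/andP; split.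
    rewrite lerBrDr -lerBrDl; apply: (@le_trans _ _ (ln (c * a n))).
      by rewrite ler_ln ?posrE ?mulr_gt0.
    rewrite lnM ?posrE // addrC lerD2l opprK; apply: le_trans (ler_norm _) _.
    by rewrite lerDl.
  rewrite lerBlDr; apply: (@le_trans _ _ (ln (C * b n))).
    by rewrite ler_ln ?posrE ?mulr_gt0.
  rewrite lnM ?posrE // lerD2r; apply: le_trans (ler_norm _) _.
  by rewrite lerDr.
have -> : log_growth (fun N => (a N)%:E) =
    (log_growth (fun N => (b N)%:E) \+ (fun n => (n%:R^-1 * x n)%:E))%E.
  by apply/funext => n; exact: aE.
rewrite -[L]adde0.
apply: cvgeD bL _; first by rewrite fin_num_adde_defl.
apply/fine_cvgP; split; first by exists 0%N.
exact: cvg_bounded_div xM.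
Qed.

(** Once [b] vanishes it stays zero and its growth is [-oo]; otherwise Fekete's lemma applies to
    [ln (b n)]. *)
Lemma submul_log_growth (b : nat -> R) : (forall n, 0 <= b n) ->
  (forall m n, b (m + n)%N <= b m * b n) ->
  exists2 L : \bar R, (L != +oo)%E & log_growth (fun N => (b N)%:E) @ \oo --> L.
Proof.
move=> b0 bM; have [[n0 bn0]|/forallNP bp] := pselect (exists n, b n = 0).
  exists -oo%E => //; apply/cvgeNyPle => A; near=> n.
  have bn : b n = 0.
    apply/eqP; rewrite eq_le b0 andbT -(@subnK n0 n); last first.
      by near: n; exact: nbhs_infty_ge.
    by apply: le_trans (bM _ _) _; rewrite bn0 mulr0.
  rewrite /log_growth bn le0_lneNy // gt0_muleNy ?leNye // lte_fin invr_gt0 ltr0n.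
  by near: n; exact: nbhs_infty_gt.
have {}bp n : 0 < b n by rewrite lt_neqAle b0 andbT eq_sym; apply/eqP.
have [|L Ly uL] := @fekete (fun n => ln (b n)).
  by move=> m n; rewrite -lnM ?posrE // ler_ln ?posrE ?mulr_gt0.
exists L => //; rewrite (_ : log_growth _ = fun n => (n%:R^-1 * ln (b n))%:E) //.
by apply/funext => n; rewrite /log_growth lne_EFin.
Unshelve. all: by end_near. Qed.

End Growth.

(** * Mass functions *)

Section MassFunctions.
Variables (R : realType) (K : fieldType) (D : tricat K) (t : R).

(** The axioms are inequalities precisely so as to be inherited by [f \o Phi] ([mf_comp]): [Phi]
    preserves triangles, shifts and retracts, but not the vanishing of connecting maps on
    cohomology. *)
Record mass_fun (f : D -> R) : Prop := MassFun {
  mf_ge0 : forall X, 0 <= f X;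
  mf_zero : forall X, is_zero X -> f X = 0;
  mf_triangle : forall X Y Z, triangle X Y Z -> f Y <= f X + f Z;
  mf_sh : forall X, f (sh X) = expR t * f X;
  mf_retract : forall X S (i : mor X S) (p : mor S X), p ∘ i = idm X -> f X <= f S
}.

Section MassFunTheory.
Variables (f : D -> R) (mf : mass_fun f).

Lemma mf_iso X Y : isomorphic X Y -> f X = f Y.
Proof.
move=> [a [b [ba ab]]]; apply/eqP; rewrite eq_le.
by rewrite (mf_retract mf ba) (mf_retract mf ab).
Qed.

Lemma mf_ush X : f (ush X) = expR (- t) * f X.
Proof.
rewrite -(mf_iso (sh_ush_isom X)) (mf_sh mf) mulrA -expRD addNr expR0.
by rewrite mul1r.
Qed.

Lemma mf_shn k X : f (shn k X) = expR (k%:~R * t) * f X.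
Proof.
case: k => n; elim: n => [|n IH].
- by rewrite mul0r expR0 mul1r.
- rewrite [shn _ _]/= (mf_sh mf) [f _]IH mulrA -expRD; congr (expR _ * _).
  by rewrite -!pmulrn -natr1 mulrDl mul1r addrC.
- rewrite [shn _ _]/= mf_ush; congr (expR _ * _).
  by rewrite NegzE mulrNz mulr1z mulN1r.
- rewrite [shn _ _]/= mf_ush [f _]IH mulrA -expRD; congr (expR _ * _).
  rewrite !NegzE !mulrNz !mulNr -opprD; congr (- _).
  by rewrite -!pmulrn -[in RHS]natr1 mulrDl mul1r addrC.
Qed.

Lemma mf_dsum X Y S : is_dsum X Y S -> f S <= f X + f Y.
Proof. by move=> /dsum_triangle/(mf_triangle mf). Qed.

Lemma mf_comp (Phi : exact_functor D D) : mass_fun (f \o Phi).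
Proof.
have Padd := @ex_additive _ _ _ Phi.
split=> [X|X X0|X Y Z [u [v [w d]]]|X|X S i p e] /=.
- exact: mf_ge0.
- by apply: mf_zero => //; exact: fmap_is_zero.
- by apply: mf_triangle => //; do 3!eexists; exact: ex_dist d.
- by rewrite -(mf_sh mf); apply: mf_iso; exists (ex_sh Phi X); exact: ex_sh_iso.
- apply: (mf_retract mf (i := fmor Phi i) (p := fmor Phi p)).
  by rewrite -Defs.fmap_comp e Defs.fmap_id.
Qed.

End MassFunTheory.

Lemma mf_iter (f : D -> R) (Phi : exact_functor D D) N :
  mass_fun f -> mass_fun (fun X => f (iter N Phi X)).
Proof.
move=> mf; elim: N => [//|N IH].
rewrite (_ : (fun X => _) = (fun X => f (iter N Phi X)) \o Phi).
  exact: mf_comp.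
by apply/funext => X /=; rewrite -iterS iterSr.
Qed.

Lemma mf_bounded_thick (f : nat -> D -> R) (G : D) : (forall N, mass_fun (f N)) ->
  thick (fun X => exists C, 0 <= C /\ forall N, f N X <= C * f N G).
Proof.
move=> mf; have G0 N : 0 <= f N G := mf_ge0 (mf N) G.
have cone X Y Z : triangle X Y Z ->
    (exists C, 0 <= C /\ forall N, f N X <= C * f N G) ->
    (exists C, 0 <= C /\ forall N, f N Z <= C * f N G) ->
    exists C, 0 <= C /\ forall N, f N Y <= C * f N G.
  move=> d [C [C0 HC]] [C' [C'0 HC']]; exists (C + C'); split=> [|N].
    exact: addr_ge0.
  by apply: le_trans (mf_triangle (mf N) d) _; rewrite mulrDl lerD.
have shift X Y c : 0 <= c -> (forall N, f N Y = c * f N X) ->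
    (exists C, 0 <= C /\ forall N, f N X <= C * f N G) ->
    exists C, 0 <= C /\ forall N, f N Y <= C * f N G.
  move=> c0 e [C [C0 HC]]; exists (c * C); split=> [|N]; first exact: mulr_ge0.
  by rewrite e -mulrA ler_wpM2l.
split.
- by move=> X Y XY; apply: (shift _ _ 1) => // N; rewrite mul1r (mf_iso (mf N) XY).
- split; last by move=> X Y S /dsum_triangle; exact: cone.
  have [Z Z0] := zero_ex D; exists Z; split=> //; exists 0; split=> // N.
  by rewrite (mf_zero (mf N) Z0) mul0r.
- move=> X Y S [i [_ [p [_ [e _ _ _ _]]]]] [C [C0 HC]]; exists C; split=> // N.
  exact: le_trans (mf_retract (mf N) e) (HC N).
- move=> X HX; split.
    by apply: (shift X _ (expR t)) HX => [|N]; [exact: expR_ge0 | exact: mf_sh].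
  by apply: (shift X _ (expR (- t))) HX => [|N]; [exact: expR_ge0 | exact: mf_ush].
(* After rotation the third vertex is in the middle, between [Y] and [sh X]; the shift costs a
   factor [expR t]. *)
- move=> X Y Z u v w d HX HY; have /triangle_rot/cone := dist_triangle d.
  apply=> //.
  by apply: (shift X _ (expR t)) HX => [|N]; [exact: expR_ge0 | exact: mf_sh].
Qed.

(** The generating family [S] makes [b N = \sum_i f (Phi^N (S i))]
    submultiplicative, and [b N] is comparable to [f (Phi^N G)]. *)
Lemma mass_growth (f : D -> R) (n : nat) (S : 'I_n -> D) (Phi : exact_functor D D)
    (G : D) : mass_fun f ->
  (forall g, mass_fun g -> forall c, 0 <= c -> (forall i, g (S i) <= c) ->
     forall E, g E <= f E * c) ->
  split_generator G ->
  log_growth (fun N => (f (iter N Phi G))%:E) @ \oo -->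
    ereal_sup [set h | exists E : D,
      h = limn_esup (log_growth (fun N => (f (iter N Phi E))%:E))].
Proof.
move=> mf gen Ggen; have mfN N := mf_iter Phi N mf.
pose b N := \sum_i f (iter N Phi (S i)).
have b0 N : 0 <= b N by apply: sumr_ge0 => i _; exact: mf_ge0.
have bE N E : f (iter N Phi E) <= f E * b N.
  apply: (gen _ (mfN N)) => // i.
  by rewrite /b (bigD1 i) //= lerDl sumr_ge0 // => j _; exact: mf_ge0.
have [L _ bL] : exists2 L, (L != +oo)%E & log_growth (fun N => (b N)%:E) @ \oo --> L.
  (* The bound [bE] is applied to the objects [iter M Phi (S i)] and summed over [i]. *)
  apply: submul_log_growth => // M N; rewrite {1}/b /b mulr_suml.
  by apply: ler_sum => i _; rewrite addnC iterD.
have allG E : exists C, 0 <= C /\ forall N, f (iter N Phi E) <= C * f (iter N Phi G).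
  apply: (Ggen _ (mf_bounded_thick G mfN)).
  by exists 1; split=> // N; rewrite mul1r.
have G0 N : 0 <= f (iter N Phi G) := mf_ge0 mf _.
have aL : log_growth (fun N => (f (iter N Phi G))%:E) @ \oo --> L.
  have [C CP] := choice (fun i => allG (S i)).
  (* Adding 1 keeps both constants strictly positive, even if the family is empty or [f G]
     vanishes. *)
  apply: (@log_growth_comparable _ _ b (\sum_i C i + 1) (f G + 1)) bL.
  - by rewrite ltr_wpDl // sumr_ge0 // => i _; exact: (CP i).1.
  - by rewrite ltr_wpDl // mf_ge0.
  - move=> N; rewrite mulrDl mul1r.
    apply: (@le_trans _ _ ((\sum_i C i) * f (iter N Phi G))).
      by rewrite /b mulr_suml; apply: ler_sum => i _; exact: (CP i).2.
    by rewrite lerDl.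
  - by move=> N; apply: le_trans (bE N G) _; rewrite mulrDl mul1r lerDl.
rewrite (_ : ereal_sup _ = L) //; apply/eqP; rewrite eq_le; apply/andP; split.
  apply: ge_ereal_sup => _ [E ->]; have [C [C0 CP]] := allG E.
  (* A constant factor does not change the rate, so this multiple of the sequence of [G] dominates
     that of [E] and still grows at rate [L]. *)
  have CL : log_growth (fun N => ((C + 1) * f (iter N Phi G))%:E) @ \oo --> L.
    have C1 : 0 < C + 1 by rewrite ltr_wpDl.
    apply: (@log_growth_comparable _ _ _ (C + 1)^-1 (C + 1)) aL => //.
      by rewrite invr_gt0.
    by move=> N; rewrite mulKf ?gt_eqF.
  rewrite -(cvg_limn_einf_sup CL).2; apply/le_limn_esup/le_log_growth => N.
  by apply: le_trans (CP N) _; rewrite mulrDl mul1r lerDl.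
apply: ereal_sup_ubound; exists G; exact: esym (cvg_limn_einf_sup aL).2.
Qed.
End MassFunctions.

(** * The mass attached to a cohomology theory *)

Section Mass.
Variables (R : realType) (K : fieldType) (D : tricat K) (T : coh_theory R D) (t : R).

Definition mass (X : D) : \bar R :=
  (\esum_(k in [set: int]) (hdim T k X * (expR (k%:~R * t))%:E))%E.

Let term_ge0 k X : (0 <= hdim T k X * (expR (k%:~R * t))%:E)%E.
Proof. by rewrite mule_ge0 ?hdim_ge0 ?lee_fin ?expR_ge0. Qed.

Lemma mass_ge0 X : (0 <= mass X)%E.
Proof. by apply: esum_ge0. Qed.

Lemma le_mass X Y : (forall k, (hdim T k X <= hdim T k Y)%E) -> (mass X <= mass Y)%E.
Proof.
by move=> XY; apply: le_esum => k _; rewrite lee_wpmul2r ?lee_fin ?expR_ge0.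
Qed.

Lemma massD X Y (m : int -> \bar R) : (forall k, m k = hdim T k X + hdim T k Y)%E ->
  (\esum_(k in [set: int]) (m k * (expR (k%:~R * t))%:E) = mass X + mass Y)%E.
Proof.
move=> mE; rewrite -esumD; try by move=> *; exact: term_ge0.
by apply: eq_esum => k _; rewrite mE ge0_muleDl ?hdim_ge0.
Qed.

Lemma mass_le X Y Z : triangle X Y Z -> (mass Y <= mass X + mass Z)%E.
Proof.
move=> [f [g [h d]]]; rewrite -(massD (m := fun k => hdim T k X + hdim T k Z)%E) //.
apply: le_esum => k _; rewrite lee_wpmul2r ?lee_fin ?expR_ge0 //.
exact: hdim_le d.
Qed.

Lemma mass_ge X Y Z (f : mor X Y) (g : mor Y Z) (h : mor Z (sh X)) :
  dist f g h -> (forall k, hnull T k h) -> (mass X + mass Z <= mass Y)%E.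
Proof.
move=> d h0; rewrite -(massD (m := fun k => hdim T k X + hdim T k Z)%E) //.
apply: le_esum => k _; rewrite lee_wpmul2r ?lee_fin ?expR_ge0 //.
exact: hdim_ge d _ _.
Qed.

Lemma hdim_zero k X : is_zero X -> hdim T k X = 0%E.
Proof. by move=> /is_zero_id X0; apply/hnull_id; rewrite X0; exact: hnull0. Qed.

Lemma hdim_iso k X Y : isomorphic X Y -> hdim T k X = hdim T k Y.
Proof.
move=> [a [b [ba ab]]]; apply/eqP; rewrite eq_le.
by rewrite (hdim_retract _ _ ba) (hdim_retract _ _ ab).
Qed.

Lemma hdim_dsum k X Y S : is_dsum X Y S -> hdim T k S = (hdim T k X + hdim T k Y)%E.
Proof.
move=> /dsum_dist[f [g d]]; apply/eqP; rewrite eq_le (hdim_le _ _ d).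
by apply: hdim_ge d _ _; exact: hnull0.
Qed.

Lemma hdim_ush k X : hdim T k (ush X) = hdim T (k + 1) X.
Proof. by rewrite -hdim_sh; apply: hdim_iso; exact: sh_ush_isom. Qed.

Lemma hdim_shn k l X : hdim T k (shn l X) = hdim T (k - l) X.
Proof.
case: l => n; elim: n k => [|n IH] k.
- by rewrite subr0.
- have := hdim_sh T (k - 1) (shn n X); rewrite subrK => e; rewrite [LHS]e IH.
  by congr hdim; lia.
- by rewrite [LHS]hdim_ush NegzE opprK.
- by rewrite [LHS]hdim_ush IH; congr hdim; rewrite !NegzE; lia.
Qed.

Lemma hnull_dim0 k X Y (f : mor X Y) :
  hdim T k X = 0%E \/ hdim T k Y = 0%E -> hnull T k f.
Proof.
case=> /hnull_id H; first by rewrite -[f]comp_idr; exact: hnull_compl.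
by rewrite -[f]comp_idl; exact: hnull_compr.
Qed.

Lemma mass_concentrated k X (m : nat) : hdim T k X = m%:R%:E ->
  (forall j, j != k -> hdim T j X = 0%E) -> mass X = (m%:R * expR (k%:~R * t))%:E.
Proof.
move=> Xk Xj; rewrite /mass (esumID [set k]) // setTI setTI.
rewrite esum_set1 // esum1 ?adde0 ?Xk // => j /= jk.
by rewrite Xj ?mul0e //; apply/eqP.
Qed.

(** One inequality, valid for every positive scalar, is enough: the other follows by using it with
    [c^-1]. *)
Lemma esum_scale (a : int -> \bar R) (c : R) : 0 < c -> (forall k, 0 <= a k)%E ->
  (\esum_(k in [set: int]) (c%:E * a k) = c%:E * \esum_(k in [set: int]) a k)%E.
Proof.
suff le (b : int -> \bar R) (d : R) : 0 < d -> (forall k, 0 <= b k)%E ->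
  (\esum_(k in [set: int]) (d%:E * b k) <= d%:E * \esum_(k in [set: int]) b k)%E.
  move=> c0 a0; apply/eqP; rewrite eq_le le //=.
  rewrite -(@lee_pmul2l _ (c^-1)%:E) ?lte_fin ?invr_gt0 // muleA -EFinM.
  rewrite mulVf ?gt_eqF // mul1e.
  have ca k : (0 <= c%:E * a k)%E by apply: mule_ge0 => //; rewrite lee_fin ltW.
  have ci : 0 < c^-1 by rewrite invr_gt0.
  apply: le_trans (le _ _ ci ca); apply: le_esum => k _.
  by rewrite muleA -EFinM mulVf ?gt_eqF // mul1e.
move=> d0 b0; apply: ge_ereal_sup => _ [F [finF _] <-].
rewrite -ge0_mule_fsumr //; apply: lee_wpmul2l; first by rewrite lee_fin ltW.
by apply: esum_ge; exists F.
Qed.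

Lemma mass_sh X : mass (sh X) = ((expR t)%:E * mass X)%E.
Proof.
rewrite /mass (reindex_esum [set: int] _ (fun k => k + 1)); last first.
  split=> [//|x y _ _ /addIr //|y _]; by exists (y - 1); rewrite ?subrK.
rewrite -esum_scale ?expR_gt0 //; apply: eq_esum => k _.
rewrite hdim_sh intrD mulrDl mul1r addrC expRD EFinM [RHS]muleCA.
by rewrite muleA.
Qed.

Lemma mass_fun_mass : (forall X, (mass X < +oo)%E) -> mass_fun t (fine \o mass).
Proof.
move=> fin; have fm X : mass X \is a fin_num by rewrite ge0_fin_numE ?mass_ge0.
split=> [X|X X0|X Y Z d|X|X S i p e] /=.
- by rewrite fine_ge0 ?mass_ge0.
- by rewrite /mass esum1 // => k _; rewrite hdim_zero // mul0e.
- by rewrite -lee_fin EFinD !fineK // mass_le.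
- by rewrite mass_sh fineM.
- rewrite fine_le //; apply: le_mass => k; exact: hdim_retract e.
Qed.

Lemma mass_entropy (n : nat) (S : 'I_n -> D) (Phi : exact_functor D D) (G : D) :
  (forall X, (mass X < +oo)%E) ->
  (forall g, mass_fun t g -> forall c, 0 <= c -> (forall i, g (S i) <= c) ->
     forall E, ((g E)%:E <= mass E * c%:E)%E) ->
  split_generator G ->
  log_growth (fun N => mass (iter N Phi G)) @ \oo -->
    ereal_sup [set h | exists E : D,
      h = limn_esup (log_growth (fun N => mass (iter N Phi E)))].
Proof.
move=> fin gen Ggen.
have fE X : mass X = ((fine \o mass) X)%:E by rewrite /= fineK // ge0_fin_numE ?mass_ge0.
rewrite (_ : mass = fun X => ((fine \o mass) X)%:E); last exact/funext.
apply: mass_growth Ggen; first exact: mass_fun_mass.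
by move=> g mg c c0 gc E; rewrite -lee_fin EFinM -fE; exact: gen.
Qed.

End Mass.

(** * Filtrations *)

Section Filtrations.
Variables (K : fieldType) (D : tricat K).
Implicit Types (X Y Z : D) (s : seq (int * D)).

Lemma filtration_rcons Y F (s : seq D) :
  filtration Y (rcons s F) -> exists2 X, filtration X s & triangle X Y F.
Proof.
move eq_u: (rcons s F) => u fY; case: fY eq_u => [Z Z0|{}X {}Y F' s' f g h fX d].
  by move/(congr1 size); rewrite size_rcons.
by move=> /rcons_inj[-> ->]; exists X => //; exact: dist_triangle d.
Qed.

Lemma filtration_nil Y : filtration Y [::] -> is_zero Y.
Proof.
move eq_u: [::] => u fY; case: fY eq_u => // X Z F s f g h _ _.
by move/(congr1 size); rewrite size_rcons.
Qed.

Lemma shifted_filtration_rcons Y s x : shifted_filtration Y (rcons s x) ->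
  exists2 X, shifted_filtration X s & triangle X Y (shn x.1 x.2).
Proof. by rewrite /shifted_filtration map_rcons => /filtration_rcons. Qed.

Lemma shifted_filtration_cat1 X Y s x : shifted_filtration X s ->
  triangle X Y (shn x.1 x.2) -> shifted_filtration Y (rcons s x).
Proof.
move=> fX [f [g [h d]]]; rewrite /shifted_filtration map_rcons.
exact: filtrationS fX d.
Qed.

Lemma all_in_rcons (P : D -> Prop) s x :
  all_in P (rcons s x) <-> all_in P s /\ P x.2.
Proof.
elim: s => [|y s IH] /=; first by split=> [[]|[]].
by split=> [[? /IH[]]|[[? ?] ?]]; do !split=> //; apply/IH.
Qed.

Lemma sorted_rcons_all (r : rel int) (s : seq int) k : transitive r ->
  sorted r (rcons s k) = sorted r s && all (fun j => r j k) s.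
Proof. by move=> tr; rewrite !sorted_pairwise // pairwise_rcons andbC. Qed.

End Filtrations.

Section TheoryOfTriangles.
Variables (R : realType) (K : fieldType) (D : tricat K) (T : coh_theory R D) (t : R).
Implicit Types X Y Z : D.

Lemma dist_hnull X Y Z (f : mor X Y) (g : mor Y Z) (h : mor Z (sh X)) :
  dist f g h -> (forall k, hnull T k h) ->
  (forall k, hdim T k Y = hdim T k X + hdim T k Z)%E /\
  (mass T t Y = mass T t X + mass T t Z)%E.
Proof.
move=> d h0; split=> [k|]; apply/eqP; rewrite eq_le.
  by rewrite (hdim_le _ _ d) (hdim_ge d).
by rewrite (mass_le _ _ (dist_triangle d)) (mass_ge _ d).
Qed.

(** No cancellation can occur when the connecting map vanishes for degree reasons. *)
Lemma triangle_hdim X Y Z : triangle X Y Z ->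
  (forall k, hdim T k Z = 0%E \/ hdim T (k - 1) X = 0%E) ->
  (forall k, hdim T k Y = hdim T k X + hdim T k Z)%E /\
  (mass T t Y = mass T t X + mass T t Z)%E.
Proof.
move=> [f [g [h d]]] H; apply: dist_hnull d _ => k.
by apply: hnull_dim0; rewrite -[k](subrK 1) hdim_sh subrK.
Qed.

End TheoryOfTriangles.

(** * t-structures *)

Section TStructures.
Variables (K : fieldType) (D : tricat K) (a : t_structure D).
Implicit Types (X Y Z E F : D).

Local Notation L := (lev (tle a)).
Local Notation G := (lev (tge a)).

(** Here [L k] and [G k] are the k-th shifts of the two halves: [L] shrinks and [G] grows with
    [k]. *)
Lemma t_hom k E F : L (k + 1) E -> G k F -> hom0 E F.
Proof.
move=> LE GF.
apply: (@lev_hom0 _ _ (tle a) (tge a) 0 (-1) (@tle_iso _ _ a) (@tge_iso _ _ a) _ (k + 1)).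
- move=> X Y LX GY f; apply: (@t_hom0 _ _ a _ _ f LX).
  by apply/sh_sub_lev => //; exact: tge_iso.
- by rewrite add0r.
- by rewrite addrCA addNr addr0.
Qed.

Lemma t_trunc_lev k E : exists X Y, [/\ L (k + 1) X, G k Y & triangle X E Y].
Proof.
have [|X [Y [LX GY d]]] := @lev_trunc _ _ (tle a) (tge a) 0 (-1)
    (@tle_iso _ _ a) (@tge_iso _ _ a) _ (k + 1) E.
  move=> {}E; have [X [Y [f [g [h [LX GY d]]]]]] := t_trunc a E.
  exists X, Y; split=> //; last exact: dist_triangle d.
  by apply/sh_sub_lev => //; exact: tge_iso.
exists X, Y; split=> //; first by move: LX; rewrite add0r.
by move: GY; rewrite addrCA addNr addr0.
Qed.

Lemma tle_pred k E : L (k + 1) E -> L k E.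
Proof. exact: lev_pred (@tle_iso _ _ a) _ _ (@tle_sh _ _ a). Qed.

Lemma tge_succ k E : G k E -> G (k + 1) E.
Proof. exact: lev_succ (@tge_iso _ _ a) _ _ (@tge_ush _ _ a). Qed.

Lemma tge_lev k j E : k <= j -> G k E -> G j E.
Proof. exact: lev_mono (@tge_iso _ _ a) _ _ _ (@tge_ush _ _ a). Qed.

(** In the truncation triangle [E -> Y] vanishes, so [idm Y] factors through [sh X]. Maps from
    [sh X] to [Y] are zero by orthogonality, hence [Y] is zero. Being an orthogonal, [L] is then
    closed under extensions. *)
Lemma tle_char k E : (forall F, G k F -> hom0 E F) -> L (k + 1) E.
Proof.
have [X [Y [LX GY [f [g [h d]]]]]] := t_trunc_lev k E => H.
have [|r er] := weak_coker (u := idm Y) ((dist_rot _ _ _).1 d).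
  by rewrite (H _ GY g) comp0r.
have r0 : r = 0.
  apply: (@t_hom (k + 1)); last exact: tge_succ.
  by apply/lev_sh => //; exact: tle_iso.
have Y0 : is_zero Y by apply/is_zero_id; rewrite er r0 comp0l.
by apply: lev_iso LX; [exact: tle_iso | exists f; exact: zero_triangle2 d].
Qed.

(** With [f = 0] every endomorphism of [sh X] factors through [Y], and there is no nonzero map from
    [sh X] to [Y]. *)
Lemma t_trunc_zero k X Y F (f : mor X F) (g : mor F Y) (h : mor Y (sh X)) :
  dist f g h -> L (k + 1) X -> G k Y -> f = 0 -> is_zero X.
Proof.
move=> d LX GY f0; have sX0 : hom0 (sh X) (sh X).
  move=> u; have [|v ->] := weak_ker (u := u) ((dist_rot _ _ _).1 ((dist_rot _ _ _).1 d)).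
    by rewrite f0 (fmap0 (@sh_add _ D)) oppr0 comp0l.
  rewrite (_ : v = 0) ?comp0r //; apply: (@t_hom (k + 1)); last exact: tge_succ.
  by apply/lev_sh => //; exact: tle_iso.
apply: is_zero_iso (isomorphic_sym (ush_sh_isom X)) _.
by apply: fmap_is_zero (@ush_add _ D) _ _; exact: hom0_refl.
Qed.

Lemma tge_char k F : (forall E, L (k + 1) E -> hom0 E F) -> G k F.
Proof.
have [X [Y [LX GY [f [g [h d]]]]]] := t_trunc_lev k F => H.
have X0 : is_zero X := t_trunc_zero d LX GY (H _ LX f).
apply: lev_iso GY; first exact: tge_iso.
by apply: isomorphic_sym; exists g; exact: zero_triangle1 d.
Qed.

Lemma tle_ext k X Y Z : triangle X Y Z -> L k X -> L k Z -> L k Y.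
Proof.
rewrite -[k](subrK 1) => d LX LZ; apply: tle_char => F GF.
exact: hom0_ext_l d (t_hom LX GF) (t_hom LZ GF).
Qed.

Lemma tge_ext k X Y Z : triangle X Y Z -> G k X -> G k Z -> G k Y.
Proof.
move=> d GX GZ; apply: tge_char => E LE.
exact: hom0_ext_r d (t_hom LE GX) (t_hom LE GZ).
Qed.

Lemma tle_lev_sh k X : L k X -> L (k + 1) (sh X).
Proof. by move=> LX; apply/lev_sh => //; exact: tle_iso. Qed.

Lemma tge_lev_ush k X : G k X -> G (k - 1) (ush X).
Proof. by move=> GX; apply/lev_ush => //; exact: tge_iso. Qed.

(** [E] spans the [n] levels from [k] to [k + n - 1]. Truncation splits off level [k], whose factor
    comes last because degrees descend; the lower bound on degrees in the conclusion keeps the list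
    sorted. *)
Lemma t_filtration_ex_lev n k E : L k E -> G (k + n%:Z - 1) E ->
  exists2 s, t_filtration a E s & all (fun j => k <= j) [seq x.1 | x <- s].
Proof.
elim: n k E => [|n IH] k E LE GE.
  exists [::] => //; split=> //; apply: filtration0; apply: hom0_refl.
  apply: (@t_hom (k - 1)); first by rewrite subrK.
  by move: GE; rewrite addr0.
have [X [Y [LX GY d]]] := t_trunc_lev k E.
have LY : L k Y.
  apply: tle_ext (triangle_rot d) LE _.
  by apply: tle_pred; apply: tle_lev_sh; exact: tle_pred.
have [||s [hs ss fs] ks] := IH (k + 1) X => //.
  apply: tge_ext (triangle_unrot d) _ _; last by apply: tge_lev GE; lia.
  by apply: tge_lev (tge_lev_ush GY); lia.
exists (rcons s (k, shn (- k) Y)); last first.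
  rewrite map_rcons all_rcons lexx /=; apply: sub_all ks => j /=; lia.
split.
- by apply/all_in_rcons; split.
- rewrite map_rcons sorted_rcons_all; last by move=> x y z; lia.
  by rewrite ss; apply: sub_all ks => j /=; lia.
- apply: shifted_filtration_cat1 fs _; apply: triangle_iso d; try exact: isomorphic_refl.
  exact/isomorphic_sym/shnK.
Qed.

Lemma t_filtration_ex E : t_bounded a -> exists s, t_filtration a E s.
Proof.
move=> /(_ E)[[k /(sh_sub_lev (@tle_iso _ _ a)) LE] [j /(sh_sub_lev (@tge_iso _ _ a)) GE]].
(* The successor makes the top level [k + |j - k|], which is at least [j]. *)
have [||s fs _] := @t_filtration_ex_lev `|j - k|.+1 k E => //; last by exists s.
by apply: tge_lev GE; lia.
Qed.

(** The kernel of [f] in the heart is a shift of the truncation [U] of the cone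
    of [f], so it vanishes and the cone lies in the heart. *)
Lemma heart_short_exact X Y S (f : mor X Y) (q : mor Y S) :
  heart a X -> heart a Y -> heart a S -> mono_in (heart a) f ->
  coker_in (heart a) f q -> triangle X Y S.
Proof.
move=> [LX GX] [LY GY] [LS GS] fm [qf qu].
have [Z [g [h d]]] := dist_ex f.
have LZ : L 0 Z.
  apply: (@tle_ext 0 _ _ _ (triangle_rot (dist_triangle d)) LY).
  by apply: tle_pred; exact: (@tle_lev_sh 0).
have [U [V [LU GV [i [p [r e]]]]]] := t_trunc_lev 0 Z; rewrite add0r in LU.
(* The map [h ∘ i] descends to [w : ush U -> X] with [f ∘ w = 0], and [ush U] is in the heart, so
   [w = 0]. Hence [i] factors through [Y], to which [U] has no nonzero map. *)
have i0 : i = 0.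
  have GsX : G 1 (sh X) by apply/(lev_shn (@tge_iso _ _ a) 0 1).
  have GU : G 1 U.
    apply: tge_ext (triangle_unrot (dist_triangle e)) _ _.
      by apply: tge_lev (tge_lev_ush GV).
    apply: tge_ext (triangle_rot (dist_triangle d)) _ GsX.
    exact: (@tge_succ 0 _ GY).
  have Hu : heart a (ush U).
    by split; [apply/(lev_ush (@tle_iso _ _ a) 1) | apply/(lev_ush (@tge_iso _ _ a) 1)].
  have [w ew] := sh_full (h ∘ i ∘ sh_ush U).
  have w0 : w = 0.
    apply: fm => //; apply: sh_faithful; rewrite Defs.fmap_comp -ew.
    rewrite fmap0; last exact: sh_add.
    rewrite !comp_assoc; have := comp0_dist ((dist_rot2 _ _ _).1 d).
    by rewrite compNl => /eqP; rewrite oppr_eq0 => /eqP ->; rewrite !comp0l.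
  have hi0 : h ∘ i = 0.
    have [v [_ sv]] := sh_ush_iso U.
    by rewrite -[h ∘ i]comp_idr -sv comp_assoc ew w0 fmap0 ?comp0l //; exact: sh_add.
  have [v ->] := weak_ker ((dist_rot _ _ _).1 d) hi0.
  by rewrite (@t_hom 0 _ _ _ GY v) ?comp0r // add0r.
have GZ : G 0 Z.
  have U0 : is_zero U by apply: (@t_trunc_zero 0 _ _ _ _ _ _ e); rewrite ?add0r.
  apply: lev_iso GV; first exact: tge_iso.
  by apply: isomorphic_sym; exists p; exact: zero_triangle1 e.
(* Both [Z] and [S] are cokernels of [f]. The composite on [S] is the identity by the uniqueness in
   [coker_in]; on [Z], the difference from the identity factors through [sh X], which has no nonzero
   map to [Z]. *)
have [c ec] := weak_coker d qf.
have [g' [eg' _]] := qu Z g (conj LZ GZ) (comp0_dist d).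
have cg' : c ∘ g' = idm S.
  have [x [_ xu]] := qu S q (conj LS GS) qf.
  by rewrite -(xu (idm S)) ?comp_idl //; apply/esym/xu; rewrite -comp_assoc eg' -ec.
have g'c : g' ∘ c = idm Z.
  apply/eqP; rewrite -subr_eq0; apply/eqP.
  have [|v ->] := weak_coker (u := g' ∘ c - idm Z) ((dist_rot _ _ _).1 d).
    by rewrite compBl comp_idl -comp_assoc -ec eg' subrr.
  rewrite (@t_hom 0 _ _ _ GZ v) ?comp0l // add0r.
  exact: (@tle_lev_sh 0 _ LX).
apply: triangle_iso (dist_triangle d); try exact: isomorphic_refl.
by exists c, g'.
Qed.

Lemma comp_series_heart E n : comp_series (heart a) E n -> heart a E.
Proof. by case. Qed.

(** * Lengths, weights and mass for a finite heart *)

Section Dimensions.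
Variables (R : realType) (T : coh_theory R D) (t : R).
Hypothesis simple0 : forall S, simple_in (heart a) S -> hdim T 0 S = 1%E.
Hypothesis simpleN0 : forall S (k : int), simple_in (heart a) S -> k != 0 ->
  hdim T k S = 0%E.

(** Everything sits in degree 0, so no connecting map acts. In particular the length of a
    composition series is determined by [E], whichever series [length_in] selects. *)
Lemma comp_series_hdim E n : comp_series (heart a) E n ->
  hdim T 0 E = n%:R%:E /\ (forall k, k != 0 -> hdim T k E = 0%E).
Proof.
elim=> [Z _ Z0|X Y S m f q sX [X0 XN] HY HS fm fq].
  by split=> [|k _]; rewrite hdim_zero.
have [HS' _ _] := HS.
have [] := @triangle_hdim _ _ _ T t _ _ _
    (heart_short_exact (comp_series_heart sX) HY HS' fm fq).
  by move=> k; have [->|k0] := eqVneq k 0; [right; apply: XN | left; apply: simpleN0].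
move=> e _; split=> [|k k0]; rewrite e ?X0 ?simple0 -?natr1 ?EFinD //.
by rewrite XN // simpleN0 // adde0.
Qed.

Hypothesis fin : finite_heart a.

Lemma heart_comp_series E : heart a E -> comp_series (heart a) E (length_in (heart a) E).
Proof.
have [fin1 _] := fin; move=> /fin1[n sn].
by apply: (@xgetPex _ _ [set n | comp_series (heart a) E n]); exists n.
Qed.

(** The vanishing below all factors is carried along for the induction: attaching a factor in degree
    [k] to [X] causes no cancellation because [X] vanishes in degree [k - 1], its own factors lying
    above [k]. *)
Lemma t_filtration_mass E s : t_filtration a E s ->
  mass T t E = (weight (length_in (heart a)) t s)%:E /\
  forall j, all (fun i => j < i) [seq x.1 | x <- s] -> hdim T j E = 0%E.
Proof.
elim/last_ind: s E => [|s [k F] IH] E [].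
  move=> _ _ /filtration_nil E0; split=> [|j _]; last exact: hdim_zero.
  by rewrite /weight big_nil /mass esum1 // => i _; rewrite hdim_zero // mul0e.
move=> /all_in_rcons[hs /= HF]; rewrite map_rcons sorted_rcons_all; last first.
  by move=> x y z; lia.
move=> /andP[ss sk] /shifted_filtration_rcons[X fX d].
have [mX dX] := IH X (And3 hs ss fX).
have [F0 FN] := comp_series_hdim (heart_comp_series HF).
have dF j : j != k -> hdim T j (shn k F) = 0%E.
  by move=> jk; rewrite hdim_shn FN // subr_eq0.
have dFk : hdim T k (shn k F) = (length_in (heart a) F)%:R%:E.
  by rewrite hdim_shn subrr.
have [|e em] := @triangle_hdim _ _ _ T t _ _ _ d.
  move=> j; have [->|jk] := eqVneq j k; last by left; exact: dF.
  by right; apply: dX; apply: sub_all sk => i /=; lia.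
split=> [|j]; last first.
  rewrite all_rcons => /andP[/= jk js].
  by rewrite e dX // dF ?adde0 // lt_eqF.
rewrite em mX (mass_concentrated t dFk dF) /weight -cats1 big_cat big_seq1 /=.
by rewrite EFinD.
Qed.

Lemma heart_mass_fun (g : D -> R) c E n : mass_fun t g -> 0 <= c ->
  (forall S, simple_in (heart a) S -> g S <= c) ->
  comp_series (heart a) E n -> g E <= n%:R * c.
Proof.
move=> mg c0 gc; elim=> [Z _ Z0|X Y S m f q sX IH HY HS fm fq].
  by rewrite (mf_zero mg) // mul0r.
rewrite -natr1 mulrDl mul1r.
apply: le_trans (lerD IH (gc _ HS)); apply: (mf_triangle mg).
apply: heart_short_exact fm fq => //; first exact: comp_series_heart sX.
by case: HS.
Qed.

Lemma t_filtration_mass_fun (g : D -> R) c E s : mass_fun t g -> 0 <= c ->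
  (forall S, simple_in (heart a) S -> g S <= c) ->
  t_filtration a E s -> g E <= weight (length_in (heart a)) t s * c.
Proof.
move=> mg c0 gc; elim/last_ind: s E => [|s [k F] IH] E [].
  move=> _ _ /filtration_nil E0.
  by rewrite (mf_zero mg) // /weight big_nil mul0r.
move=> /all_in_rcons[hs /= HF]; rewrite map_rcons sorted_rcons_all; last first.
  by move=> x y z; lia.
move=> /andP[ss sk] /shifted_filtration_rcons[X fX d].
rewrite /weight -cats1 big_cat big_seq1 /= mulrDl.
apply: le_trans (mf_triangle mg d) _; apply: lerD; first exact: IH.
rewrite (mf_shn mg) [leRHS]mulrAC mulrC ler_wpM2r ?expR_ge0 //.
exact: heart_mass_fun (heart_comp_series HF).
Qed.

Hypothesis bdd : t_bounded a.

(** Boundedness provides a t-filtration, so [xget] does not return its default, and the weight of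
    every t-filtration is the mass. *)
Lemma delta_t_mass E : (delta_t a t E)%:E = mass T t E.
Proof.
have [s fs] := t_filtration_ex E bdd.
have ex : exists w, exists s, t_filtration a E s /\ w = weight (length_in (heart a)) t s.
  by exists (weight (length_in (heart a)) t s), s.
have [s' [fs' e]] := @xgetPex _ (0 : R) [set w | exists s, t_filtration a E s /\
  w = weight (length_in (heart a)) t s] ex.
by rewrite /delta_t e (t_filtration_mass fs').1.
Qed.

Theorem t_entropy (Phi : exact_functor D D) (G0 : D) : split_generator G0 ->
  log_growth (fun N => mass T t (iter N Phi G0)) @ \oo --> entropy_t a t Phi.
Proof.
move=> Ggen; have [_ [n [S SP]]] := fin.
have -> : entropy_t a t Phi = ereal_sup [set h | exists E : D,
    h = limn_esup (log_growth (fun N => mass T t (iter N Phi E)))].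
  rewrite /entropy_t; under eq_fun do under eq_exists do under eq_fun do
    rewrite delta_t_mass.
  by [].
apply: (mass_entropy (S := S)) Ggen => [X|g mg c c0 gc E].
  by rewrite -delta_t_mass ltry.
have [s fs] := t_filtration_ex E bdd.
rewrite (t_filtration_mass fs).1 -EFinM lee_fin.
apply: t_filtration_mass_fun fs => // S' HS.
by have [i /(mf_iso mg) ->] := SP _ HS.
Qed.

End Dimensions.
End TStructures.

(** * Co-t-structures *)

Section CancelConnectingMap.
Variables (K : fieldType) (D : tricat K).
Implicit Types X Y Z : D.

(** If [A] is a piece of the top factor [Q] whose connecting map into the factor
    [P] below has cone [C], both copies of [A] can be removed at once. *)
Lemma cancel_connecting (Y0 Y1 Y2 P Q A B C : D)
    (f1 : mor Y0 Y1) (g1 : mor Y1 P) (h1 : mor P (sh Y0))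
    (f2 : mor Y1 Y2) (g2 : mor Y2 Q) (h2 : mor Q (sh Y1))
    (a : mor A Q) (q : mor Q B) (r : mor B (sh A))
    (m : mor (sh P) C) (n : mor C (sh A)) :
  dist f1 g1 h1 -> dist f2 g2 h2 -> dist a q r ->
  dist (fmor sh g1 ∘ (h2 ∘ a)) m n ->
  exists Y', triangle Y0 Y' (ush C) /\ triangle Y' Y2 B.
Proof.
(* The new middle object is [ush W]. The octahedral axiom is used twice: for [h2 ∘ a] followed by
   the shifted projection to [P], and for [h2 ∘ a] itself as a composite. *)
move=> d1 d2 da dm; have [W [j [k dw]]] := dist_ex (h2 ∘ a).
exists (ush W); split.
- have dg : dist (- fmor sh g1) (- fmor sh h1) (- fmor sh (- fmor sh f1)).
    exact: (dist_rot3 _ _ _).1 ((dist_rot _ _ _).1 d1).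
  (* Rotation has put a sign on [fmor sh g1]; the automorphism [- idm A] puts the same sign on the
     triangle of [C]. *)
  have NN : (- idm A) ∘ (- idm A) = idm A by rewrite compNl compNr comp_idl opprK.
  have := dist_isoX NN NN dm; rewrite compNr comp_idr -compNl => dm'.
  have [f [g [d _]]] := octahedron dw dg dm'.
  have := triangle_ush (triangle_unrot_sh (dist_triangle d)).
  by apply: triangle_iso; try exact: isomorphic_refl; exact: ush_sh_isom.
- have [f [g [d _]]] := octahedron da ((dist_rot2 _ _ _).1 d2) dw.
  exact/triangle_unrot/triangle_unrot_sh/(dist_triangle d).
Qed.

Lemma sh_shn_pred k X : isomorphic (sh (shn (k - 1) X)) (shn k X).
Proof. by have := sh_shn (k - 1) X; rewrite subrK. Qed.

Lemma dsum_of_impl (Q Q' : D -> Prop) n X : (forall Y, Q Y -> Q' Y) ->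
  dsum_of Q n X -> dsum_of Q' n X.
Proof.
move=> QQ'; elim=> [Z Z0|Y Z S m QY _ IH d]; first exact: dsum_of0.
exact: dsum_ofS (QQ' _ QY) IH d.
Qed.

(** The idempotents of a decomposition add up to the identity, so one of them is invertible. An
    invertible idempotent is the identity, and the other summand vanishes. *)
Lemma local_end_indecomposable (P : D -> Prop) X : P X -> local_end X ->
  indecomposable_in P X.
Proof.
move=> PX [X1 Xloc]; split=> //; first by move=> /is_zero_id.
move=> Y Z PY PZ [i1 [i2 [p1 [p2 [e1 e2 e3 e4 e5]]]]].
have zero U V (i : mor U X) (p : mor X U) (i' : mor V X) (p' : mor X V) :
    p' ∘ i' = idm V -> i ∘ p + i' ∘ p' = idm X -> p ∘ i = idm U ->
    is_iso (i ∘ p) -> is_zero V.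
  move=> e' e ei [g [gl _]].
  have ee : (i ∘ p) ∘ (i ∘ p) = i ∘ p.
    by rewrite -comp_assoc (comp_assoc p) ei comp_idl.
  have ip : i ∘ p = idm X by rewrite -[i ∘ p]comp_idl -gl -comp_assoc ee.
  have ip' : i' ∘ p' = 0 by apply: (addrI (i ∘ p)); rewrite e addr0.
  apply/is_zero_id; rewrite -e' -[i']comp_idr -e' (comp_assoc i') ip'.
  by rewrite comp0l comp0r.
have [i1p1|ni1p1] := pselect (is_iso (i1 ∘ p1)).
  by right; apply: (zero _ _ i1 p1 i2 p2).
left; apply: (zero _ _ i2 p2 i1 p1) => //; first by rewrite addrC.
by apply: contrapT => /(Xloc _ _ ni1p1); apply; rewrite e5; exact: is_iso_id.
Qed.

End CancelConnectingMap.

(** * Components of maps that are nonzero on cohomology *)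

Section HnullTheory.
Variables (R : realType) (K : fieldType) (D : tricat K) (T : coh_theory R D).
Implicit Types X Y Z : D.

Lemma hnull_iso_l k X Y Z (g : mor Y Z) (f : mor X Y) : is_iso g ->
  hnull T k (g ∘ f) -> hnull T k f.
Proof.
move=> [g' [gl _]] H; rewrite -[f]comp_idl -gl -comp_assoc.
exact: hnull_compl.
Qed.

Lemma hnullN k X Y (f : mor X Y) : hnull T k f -> hnull T k (- f).
Proof. by rewrite -[- f]comp_idl compNr -compNl; exact: hnull_compl. Qed.

Lemma hnull_shn j k X Y (f : mor X Y) :
  hnull T j f -> hnull T (j + k) (fmor (shf D k) f).
Proof.
have ushP i X' Y' (g : mor X' Y') : hnull T i g -> hnull T (i - 1) (fmor ush g).
  move=> H; apply/hnull_sh; rewrite subrK.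
  apply: (hnull_iso_l (sh_ush_iso Y')); rewrite -sh_ush_nat.
  exact: hnull_compr.
move=> H; case: k => n; elim: n => [|n IH].
- by rewrite addr0.
- by rewrite (_ : j + n.+1%:Z = j + n%:Z + 1); [apply/hnull_sh | lia].
- exact: ushP.
- by rewrite (_ : j + Negz n.+1 = j + Negz n - 1); [exact: ushP | rewrite !NegzE; lia].
Qed.

(** Together with [hnull_dsum_tgt] this finds a matrix entry between indecomposables that acts
    nontrivially. *)
Lemma hnull_dsum_src (Q : D -> Prop) k n E F (f : mor E F) : dsum_of Q n E ->
  ~ hnull T k f -> exists A (i : mor A E) (p : mor E A),
    [/\ Q A, p ∘ i = idm A & ~ hnull T k (f ∘ i)].
Proof.
move=> dE; elim: dE f => [Z Z0|X Y S m QX _ IH [i1 [i2 [p1 [p2 [e1 e2 e3 e4 e5]]]]]] f nf.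
  by case: nf; apply: hnull_dim0; left; exact: hdim_zero.
have [n1|n1] := pselect (hnull T k (f ∘ i1)); last by exists X, i1, p1.
have n2 : ~ hnull T k (f ∘ i2).
  move=> n2; apply: nf; rewrite -[f]comp_idr -e5 compDr !comp_assoc.
  by apply: hnullD; exact: hnull_compr.
have [A [i [p [QA pi ni]]]] := IH _ n2.
exists A, (i2 ∘ i), (p ∘ p2); split=> //; last by rewrite comp_assoc.
by rewrite -comp_assoc (comp_assoc p2) e2 comp_idl.
Qed.

Lemma hnull_dsum_tgt (Q : D -> Prop) k n E F (f : mor F E) : dsum_of Q n E ->
  ~ hnull T k f -> exists A (i : mor A E) (p : mor E A),
    [/\ Q A, p ∘ i = idm A & ~ hnull T k (p ∘ f)].
Proof.
move=> dE; elim: dE f => [Z Z0|X Y S m QX _ IH [i1 [i2 [p1 [p2 [e1 e2 e3 e4 e5]]]]]] f nf.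
  by case: nf; apply: hnull_dim0; right; exact: hdim_zero.
have [n1|n1] := pselect (hnull T k (p1 ∘ f)); last by exists X, i1, p1.
have n2 : ~ hnull T k (p2 ∘ f).
  move=> n2; apply: nf; rewrite -[f]comp_idl -e5 compDl -!comp_assoc.
  by apply: hnullD; exact: hnull_compl.
have [A [i [p [QA pi ni]]]] := IH _ n2.
exists A, (i2 ∘ i), (p ∘ p2); split=> //; last by rewrite -comp_assoc.
by rewrite -comp_assoc (comp_assoc p2) e2 comp_idl.
Qed.

End HnullTheory.

Section CotStructures.
Variables (K : fieldType) (D : tricat K) (b : cot_structure D).
Hypothesis idem : idempotent_complete D.
Implicit Types (X Y Z E F : D).

Local Notation G := (lev (cge b)).
Local Notation L := (lev (cle b)).

(** Again [L] shrinks and [G] grows with [k], but the vanishing maps now go from [G] to [L]. *)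
Lemma cot_hom k E F : G k E -> L (k + 1) F -> hom0 E F.
Proof.
move=> GE LF.
apply: (@lev_hom0 _ _ (cge b) (cle b) (-1) 0 (@cge_iso _ _ b) (@cle_iso _ _ b) _ (k + 1)).
- move=> X Y GX LY f; apply: (@cot_hom0 _ _ b _ _ f _ LY).
  by apply/sh_sub_lev => //; exact: cge_iso.
- by rewrite addrCA addNr addr0.
- by rewrite add0r.
Qed.

Lemma cot_trunc_lev k E : exists X Y, [/\ G k X, L (k + 1) Y & triangle X E Y].
Proof.
have [|X [Y [GX LY d]]] := @lev_trunc _ _ (cge b) (cle b) (-1) 0
    (@cge_iso _ _ b) (@cle_iso _ _ b) _ (k + 1) E.
  move=> {}E; have [X [Y [f [g [h [GX LY d]]]]]] := cot_trunc b E.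
  exists X, Y; split=> //; last exact: dist_triangle d.
  by apply/sh_sub_lev => //; exact: cge_iso.
exists X, Y; split=> //; last by move: LY; rewrite add0r.
by move: GX; rewrite addrCA addNr addr0.
Qed.

Lemma cle_lev k j E : k <= j -> L j E -> L k E.
Proof. exact: lev_anti (@cle_iso _ _ b) _ _ _ (@cle_sh _ _ b). Qed.

Lemma cge_lev k j E : k <= j -> G k E -> G j E.
Proof. exact: lev_mono (@cge_iso _ _ b) _ _ _ (@cge_ush _ _ b). Qed.

(** The truncation only shows [E] to be a retract of [X]; idempotent completeness turns the retract
    into a summand, and the halves are closed under summands. *)
Lemma cge_char k E : (forall F, L (k + 1) F -> hom0 E F) -> G k E.
Proof.
have [X [Y [GX LY [f [g [h d]]]]]] := cot_trunc_lev k E => H.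
have [|s es] := weak_ker (u := idm E) d; first by rewrite comp_idr; exact: H.
have [W dW] := retract_is_dsum idem (esym es).
exact: lev_summand (@cge_summand _ _ b) dW GX.
Qed.

Lemma cle_char k F : (forall E, G k E -> hom0 E F) -> L (k + 1) F.
Proof.
have [X [Y [GX LY [f [g [h d]]]]]] := cot_trunc_lev k F => H.
have [|s es] := weak_coker (u := idm F) d; first by rewrite comp_idl; exact: H.
have [W dW] := retract_is_dsum idem (esym es).
exact: lev_summand (@cle_summand _ _ b) dW LY.
Qed.

Lemma cge_ext k X Y Z : triangle X Y Z -> G k X -> G k Z -> G k Y.
Proof.
move=> d GX GZ; apply: cge_char => F LF.
exact: hom0_ext_l d (cot_hom GX LF) (cot_hom GZ LF).
Qed.

Lemma cle_ext k X Y Z : triangle X Y Z -> L k X -> L k Z -> L k Y.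
Proof.
rewrite -[k](subrK 1) => d LX LZ; apply: cle_char => E GE.
exact: hom0_ext_r d (cot_hom GE LX) (cot_hom GE LZ).
Qed.

Lemma cge_lev_sh k X : G k X -> G (k + 1) (sh X).
Proof. by move=> GX; apply/lev_sh => //; exact: cge_iso. Qed.

Lemma cle_lev_ush k X : L k X -> L (k - 1) (ush X).
Proof. by move=> LX; apply/lev_ush => //; exact: cle_iso. Qed.

Lemma coheart_iso : iso_closed (coheart b).
Proof. by move=> X Y XY [GX LX]; split; [exact: cge_iso GX | exact: cle_iso LX]. Qed.

Lemma coheart_summand : summand_closed (coheart b).
Proof.
move=> X Y S d [GS LS].
by split; [exact: cge_summand d GS | exact: cle_summand d LS].
Qed.

Lemma cot_filtration_rcons E X s k F : cot_filtration b X s ->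
  all (fun j => j < k) [seq x.1 | x <- s] -> coheart b F ->
  triangle X E (shn k F) -> cot_filtration b E (rcons s (k, F)).
Proof.
move=> [hs ss fs] sk HF d; split.
- by apply/all_in_rcons.
- by rewrite map_rcons sorted_rcons_all ?ss //; exact: lt_trans.
- exact: (@shifted_filtration_cat1 _ _ X E s (k, F) fs d).
Qed.

Lemma cot_filtration_rcons_inv E s k F : cot_filtration b E (rcons s (k, F)) ->
  [/\ coheart b F, all (fun j => j < k) [seq x.1 | x <- s] &
    exists2 X, cot_filtration b X s & triangle X E (shn k F)].
Proof.
move=> [/all_in_rcons[hs HF]]; rewrite map_rcons sorted_rcons_all; last exact: lt_trans.
move=> /andP[ss sk] /shifted_filtration_rcons[X fX d]; split=> //.
by exists X.
Qed.

(** [E] spans the [n + 1] levels from [k] to [k + n]. Degrees ascend, so the top level is split off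
    and its factor comes last; the induction starts with one level, a shift of the co-heart. *)
Lemma cot_filtration_ex_lev n k E : L k E -> G (k + n%:Z) E ->
  exists2 s, cot_filtration b E s &
    all (fun j => j <= k + n%:Z) [seq x.1 | x <- s].
Proof.
elim: n E => [|n IH] E LE GE.
  exists [:: (k, shn (- k) E)]; last by rewrite /= addr0 lexx.
  have [Z Z0] := zero_ex D.
  apply: (@cot_filtration_rcons _ Z [::]) => //; last first.
  - by apply: triangle_zero1 => //; exact/isomorphic_sym/shnK.
  - by split=> //; move: GE; rewrite addr0.
  - by split=> //; exact: filtration0.
have [X [Y [GX LY d]]] := cot_trunc_lev (k + n%:Z) E.
have e : k + n.+1%:Z = k + n%:Z + 1 by lia.
rewrite e in GE *.
have GY : G (k + n%:Z + 1) Y.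
  exact: cge_ext (triangle_rot d) GE (cge_lev_sh GX).
have [|s fs ks] := IH X _ GX.
  apply: cle_ext (triangle_unrot d) _ LE.
  by apply: cle_lev (cle_lev_ush LY); lia.
exists (rcons s (k + n%:Z + 1, shn (- (k + n%:Z + 1)) Y)); last first.
  by rewrite map_rcons all_rcons lexx /=; apply: sub_all ks => j /=; lia.
apply: cot_filtration_rcons fs _ _ _.
- by apply: sub_all ks => j /=; lia.
- by [].
- apply: triangle_iso d; try exact: isomorphic_refl.
  exact/isomorphic_sym/shnK.
Qed.

Lemma cot_filtration_ex E : cot_bounded b -> exists s, cot_filtration b E s.
Proof.
move=> /(_ E)[[k /(sh_sub_lev (@cge_iso _ _ b)) GE] [j /(sh_sub_lev (@cle_iso _ _ b)) LE]].
(* The order of [k] and [j] is unknown; the levels from their minimum to their maximum suit both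
   bounds. *)
have [||s fs _] := @cot_filtration_ex_lev `|k - j| (Num.min k j) E; last by exists s.
- by apply: cle_lev LE; lia.
- by apply: cge_lev GE; lia.
Qed.

Section Dimensions.
Variables (R : realType) (T : coh_theory R D) (t : R).
Local Notation indec := (indecomposable_in (coheart b)).
Local Notation sigma := (num_indec (coheart b)).
Hypothesis indec0 : forall S, indec S -> hdim T 0 S = 1%E.
Hypothesis indecN0 : forall S (k : int), indec S -> k != 0 -> hdim T k S = 0%E.
Hypothesis fin : finite_coheart b.

(** Shows in passing that the number of indecomposable summands is determined by [E], so the choice
    in [num_indec] is harmless. *)
Lemma dsum_of_hdim E n : dsum_of indec n E ->
  hdim T 0 E = n%:R%:E /\ (forall k, k != 0 -> hdim T k E = 0%E).
Proof.
elim=> [Z Z0|X Y S m HX _ [Y0 YN] d].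
  by split=> [|k _]; rewrite hdim_zero.
split=> [|k k0]; rewrite (hdim_dsum _ _ d).
  by rewrite indec0 // Y0 -EFinD -natr1 addrC.
by rewrite indecN0 // YN // adde0.
Qed.

Lemma coheart_dsum_of E : coheart b E -> dsum_of indec (sigma E) E.
Proof.
have [KS _] := fin; move=> /KS[n dE].
apply: (@xgetPex _ _ [set n | dsum_of indec n E]); exists n.
by apply: dsum_of_impl dE => Y [PY]; exact: local_end_indecomposable.
Qed.

Lemma coheart_hdim E : coheart b E ->
  hdim T 0 E = (sigma E)%:R%:E /\ (forall k, k != 0 -> hdim T k E = 0%E).
Proof. by move=> /coheart_dsum_of/dsum_of_hdim. Qed.

Lemma shn_coheart_hdim k j F : coheart b F ->
  hdim T j (shn k F) = if j == k then (sigma F)%:R%:E else 0%E.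
Proof.
move=> /coheart_hdim[F0 FN]; rewrite hdim_shn; case: eqP => [->|jk].
  by rewrite subrr.
by apply: FN; rewrite subr_eq0; apply/eqP.
Qed.

Lemma mass_shn_coheart k F : coheart b F ->
  mass T t (shn k F) = ((sigma F)%:R * expR (k%:~R * t))%:E.
Proof.
move=> HF; apply: mass_concentrated => [|j jk]; rewrite shn_coheart_hdim //.
  by rewrite eqxx.
by rewrite (negbTE jk).
Qed.

Lemma mass_is_zero E : is_zero E -> mass T t E = 0%E.
Proof. by move=> E0; rewrite /mass esum1 // => i _; rewrite hdim_zero // mul0e. Qed.

Lemma weight_rcons (ell : D -> nat) s k F :
  weight ell t (rcons s (k, F)) =
  weight ell t s + (ell F)%:R * expR (k%:~R * t).
Proof. by rewrite /weight -cats1 big_cat big_seq1. Qed.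

Lemma cot_filtration_hdim0 E s j : cot_filtration b E s ->
  all (fun i => i < j) [seq x.1 | x <- s] -> hdim T j E = 0%E.
Proof.
elim/last_ind: s E => [|s [k F] IH] E.
  by move=> [_ _ /filtration_nil E0] _; exact: hdim_zero.
move=> /cot_filtration_rcons_inv[HF _ [X fX [f [g [h d]]]]].
rewrite map_rcons all_rcons => /andP[/= kj sj].
apply/eqP; rewrite eq_le hdim_ge0 andbT; apply: le_trans (hdim_le _ _ d) _.
by rewrite (IH X) // shn_coheart_hdim // gt_eqF // adde0.
Qed.

Lemma cot_filtration_mass_fun (g : D -> R) c E s : mass_fun t g -> 0 <= c ->
  (forall S, indec S -> g S <= c) ->
  cot_filtration b E s -> g E <= weight sigma t s * c.
Proof.
move=> mg c0 gc.
have gsum n X : dsum_of indec n X -> g X <= n%:R * c.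
  elim=> [Z Z0|Y Z S m HY _ IH d]; first by rewrite (mf_zero mg) // mul0r.
  rewrite -natr1 mulrDl mul1r addrC.
  by apply: le_trans (mf_dsum mg d) _; apply: lerD => //; exact: gc.
elim/last_ind: s E => [|s [k F] IH] E.
  move=> [_ _ /filtration_nil E0].
  by rewrite (mf_zero mg) // /weight big_nil mul0r.
move=> /cot_filtration_rcons_inv[HF _ [X fX d]].
rewrite weight_rcons mulrDl.
apply: le_trans (mf_triangle mg d) _; apply: lerD; first exact: IH.
rewrite (mf_shn mg) [leRHS]mulrAC mulrC ler_wpM2r ?expR_ge0 //.
exact: gsum (coheart_dsum_of HF).
Qed.

Lemma cot_filtration_mass_le E s : cot_filtration b E s ->
  (mass T t E <= (weight sigma t s)%:E)%E.
Proof.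
elim/last_ind: s E => [|s [k F] IH] E.
  by move=> [_ _ /filtration_nil E0]; rewrite mass_is_zero // /weight big_nil.
move=> /cot_filtration_rcons_inv[HF _ [X fX d]].
rewrite weight_rcons EFinD; apply: le_trans (mass_le _ _ d) _.
by apply: leeD; [exact: IH | rewrite mass_shn_coheart].
Qed.

Hypothesis indec_iso : forall E F (f : mor E F), indec E -> indec F ->
  ~ hnull T 0 f -> is_iso f.

(** The termination measure for cancellation: unlike the real-valued weight, it allows induction. *)
Let count (s : seq (int * D)) : nat := \sum_(x <- s) sigma x.2.

Let count_rcons s k F : count (rcons s (k, F)) = (count s + sigma F)%N.
Proof. by rewrite /count -cats1 big_cat big_seq1. Qed.

Lemma summand_sigma A B S k : indec A -> coheart b B -> coheart b S ->
  is_dsum (shn k A) (shn k B) (shn k S) -> sigma S = (sigma B).+1.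
Proof.
move=> HA HB HS d; have [CA _ _] := HA.
have := hdim_dsum T k d; rewrite !hdim_shn subrr (indec0 HA).
rewrite (coheart_hdim HB).1 (coheart_hdim HS).1 -EFinD => -[]/eqP.
by rewrite -(natrD _ 1) eqr_nat => /eqP.
Qed.

Lemma shn_summand k A C S : coheart b S -> is_dsum (shn k A) C (shn k S) ->
  exists2 B, coheart b B & isomorphic (shn k B) C.
Proof.
move=> HS d; exists (shn (- k) C); last exact: shnK.
apply: coheart_summand (is_dsum_sym (shn_dsum (- k) d)) _.
by apply: coheart_iso HS; exact/isomorphic_sym/shnKV.
Qed.

(** Up to the identification of shifts, the connecting map between adjacent factors is the k-th
    shift of a map [d : F -> F']. An entry of [d] that is nonzero on cohomology is an isomorphism,
    and both factors lose that indecomposable. *)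
Lemma cancel_indecomposable Y0 Y1 Y2 k F F' (f1 : mor Y0 Y1)
    (g1 : mor Y1 (shn (k - 1) F')) (h1 : mor (shn (k - 1) F') (sh Y0))
    (f2 : mor Y1 Y2) (g2 : mor Y2 (shn k F)) (h2 : mor (shn k F) (sh Y1)) :
  coheart b F -> coheart b F' -> dist f1 g1 h1 -> dist f2 g2 h2 ->
  ~ hnull T k (fmor sh g1 ∘ h2) ->
  exists Y' B B', [/\ coheart b B, coheart b B', sigma F = (sigma B).+1,
    sigma F' = (sigma B').+1 &
    triangle Y0 Y' (shn (k - 1) B') /\ triangle Y' Y2 (shn k B)].
Proof.
move=> HF HF' d1 d2 nn; have [x xi] := sh_shn_pred k F'.
have [d ed] := shf_full (x ∘ (fmor sh g1 ∘ h2)).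
have nd : ~ hnull T 0 d.
  move=> /(hnull_shn k); rewrite add0r -ed => /(hnull_iso_l xi); exact: nn.
have [A [i [p [HA pi ni]]]] := hnull_dsum_src (coheart_dsum_of HF) nd.
have [A' [i' [p' [HA' _ ni']]]] := hnull_dsum_tgt (coheart_dsum_of HF') ni.
have [z [zl _]] := indec_iso HA HA' ni'.
have pi_k : fmor (shf D k) p ∘ fmor (shf D k) i = idm (shn k A).
  by rewrite -Defs.fmap_comp pi Defs.fmap_id.
have [Bk [q [r da]]] := dist_ex (fmor (shf D k) i).
have [C [m [n dm]]] := dist_ex (fmor sh g1 ∘ (h2 ∘ fmor (shf D k) i)).
have dB : is_dsum (shn k A) Bk (shn k F) := dist_split da pi_k.
(* Because the chosen entry is invertible, the map out of [shn k A] is a split monomorphism, with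
   retraction built from [z ∘ p']. *)
have dC : is_dsum (shn k A) C (sh (shn (k - 1) F')).
  apply: (dist_split (r := fmor (shf D k) (z ∘ p') ∘ x) dm).
  have e : x ∘ (fmor sh g1 ∘ (h2 ∘ fmor (shf D k) i)) = fmor (shf D k) (d ∘ i).
    by rewrite Defs.fmap_comp -ed !comp_assoc.
  by rewrite -comp_assoc [X in _ ∘ X]e -Defs.fmap_comp -comp_assoc zl Defs.fmap_id.
have [Y' [t1 t2]] := cancel_connecting d1 d2 da dm.
have dC' : is_dsum (shn k A) C (shn k F').
  exact: is_dsum_iso_sum (sh_shn_pred k F') dC.
have [B HB eB] := shn_summand HF dB.
have [B' HB' eB'] := shn_summand HF' dC'.
exists Y', B, B'; split=> //.
- apply: (summand_sigma (k := k) HA) => //.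
  by apply/is_dsum_sym; apply: is_dsum_iso (isomorphic_sym eB) (is_dsum_sym dB).
- apply: (summand_sigma (k := k) HA) => //.
  by apply/is_dsum_sym; apply: is_dsum_iso (isomorphic_sym eB') (is_dsum_sym dC').
split; last first.
  by apply: triangle_iso t2 => //; try exact: isomorphic_refl; exact: isomorphic_sym.
apply: triangle_iso t1; try exact: isomorphic_refl.
apply: isomorphic_trans (fmap_isomorphic ush (isomorphic_sym eB')) _.
by have := shnD (-1) k B'; rewrite addrC.
Qed.

(** The degrees are kept, exhausted factors remaining as zero objects, so that an improved
    filtration of the penultimate object can still be extended by the last factor. *)
Lemma cot_filtration_improve E s : cot_filtration b E s ->
  mass T t E = (weight sigma t s)%:E \/
  exists s', [/\ cot_filtration b E s', [seq x.1 | x <- s'] = [seq x.1 | x <- s]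
    & (count s' < count s)%N].
Proof.
elim/last_ind: s E => [|s [k F] IH] Y2.
  by move=> [_ _ /filtration_nil E0]; left; rewrite mass_is_zero // /weight big_nil.
move=> /cot_filtration_rcons_inv[HF sk [Y1 fY1 d2]].
have [mY1|[s' [fs' e' c']]] := IH Y1 fY1; last first.
  right; exists (rcons s' (k, F)); rewrite !map_rcons e' !count_rcons ltn_add2r.
  by split=> //; apply: cot_filtration_rcons fs' _ HF d2; rewrite e'.
have [f2 [g2 [h2 {}d2]]] := d2.
have [h2_0|/existsNP[j nj]] := pselect (forall j, hnull T j h2).
  left; rewrite (dist_hnull t d2 h2_0).2 mY1 mass_shn_coheart //.
  by rewrite weight_rcons EFinD.
(* The top factor has cohomology in degree [k] only, so a connecting map can act nowhere else. *)
have jk : j = k.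
  apply/eqP; apply: contrapT => /negP jk; apply: nj; apply: hnull_dim0; left.
  by rewrite shn_coheart_hdim // (negbTE jk).
subst j; have nY1 : hdim T (k - 1) Y1 <> 0%E.
  move=> Y10; apply: nj; apply: hnull_dim0; right.
  by rewrite -[k](subrK 1) hdim_sh.
right; elim/last_ind: s IH {mY1} sk fY1 => [|s [k' F'] _] _.
  by move=> sk fY1; case: nY1; exact: cot_filtration_hdim0 fY1 _.
rewrite map_rcons all_rcons => /andP[/= k'k sk] fY1.
have [HF' sk' [Y0 fY0 d1]] := cot_filtration_rcons_inv fY1.
(* All factors of [Y1] lie below [k]; if the last one were also below [k - 1], then [Y1] would
   vanish in degree [k - 1]. *)
have ek : k' = k - 1.
  apply/eqP; apply: contrapT => /negP k'N; apply: nY1.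
  apply: cot_filtration_hdim0 fY1 _; rewrite map_rcons all_rcons /=.
  by apply/andP; split; [|apply: sub_all sk' => i /=]; lia.
subst k'; have [f1 [g1 [h1 {}d1]]] := d1.
(* The factors of [Y0] lie below [k - 1], so [sh Y0] vanishes in degree [k] and projecting from
   [sh Y1] to the shifted factor loses nothing there. *)
have nn : ~ hnull T k (fmor sh g1 ∘ h2).
  move=> H; apply: nj; apply: (hnull_cancel ((dist_rot3 _ _ _).1 d1)).
    by rewrite -[k](subrK 1) hdim_sh (cot_filtration_hdim0 fY0).
  by rewrite compNl; exact: hnullN.
have [Y' [B [B' [HB HB' eF eF' [t1 t2]]]]] :=
  cancel_indecomposable HF HF' d1 d2 nn.
exists (rcons (rcons s (k - 1, B')) (k, B)); split.
- apply: cot_filtration_rcons (cot_filtration_rcons fY0 sk' HB' t1) _ HB t2.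
  by rewrite map_rcons all_rcons /= sk andbT; lia.
- by rewrite !map_rcons.
- by rewrite !count_rcons eF eF'; lia.
Qed.

Lemma cot_filtration_mass_ex E : cot_bounded b ->
  exists2 s, cot_filtration b E s & mass T t E = (weight sigma t s)%:E.
Proof.
move=> /(cot_filtration_ex E)[s fs].
elim: (count s).+1 {-2}s (ltnSn (count s)) fs => // n IH {}s sn fs.
have [e|[s' [fs' _ ss']]] := cot_filtration_improve fs; first by exists s.
by apply: IH fs'; rewrite (leq_trans ss').
Qed.

Hypothesis bdd : cot_bounded b.

Lemma delta_cot_mass E : delta_cot b t E = mass T t E.
Proof.
apply/eqP; rewrite eq_le; apply/andP; split.
  have [s fs ->] := cot_filtration_mass_ex E bdd.
  by apply: ereal_inf_lbound; exists s.
by apply: le_ereal_inf_tmp => _ [s [fs ->]]; exact: cot_filtration_mass_le.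
Qed.

Theorem cot_entropy (Phi : exact_functor D D) (G0 : D) : split_generator G0 ->
  log_growth (fun N => mass T t (iter N Phi G0)) @ \oo --> entropy_cot b t Phi.
Proof.
move=> Ggen; have [_ [n [S SP]]] := fin.
have -> : entropy_cot b t Phi = ereal_sup [set h | exists E : D,
    h = limn_esup (log_growth (fun N => mass T t (iter N Phi E)))].
  rewrite /entropy_cot; under eq_fun do under eq_exists do under eq_fun do
    rewrite delta_cot_mass.
  by [].
apply: (mass_entropy (S := S)) Ggen => [X|g mg c c0 gc E].
  by have [s _ ->] := cot_filtration_mass_ex X bdd; rewrite ltry.
have [s fs ->] := cot_filtration_mass_ex E bdd.
rewrite -EFinM lee_fin; apply: cot_filtration_mass_fun fs => // S' HS.
by have [i /(mf_iso mg) ->] := SP _ HS.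
Qed.

End Dimensions.
End CotStructures.

(** * The theorem *)

Section UnitCohomology.
Variables (R : realType) (K : fieldType).

Lemma dim_cohomology_unit (C : Db K) (i : int) :
  isomorphic C (unit_cx K : Db K) ->
  dimE R (cohomology C i) = if i == 0 then 1%E else 0%E.
Proof.
move=> [u [v [vu uv]]]; rewrite -(dim_unit_cx K R i).
have inj (C' C'' : Db K) (f : mor C' C'') (g : mor C'' C') : g ∘ f = idm C' ->
    (dimE R (cohomology C' i) <= dimE R (cohomology C'' i))%E.
  move=> gf; apply: (dimE_inj R (@Hmap_linear _ _ _ i f)) => x fx.
  by rewrite -[x]Hmap_id -[db_class _]gf Hmap_comp fx Hmap_0.
by apply/eqP; rewrite eq_le (inj _ _ u v) // (inj _ _ v u).
Qed.

Variables (D : tricat K) (t : R).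

(** The substitution of [- k] for [k] turns degree [- k] with exponent [- k t] into degree [k] with
    exponent [k t]. *)
Lemma mass_contravariant (Gamma : exact_functor (op_shiftcat D) (Db K)) :
  (fun X : D => coh_sum (- t) (Gamma X)) = mass (contravariant_theory R Gamma) t.
Proof.
apply/funext => X; rewrite /coh_sum (reindex_esum [set: int] _ (fun k => - k)).
  by apply: eq_esum => k _; rewrite opprK mulrNz mulrNN.
by split=> [//|x y _ _ /oppr_inj //|y _]; exists (- y); rewrite ?opprK.
Qed.

End UnitCohomology.

Theorem theorem1p4 (R : realType) (K : closedFieldType) (D : tricat K)
    (D_idem : idempotent_complete D) (Phi : exact_functor D D)
    (Phi_nonnil : forall N : nat, (0 < N)%N ->
       ~ (forall X : D, is_zero (iter N Phi X)))
    (t : R) :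
  (* covariant case *)
  (forall Gamma : exact_functor D (Db K),
    (forall a : t_structure D, t_bounded a -> finite_heart a ->
      (forall E : D, simple_in (heart a) E ->
         isomorphic (Gamma E) (unit_cx K : Db K)) ->
      forall G : D, split_generator G ->
        log_growth (fun N => coh_sum t (Gamma (iter N Phi G))) @ \oo
          --> entropy_t a t Phi)
    /\
    (forall b : cot_structure D, cot_bounded b -> finite_coheart b ->
      (forall E : D, indecomposable_in (coheart b) E ->
         isomorphic (Gamma E) (unit_cx K : Db K)) ->
      (forall (E F : D) (f : mor E F),
         indecomposable_in (coheart b) E -> indecomposable_in (coheart b) F ->
         fmor Gamma f <> 0 -> is_iso f) ->
      forall G : D, split_generator G ->
        log_growth (fun N => coh_sum t (Gamma (iter N Phi G))) @ \oo
          --> entropy_cot b t Phi))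
  /\
  (* contravariant case *)
  (forall Gamma : exact_functor (op_shiftcat D) (Db K),
    (forall a : t_structure D, t_bounded a -> finite_heart a ->
      (forall E : D, simple_in (heart a) E ->
         isomorphic (Gamma E) (unit_cx K : Db K)) ->
      forall G : D, split_generator G ->
        log_growth (fun N => coh_sum (- t) (Gamma (iter N Phi G))) @ \oo
          --> entropy_t a t Phi)
    /\
    (forall b : cot_structure D, cot_bounded b -> finite_coheart b ->
      (forall E : D, indecomposable_in (coheart b) E ->
         isomorphic (Gamma E) (unit_cx K : Db K)) ->
      (forall (E F : D) (f : mor E F),
         indecomposable_in (coheart b) E -> indecomposable_in (coheart b) F ->
         fmor Gamma (f : mor (F : op_shiftcat D) E) <> 0 -> is_iso f) ->
      forall G : D, split_generator G ->
        log_growth (fun N => coh_sum (- t) (Gamma (iter N Phi G))) @ \oo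
          --> entropy_cot b t Phi)).
Proof.
split=> Gamma.
- have dimS E k : isomorphic (Gamma E) (unit_cx K : Db K) ->
      hdim (covariant_theory R Gamma) k E = if k == 0 then 1%E else 0%E.
    by move=> e; rewrite hdim_covariant dim_cohomology_unit // oppr_eq0.
  split=> [a abdd afin simpleK G Ggen|b bbdd bfin indecK indec_iso G Ggen];
    (* In the covariant case the two sums agree by unfolding, so a change by conversion suffices. *)
    rewrite -[X in log_growth X]/(fun N => mass (covariant_theory R Gamma) t (iter N Phi G)).
  + apply: t_entropy => // [S HS|S k HS k0]; rewrite dimS //; first exact: simpleK.
      by rewrite (negbTE k0).
    exact: simpleK.
  + apply: cot_entropy => // [S HS|S k HS k0|E F f HE HF nf].
    * by rewrite dimS //; exact: indecK.
    * by rewrite dimS ?(negbTE k0) //; exact: indecK.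
    * by apply: indec_iso => // f0; apply: nf; exact: hnull_covariant.
- have dimS E k : isomorphic (Gamma E) (unit_cx K : Db K) ->
      hdim (contravariant_theory R Gamma) k E = if k == 0 then 1%E else 0%E.
    by move=> e; rewrite hdim_contravariant dim_cohomology_unit.
  split=> [a abdd afin simpleK G Ggen|b bbdd bfin indecK indec_iso G Ggen];
    have -> : (fun N => coh_sum (- t) (Gamma (iter N Phi G))) =
      (fun N => mass (contravariant_theory R Gamma) t (iter N Phi G))
      by apply/funext => N; rewrite -mass_contravariant.
  + apply: t_entropy => // [S HS|S k HS k0]; rewrite dimS //; first exact: simpleK.
      by rewrite (negbTE k0).
    exact: simpleK.
  + apply: cot_entropy => // [S HS|S k HS k0|E F f HE HF nf].
    * by rewrite dimS //; exact: indecK.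
    * by rewrite dimS ?(negbTE k0) //; exact: indecK.
    * by apply: indec_iso => // f0; apply: nf; exact: hnull_contravariant.
Qed.
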